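(* Let $(R,G)$ be a marked elliptic root system whose affine quotient $R/G$ is non-reduced, let $X_l$ be the type of $R/G$ (one of $BCC_l$ $(l\ge1)$, $C^\vee BC_l$ $(l\ge1)$, $BB^\vee_l$ $(l\ge2)$, $C^\vee C_l$ $(l\ge1)$), and let $(\Pi^{\mathrm{dc}},\Pi^{\mathrm{mc}})$ be a paired simple system of $(R,G)$. Then, after a suitable choice of numbering $\Pi^{\mathrm{dc}}=\{\alpha_0,\dots,\alpha_l\}$, the elliptic diagram $\Gamma(R,G)$ is one of those in the list of type $X_l$ given in the context; that is, for this numbering $(R,G)$ realizes one of the rows of the list for $X_l$.
   Context: Root systems. Let $F$ be a finite-dimensional real vector space with a symmetric bilinear form $I$. For $\alpha\in F$ with $I(\alpha,\alpha)\ne0$ put $\alpha^\vee=2\alpha/I(\alpha,\alpha)$ and $r_\alpha(\lambda)=\lambda-I(\alpha^\vee,\lambda)\alpha$. A root system belonging to $(F,I)$ is a subset $R\subset F\setminus\{0\}$ such that: (R1) the subgroup $Q(R)$ generated by $R$ is a full lattice in $F$; (R2) $I(\alpha,\alpha)\neq0$ for $\alpha\in R$; (R3) $r_\alpha(R)=R$ for $\alpha\in R$; (R4) $I(\alpha^\vee,\beta)\in\mathbb Z$ for $\alpha,\beta\in R$; (R5) if $R=R_1\sqcup R_2$ with $R_1\perp R_2$, then $R_1=\emptyset$ or $R_2=\emptyset$. $R$ is reduced if $\alpha,c\alpha\in R$ ($c\in\mathbb R$) implies $c=\pm1$, otherwise non-reduced. $R$ is elliptic if $I$ has signature $(l,2,0)$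 ($l\ge1$ positive directions, $2$-dimensional radical, no negative direction), affine if the signature is $(l,1,0)$. A marked elliptic root system (mERS) is a pair $(R,G)$ with $R$ elliptic and $G\subset\mathrm{rad}(I)$ a one-dimensional subspace such that $G\cap Q(R)$ has rank $1$. Let $\pi_G:F\to F/G$ be the projection, $\bar\alpha=\pi_G(\alpha)$; the affine quotient $R/G=\pi_G(R)$ is an affine root system for the induced form $I_{F/G}$. Root systems are isomorphic if a linear isomorphism of ambient spaces maps one onto the other. Non-reduced affine root systems, in $\bigoplus_{i=1}^l\mathbb R\varepsilon_i\oplus\mathbb Rb$ ($\varepsilon_i$ orthonormal, radical $\mathbb Rb$), with $B_s=\{\pm\varepsilon_i\}$, $B_m=\{\pm\varepsilon_i\pm\varepsilon_j\}_{i<j}$, $B_l=\{\pm2\varepsilon_i\}$: $BCC_l=(B_s\cup B_m\cup B_l)+\mathbb Zb$; $C^\vee BC_l=(B_s+\mathbb Zb)\cup(B_m+2\mathbb Zb)\cup(B_l+4\mathbb Zb)$; $BB_l^\vee=(B_s+\mathbb Zb)\cup(B_m+\mathbb Zb)\cup(B_l+2\mathbb Zb)$; $C^\vee C_l=(B_s+\mathbb Zb)\cup(B_m+2\mathbb Zb)\cup(B_l+2\mathbb Zb)$. Standard simple systems $\beta_0,\dots,\beta_l$: $\beta_i=\varepsilon_i-\varepsilon_{i+1}$ ($1\le i<l$), $\beta_l=\varepsilon_l$, and $\beta_0=b-2\varepsilon_1$ for $BCC_l$, $\beta_0=b-\varepsilon_1$ for $C^\vee BC_l$ and $C^\vee C_l$,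 $\beta_0=b-\varepsilon_1-\varepsilon_2$ for $BB_l^\vee$. Paired simple systems. Fix a generator $a$ of $Q(R)\cap G$. For $\alpha\in R$ put $k(\alpha)=\min\{k\in\mathbb Z_{>0}:\alpha+ka\in R\}$ (counting number) and $\alpha^\ast=\alpha+k(\alpha)a$. Let $R^{\mathrm{dc}}=\{\alpha\in R:\frac12\alpha\notin R\}$. For $\alpha\in R$ define $\alpha'\in R$: $\alpha'=\alpha$ if $2\bar\alpha\notin R/G$; otherwise $\alpha'$ is the unique element of $R\cap\pi_G^{-1}(2\bar\alpha)$ with $\alpha'\in2\alpha+\mathbb Z_{\le0}a$ and $(\alpha')^\ast\in2\alpha+\mathbb Z_{>0}a$. A simple system of an affine root system is a basis of the ambient space consisting of roots such that every root is an integral combination of it with all coefficients $\ge0$ or all $\le0$. A paired simple system is a pair $(\Pi^{\mathrm{dc}},\Pi^{\mathrm{mc}})$ where $\Pi^{\mathrm{dc}}=\{\alpha_0,\dots,\alpha_l\}\subset R^{\mathrm{dc}}$ has image a simple system of $R^{\mathrm{dc}}/G$ (equivalently of $R/G$), satisfies: if some $\beta\in\pi_G^{-1}(\bar\alpha_i)\cap R$ has $2\beta\notin R$ then $2\alpha_i\notin R$; and $\Pi^{\mathrm{mc}}=\{\alpha_0',\dots,\alpha_l'\}$. Exponents. For $x,y$ with $\bar x=c\bar y\ne0$ put $(x:y)_G=c$. For $\alpha\in\Pi^{\mathrm{dc}}$ define $k^{\mathrm{nr}}(\alpha)$ by $\alpha=(\alpha:(\alpha')^\ast)_G(\alpha')^\ast-k^{\mathrm{nr}}(\alpha)a$.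 Let $I_R$ be the positive multiple of $I$ such that the values $I_R(\alpha,\alpha)$, $\alpha\in R$, are integers with gcd $2$. Let $n_\alpha$ ($\alpha\in\Pi^{\mathrm{dc}}$) be the positive integers such that $\sum n_\alpha\bar\alpha$ generates $Q(R/G)\cap\mathrm{rad}(I_{F/G})$. The exponent is $m_\alpha=\frac{I_R(\alpha,\alpha)}{2k^{\mathrm{nr}}(\alpha)}n_\alpha$; $m_{\max}=\max_\alpha m_\alpha$. A node $\alpha\in\Pi^{\mathrm{dc}}$ is collapsed if $m_\alpha<m_{\max}$. Elliptic diagram. The node set of $\Gamma(R,G)$ is $\Pi^{\mathrm{dc}}\sqcup\{(\alpha')^\ast:\alpha\in\Pi^{\mathrm{dc}}\text{ not collapsed}\}$. A node $\gamma$ is black (b) if $2\gamma\in R$ or $\frac12\gamma\in R$; gray (g) if $2\gamma,\frac12\gamma\notin R$ but $2\bar\gamma\in R/G$ or $\frac12\bar\gamma\in R/G$; white otherwise. Edges between nodes $\alpha,\beta$ record the integers $I(\alpha,\beta^\vee),I(\beta,\alpha^\vee)$. Realizing a row. $(R,G)$ (with a numbered $\Pi^{\mathrm{dc}}$) realizes a row of the list for $X_l$ if $\bar\alpha_i\mapsto\beta_i$ ($0\le i\le l$) extends to an isomorphism of root systems from $R/G$ onto $X_l$, the collapsed nodes of $\Pi^{\mathrm{dc}}$ are exactly those indicated, and the colours and counting numbers are those indicated. Nodes for which no colour is given are white. ''$\times$'' means that the node is absent from the diagram. For nodes $\alpha_i$ with $2\bar\alpha_i\notin R/G$ one always has $k((\alpha_i')^\ast)=k(\alpha_i)$.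 The nodes $\alpha_i$ called ''middle'' are never collapsed. List for $BCC_l$ (middle nodes $\alpha_1,\dots,\alpha_{l-1}$). Format: [colour of $\alpha_l$, colour of $(\alpha_l')^\ast$; $k(\alpha_0)$, $k(\alpha_i)$ for middle $i$, $k(\alpha_l)$; $k((\alpha_l')^\ast)$]. No collapsed nodes: 1 [g,g;1,1,1;2], 2 [g,b;2,2,1;4], 3 [b,g;1,1,1;1], 4 [b,b;2,2,1;2]. Only $\alpha_l$ collapsed: 5 [b,×;1,1,1;2]. Only $\alpha_0$ collapsed: 6 [g,g;2,1,1;2], 7 [g,b;4,2,1;4], 8 [b,g;2,1,1;1], 9 [b,b;4,2,1;2]. $\alpha_0$ and $\alpha_l$ collapsed ($l\ge2$): 10 [b,×;2,1,1;2]. List for $C^\vee BC_l$ (middle nodes $\alpha_1,\dots,\alpha_{l-1}$, same format). No collapsed nodes: 1 [g,g;1,2,2;4], 2 [g,b;1,2,1;4], 3 [b,g;1,2,2;2], 4 [b,b;1,2,1;2]. Only $\alpha_l$ collapsed: 5 [b,×;1,2,2;4]. Only $\alpha_0$ collapsed: 6 [g,g;1,1,1;2], 7 [g,b;2,2,1;4], 8 [b,g;1,1,1;1], 9 [b,b;2,2,1;2]. $\alpha_0$ and $\alpha_l$ collapsed ($l\ge2$): 10 [b,×;1,1,1;2]. List for $BB_l^\vee$, $l\ge3$ (middle nodes $\alpha_2,\dots,\alpha_{l-1}$; $\alpha_0,\alpha_1$ always collapsed). Format: [colour of $\alpha_l$, colour of $(\alpha_l')^\ast$; $k(\alpha_0)=k(\alpha_1)$,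 $k(\alpha_i)$ for middle $i$, $k(\alpha_l)$; $k((\alpha_l')^\ast)$]. $\alpha_l$ not collapsed: 1 [g,g;1,1,1;2], 2 [g,b;2,2,1;4], 3 [b,g;1,1,1;1], 4 [b,b;2,2,1;2]. $\alpha_l$ collapsed: 5 [b,×;1,1,1;2]. List for $BB_2^\vee$ ($\alpha_2$ never collapsed). Format: [colour of $\alpha_2$, colour of $(\alpha_2')^\ast$; $k(\alpha_0),k(\alpha_1),k(\alpha_2)$; $k((\alpha_2')^\ast)$]. No collapsed nodes: 1 [b,b;1,1,1;2]. Only $\alpha_0$ collapsed: 2 [b,b;2,1,1;2]. $\alpha_0,\alpha_1$ collapsed: 3 [g,g;1,1,1;2], 4 [g,b;2,2,1;4], 5 [b,g;1,1,1;1], 6 [b,b;2,2,1;2]. List for $C^\vee C_l$ (middle nodes $\alpha_1,\dots,\alpha_{l-1}$). Format: [colours of $\alpha_0,(\alpha_0')^\ast$; colours of $\alpha_l,(\alpha_l')^\ast$; $k(\alpha_0),k((\alpha_0')^\ast)$; $k(\alpha_i)$ for middle $i$; $k(\alpha_l),k((\alpha_l')^\ast)$]. No collapsed nodes: 1 [g,g;g,g;1,2;1;1,2], 2 [g,g;g,b;2,4;2;1,4], 3 [g,g;b,g;1,2;1;1,1], 4 [g,g;b,b;2,4;2;1,2], 5 [g,b;g,b;1,4;2;1,4], 6 [g,b;b,g;1,4;2;2,2], 7 [g,b;b,b;1,4;2;1,2], 8 [b,g;b,g;1,1;1;1,1], 9 [b,g;b,b;2,2;2;1,2], 10 [b,b;b,b;1,2;2;1,2].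 Only $\alpha_0$ collapsed: 11 [b,×;g,g;1,2;1;1,2], 12 [b,×;g,b;2,4;2;1,4], 13 [b,×;b,g;1,2;1;1,1], 14 [b,×;b,b;2,4;2;1,2]. $\alpha_0$ and $\alpha_l$ collapsed ($l\ge2$): 15 [b,×;b,×;1,2;1;1,2]. *)

(* Defs.v *)
From HB Require Import structures.
From mathcomp Require Import all_boot all_order all_algebra.
From mathcomp Require Import all_classical all_reals.

Set Implicit Arguments.
Unset Strict Implicit.
Unset Printing Implicit Defensive.

Import Order.TTheory GRing.Theory Num.Theory.
Local Open Scope classical_set_scope.
Local Open Scope ring_scope.

(* The scalar field of real numbers is called K, so that R is free for root
   systems. *)

Definition coroot_refl (K : realType) (F : vectType K) (I : {symmetric F})
    (x y : F) : F := y - I ((2 / I x x) *: x) y *: x.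

Definition root_lattice (K : realType) (E : vectType K) (R : set E) : set E :=
  [set x | exists n (v : 'I_n -> E) (c : 'I_n -> int),
     (forall i, R (v i)) /\ x = \sum_(i < n) v i *~ c i].

Definition full_lattice (K : realType) (E : vectType K) (L : set E) : Prop :=
  exists2 s : seq E, basis_of fullv s &
    L = [set x | exists c : 'I_(size s) -> int, x = \sum_(i < size s) s`_i *~ c i].

Definition root_system (K : realType) (F : vectType K) (I : {symmetric F})
    (R : set F) : Prop :=
  ~ R 0 /\
  [/\ full_lattice (root_lattice R),
      (forall x, R x -> I x x != 0),
      (forall x, R x -> coroot_refl I x @` R = R),
      (forall x y, R x -> R y ->
         exists z : int, I ((2 / I x x) *: x) y = z%:~R) &
      (forall R1 R2 : set F, R = R1 `|` R2 -> R1 `&` R2 = set0 ->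
         (forall x y, R1 x -> R2 y -> I x y = 0) -> R1 = set0 \/ R2 = set0)].

Definition reduced (K : realType) (E : vectType K) (R : set E) : Prop :=
  forall (x : E) (c : K), R x -> R (c *: x) -> c = 1 \/ c = -1.

(* [p], [z], [n]: number of positive, null and negative directions, in this
   order. *)
Definition has_signature (K : realType) (F : vectType K) (I : {symmetric F})
    (p z n : nat) : Prop :=
  exists e : (p + z + n).-tuple F,
    [/\ basis_of fullv e,
        (forall i j : 'I_(p + z + n), i != j -> I (tnth e i) (tnth e j) = 0) &
        (forall i : 'I_(p + z + n),
           let q := I (tnth e i) (tnth e i) in
           [/\ (i < p)%N -> 0 < q, (p <= i < p + z)%N -> q = 0 &
               (p + z <= i)%N -> q < 0])].

Definition elliptic (K : realType) (F : vectType K) (I : {symmetric F})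
    (R : set F) : Prop :=
  root_system I R /\ exists2 l : nat, (1 <= l)%N & has_signature I l 2 0.

Definition radical (K : realType) (E : vectType K) (J : E -> E -> K) : set E :=
  [set x | forall y, J x y = 0].

Definition generated_by (K : realType) (E : vectType K) (x : E) (A : set E) :
  Prop := A = [set x *~ z | z in [set: int]].

Definition mERS (K : realType) (F : vectType K) (I : {symmetric F})
    (R : set F) (G : {vspace F}) : Prop :=
  [/\ elliptic I R, [set` G] `<=` radical I, \dim G = 1%N &
      exists2 a : F, a != 0 & generated_by a (root_lattice R `&` [set` G])].

(* The quotient F/G is realised on a complement of G, with the projection
   along G; see [lker_quot_proj], [limg_quot_proj] and [quot_formE]. *)
Definition quot (K : realType) (F : vectType K) (G : {vspace F}) :
  vectType K := subvs_of (G^C)%VS.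

Definition quot_proj (K : realType) (F : vectType K) (G : {vspace F}) :
    'Hom(F, quot G) :=
  linfun (vsproj (G^C)%VS \o daddv_pi (G^C)%VS G).

Definition quot_form (K : realType) (F : vectType K) (I : {symmetric F})
    (G : {vspace F}) (x y : quot G) : K := I (vsval x) (vsval y).

Lemma quot_projE (K : realType) (F : vectType K) (G : {vspace F}) (x : F) :
  vsval (quot_proj G x) = daddv_pi (G^C)%VS G x.
Proof. by rewrite /quot_proj lfunE /= vsprojK ?memv_pi. Qed.

Lemma quot_proj_split (K : realType) (F : vectType K) (G : {vspace F}) (x : F) :
  x = vsval (quot_proj G x) + daddv_pi G (G^C)%VS x.
Proof.
rewrite quot_projE daddv_pi_add //; first by rewrite capvC capv_compl.
by rewrite addvC addv_complf memvf.
Qed.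

Lemma lker_quot_proj (K : realType) (F : vectType K) (G : {vspace F}) :
  lker (quot_proj G) = G.
Proof.
apply/vspaceP => x; rewrite memv_ker; apply/eqP/idP => [px0|xG].
  by rewrite (quot_proj_split G x) px0 linear0 add0r memv_pi.
apply: val_inj => /=; rewrite quot_projE.
have := quot_proj_split G x; rewrite quot_projE.
rewrite [daddv_pi G _ x]daddv_pi_id ?capv_compl //.
by move=> /(congr1 (fun y => y - x)); rewrite subrr addrK => <-.
Qed.

Lemma limg_quot_proj (K : realType) (F : vectType K) (G : {vspace F}) :
  limg (quot_proj G) = fullv.
Proof.
apply/vspaceP => y; rewrite memvf.
have -> : y = quot_proj G (vsval y).
  apply: val_inj => /=.
  by rewrite quot_projE daddv_pi_id ?subvsP // capvC capv_compl.
by rewrite memv_img ?memvf.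
Qed.

Lemma quot_formE (K : realType) (F : vectType K) (I : {symmetric F})
    (G : {vspace F}) (x y : F) : [set` G] `<=` radical I ->
  quot_form I (quot_proj G x) (quot_proj G y) = I x y.
Proof.
move=> Grad.
have Gl u v : u \in G -> I u v = 0 by move=> uG; exact: (Grad u uG).
have Gr u v : v \in G -> I u v = 0.
  by move=> vG; rewrite hermC /= Gl // expr0 mul1r.
rewrite [in RHS](quot_proj_split G x) [in RHS](quot_proj_split G y).
by rewrite linearDl linearDr /= [I (daddv_pi _ _ x) _]Gl ?memv_pi // addr0
           [I _ (daddv_pi _ _ y)]Gr ?memv_pi // addr0.
Qed.

Definition quot_roots (K : realType) (F : vectType K) (G : {vspace F})
    (R : set F) : set (quot G) := quot_proj G @` R.
Arguments quot_roots {K F} G R.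

Definition root_system_iso (K : realType) (E E' : vectType K)
    (R : set E) (R' : set E') (f : {linear E -> E'}) : Prop :=
  bijective f /\ f @` R = R'.

(* [CvBC], [BBv] and [CvC] stand for the types with a dual superscript:
   C^vee BC_l, BB_l^vee and C^vee C_l. *)
Inductive nr_type := BCC | CvBC | BBv | CvC.

Definition nr_rank_ok (X : nr_type) (l : nat) : bool :=
  if X is BBv then (2 <= l)%N else (1 <= l)%N.

(* The space R eps_1 + ... + R eps_l + R b is 'rV_l.+1: coordinate 0 is the
   coefficient of b, and eps_i is meant for 1 <= i <= l. *)
Definition vb (K : realType) (l : nat) : 'rV[K]_l.+1 := delta_mx 0 ord0.
Definition eps (K : realType) (l i : nat) : 'rV[K]_l.+1 := delta_mx 0 (inord i).

Definition shortB (K : realType) (l : nat) : set 'rV[K]_l.+1 :=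
  [set x | exists (i : nat) (s : bool),
     (1 <= i <= l)%N /\ x = (-1) ^+ s *: eps K l i].
Definition midB (K : realType) (l : nat) : set 'rV[K]_l.+1 :=
  [set x | exists (i j : nat) (s t : bool),
     [/\ (1 <= i)%N, (i < j)%N, (j <= l)%N &
         x = (-1) ^+ s *: eps K l i + (-1) ^+ t *: eps K l j]].
Definition longB (K : realType) (l : nat) : set 'rV[K]_l.+1 :=
  [set x | exists (i : nat) (s : bool),
     (1 <= i <= l)%N /\ x = (-1) ^+ s *: (2 *: eps K l i)].

Arguments shortB : clear implicits.
Arguments midB : clear implicits.
Arguments longB : clear implicits.

Definition plusZb (K : realType) (l : nat) (B : set 'rV[K]_l.+1) (m : nat) :
    set 'rV[K]_l.+1 :=
  [set x | exists (y : 'rV[K]_l.+1) (z : int), B y /\ x = y + vb K l *~ (m%:Z * z)].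

Definition affine_roots (K : realType) (X : nr_type) (l : nat) :
    set 'rV[K]_l.+1 :=
  let: (ms, mm, ml) := match X with
    | BCC => (1, 1, 1)
    | CvBC => (1, 2, 4)
    | BBv => (1, 1, 2)
    | CvC => (1, 2, 2)
    end%N in
  plusZb (shortB K l) ms `|` plusZb (midB K l) mm `|` plusZb (longB K l) ml.

Arguments affine_roots : clear implicits.

Definition std_simple (K : realType) (X : nr_type) (l i : nat) : 'rV[K]_l.+1 :=
  if i == 0%N then
    match X with
    | BCC => vb K l - 2 *: eps K l 1
    | CvBC | CvC => vb K l - eps K l 1
    | BBv => vb K l - eps K l 1 - eps K l 2
    end
  else if i == l then eps K l l
  else eps K l i - eps K l i.+1.

Section Marked.
Variables (K : realType) (F : vectType K) (I : {symmetric F}).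
Variables (R : set F) (G : {vspace F}) (a : F).

Local Notation pi := (quot_proj G).
Local Notation RG := (quot_roots G R).

Definition counting (x : F) : nat :=
  xget 0%N [set k : nat | [/\ (0 < k)%N, R (x + a *+ k) &
    forall j : nat, (0 < j)%N -> R (x + a *+ j) -> (k <= j)%N]].

Definition star (x : F) : F := x + a *+ counting x.

Definition Rdc : set F := [set x | R x /\ ~ R (2^-1 *: x)].

Definition primed (x : F) : F :=
  if `[< RG (2 *: pi x) >] then
    xget 0 [set y | [/\ R y, pi y = 2 *: pi x,
      exists n : nat, y = 2 *: x - a *+ n &
      exists2 n : nat, (0 < n)%N & star y = 2 *: x + a *+ n]]
  else x.

Definition simple_system (E : vectType K) (T B : set E) : Prop :=
  B `<=` T /\
  exists s : seq E, [/\ B = [set` s], basis_of fullv s &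
    forall x, T x -> exists c : 'I_(size s) -> int,
      x = \sum_(i < size s) s`_i *~ c i /\
      ((forall i, 0 <= c i) \/ (forall i, c i <= 0))].

(* The image of Pdc is a family of distinct vectors indexed by Pdc, whence the
   injectivity clause. *)
Definition paired_simple_system (Pdc Pmc : set F) : Prop :=
  [/\ Pdc `<=` Rdc,
      (forall x y, Pdc x -> Pdc y -> pi x = pi y -> x = y),
      simple_system (quot_roots G Rdc) (pi @` Pdc),
      (forall x, Pdc x ->
         (exists y : F, [/\ R y, pi y = pi x & ~ R (2 *: y)]) -> ~ R (2 *: x)) &
      Pmc = primed @` Pdc].

Definition ratioG (x y : F) : K :=
  xget 0 [set c | [/\ pi x = c *: pi y, pi x != 0 & pi y != 0]].

Definition knr (x : F) : K :=
  xget 0 [set k | let y := star (primed x) in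
                  x = ratioG x y *: y - k *: a].

(* The factor t > 0 with I_R = t I. *)
Definition norm_factor : K :=
  xget 0 [set t | let value (z : int) :=
                    exists2 x, R x & t * I x x = z%:~R in
    [/\ 0 < t,
        (forall x, R x -> exists z : int, t * I x x = z%:~R),
        (forall z, value z -> (2 %| z)%Z) &
        (forall d : int, (forall z, value z -> (d %| z)%Z) -> (d %| 2)%Z)]].

Definition IR (x y : F) : K := norm_factor * I x y.

Section Numbered.
Variables (l : nat) (alpha : 'I_l.+1 -> F).

Definition marks : {ffun 'I_l.+1 -> nat} :=
  xget [ffun=> 0%N] [set n : {ffun 'I_l.+1 -> nat} |
    (forall i, 0 < n i)%N /\
    generated_by (\sum_i pi (alpha i) *+ n i)
                 (root_lattice RG `&` radical (@quot_form _ _ I G))].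

Definition exponent (i : 'I_l.+1) : K :=
  IR (alpha i) (alpha i) / (2 * knr (alpha i)) * (marks i)%:R.

Definition max_exponent : K :=
  \big[Num.max/exponent ord0]_(i < l.+1) exponent i.

Definition collapsed (i : 'I_l.+1) : Prop := exponent i < max_exponent.

End Numbered.

Inductive colour := White | Gray | Black.

Definition colour_of (x : F) : colour :=
  if `[< R (2 *: x) \/ R (2^-1 *: x) >] then Black
  else if `[< RG (2 *: pi x) \/ RG (2^-1 *: pi x) >] then Gray
  else White.

End Marked.

(* Data prescribed at the index i, where gamma denotes star (primed alpha_i):
   colour and counting number of alpha_i; colour of the node gamma, [None]
   meaning that it is absent from the diagram, i.e. that alpha_i is collapsed;
   counting number of gamma. *)
Record node_data := Node {
  nd_colour : colour;
  nd_count : nat;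
  nd_star_colour : option colour;
  nd_star_count : nat }.

(* White nodes, not collapsed ([wh]) or collapsed ([wc]). They occur only where
   2 alpha_i is not a root of R/G, so that gamma is alpha_i + k(alpha_i) a and
   has the same counting number as alpha_i. *)
Definition wh (k : nat) := Node White k (Some White) k.
Definition wc (k : nat) := Node White k None k.

Definition row := nat -> node_data.

Definition chain_row (l : nat) (d0 dm dl : node_data) : row :=
  fun i => if i == 0%N then d0 else if i == l then dl else dm.

Definition fork_row (l : nat) (d0 dm dl : node_data) : row :=
  fun i => if (i <= 1)%N then d0 else if i == l then dl else dm.

Local Notation g := Gray.
Local Notation b := Black.

Definition rows_BCC (l : nat) : seq row :=
  [:: chain_row l (wh 1) (wh 1) (Node g 1 (Some g) 2);
      chain_row l (wh 2) (wh 2) (Node g 1 (Some b) 4);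
      chain_row l (wh 1) (wh 1) (Node b 1 (Some g) 1);
      chain_row l (wh 2) (wh 2) (Node b 1 (Some b) 2);
      chain_row l (wh 1) (wh 1) (Node b 1 None 2);
      chain_row l (wc 2) (wh 1) (Node g 1 (Some g) 2);
      chain_row l (wc 4) (wh 2) (Node g 1 (Some b) 4);
      chain_row l (wc 2) (wh 1) (Node b 1 (Some g) 1);
      chain_row l (wc 4) (wh 2) (Node b 1 (Some b) 2)]
  ++ (if (2 <= l)%N then [:: chain_row l (wc 2) (wh 1) (Node b 1 None 2)]
      else [::]).

Definition rows_CvBC (l : nat) : seq row :=
  [:: chain_row l (wh 1) (wh 2) (Node g 2 (Some g) 4);
      chain_row l (wh 1) (wh 2) (Node g 1 (Some b) 4);
      chain_row l (wh 1) (wh 2) (Node b 2 (Some g) 2);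
      chain_row l (wh 1) (wh 2) (Node b 1 (Some b) 2);
      chain_row l (wh 1) (wh 2) (Node b 2 None 4);
      chain_row l (wc 1) (wh 1) (Node g 1 (Some g) 2);
      chain_row l (wc 2) (wh 2) (Node g 1 (Some b) 4);
      chain_row l (wc 1) (wh 1) (Node b 1 (Some g) 1);
      chain_row l (wc 2) (wh 2) (Node b 1 (Some b) 2)]
  ++ (if (2 <= l)%N then [:: chain_row l (wc 1) (wh 1) (Node b 1 None 2)]
      else [::]).

Definition rows_BBv (l : nat) : seq row :=
  [:: fork_row l (wc 1) (wh 1) (Node g 1 (Some g) 2);
      fork_row l (wc 2) (wh 2) (Node g 1 (Some b) 4);
      fork_row l (wc 1) (wh 1) (Node b 1 (Some g) 1);
      fork_row l (wc 2) (wh 2) (Node b 1 (Some b) 2);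
      fork_row l (wc 1) (wh 1) (Node b 1 None 2)].

(* In rank 2, [chain_row] lists alpha_0, alpha_1, alpha_2. *)
Definition rows_BBv2 : seq row :=
  [:: chain_row 2 (wh 1) (wh 1) (Node b 1 (Some b) 2);
      chain_row 2 (wc 2) (wh 1) (Node b 1 (Some b) 2);
      chain_row 2 (wc 1) (wc 1) (Node g 1 (Some g) 2);
      chain_row 2 (wc 2) (wc 2) (Node g 1 (Some b) 4);
      chain_row 2 (wc 1) (wc 1) (Node b 1 (Some g) 1);
      chain_row 2 (wc 2) (wc 2) (Node b 1 (Some b) 2)].

Definition rows_CvC (l : nat) : seq row :=
  [:: chain_row l (Node g 1 (Some g) 2) (wh 1) (Node g 1 (Some g) 2);
      chain_row l (Node g 2 (Some g) 4) (wh 2) (Node g 1 (Some b) 4);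
      chain_row l (Node g 1 (Some g) 2) (wh 1) (Node b 1 (Some g) 1);
      chain_row l (Node g 2 (Some g) 4) (wh 2) (Node b 1 (Some b) 2);
      chain_row l (Node g 1 (Some b) 4) (wh 2) (Node g 1 (Some b) 4);
      chain_row l (Node g 1 (Some b) 4) (wh 2) (Node b 2 (Some g) 2);
      chain_row l (Node g 1 (Some b) 4) (wh 2) (Node b 1 (Some b) 2);
      chain_row l (Node b 1 (Some g) 1) (wh 1) (Node b 1 (Some g) 1);
      chain_row l (Node b 2 (Some g) 2) (wh 2) (Node b 1 (Some b) 2);
      chain_row l (Node b 1 (Some b) 2) (wh 2) (Node b 1 (Some b) 2);
      chain_row l (Node b 1 None 2) (wh 1) (Node g 1 (Some g) 2);
      chain_row l (Node b 2 None 4) (wh 2) (Node g 1 (Some b) 4);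
      chain_row l (Node b 1 None 2) (wh 1) (Node b 1 (Some g) 1);
      chain_row l (Node b 2 None 4) (wh 2) (Node b 1 (Some b) 2)]
  ++ (if (2 <= l)%N then
        [:: chain_row l (Node b 1 None 2) (wh 1) (Node b 1 None 2)]
      else [::]).

Definition rows (X : nr_type) (l : nat) : seq row :=
  match X with
  | BCC => rows_BCC l
  | CvBC => rows_CvBC l
  | BBv => if l == 2%N then rows_BBv2 else rows_BBv l
  | CvC => rows_CvC l
  end.

Definition realizes (K : realType) (F : vectType K) (I : {symmetric F})
    (R : set F) (G : {vspace F}) (a : F) (X : nr_type) (l : nat)
    (alpha : 'I_l.+1 -> F) (r : row) : Prop :=
  (exists f : {linear quot G -> 'rV[K]_l.+1},
     root_system_iso (quot_roots G R) (affine_roots K X l) f /\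
     forall i : 'I_l.+1, f (quot_proj G (alpha i)) = std_simple K X l i) /\
  forall i : 'I_l.+1,
    let alpha_i_star := star R a (primed R G a (alpha i)) in
    [/\ colour_of R G (alpha i) = nd_colour (r i),
        counting R a (alpha i) = nd_count (r i),
        counting R a alpha_i_star = nd_star_count (r i) &
        match nd_star_colour (r i) with
        | None => collapsed I R G a alpha i
        | Some c => ~ collapsed I R G a alpha i /\
                    colour_of R G alpha_i_star = c
        end].

(* Main.v *)
(* A linear functional that is positive on a simple system of R/G can be moved by
   explicit automorphisms of X_l (signed permutations of the eps_i, translations
   by b) to the fundamental alcove, so every simple system is a standard one up
   to automorphism; moreover the form on R/G is a multiple of the standard one.
   Splitting F along the alpha_i, the fibre of R over alpha_i is k_i Z a, and the
   fibre over 2 alpha_i, if nonempty, is a coset of a subgroup of Z a. The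
   reflections in two roots of the same fibre compose to a translation along a;
   applied to the fibres of adjacent nodes this yields divisibility relations
   between these integers. Since all roots come from the simple fibres by simple
   reflections, the k_i are globally coprime. Finitely many possibilities remain,
   and these are the rows, up to the diagram reversal for C^vee C_l and BB_2^vee. *)

From HB Require Import structures.
Require Import Defs.
From mathcomp Require Import all_boot all_order all_algebra all_fingroup.
From mathcomp Require Import all_classical all_reals.
From mathcomp Require Import ring lra zify.

Set Implicit Arguments.
Unset Strict Implicit.
Unset Printing Implicit Defensive.

Import Order.TTheory GRing.Theory Num.Theory.
Local Open Scope classical_set_scope.
Local Open Scope ring_scope.

(** * Roots in coordinates *)

(** An isomorphism of root systems says nothing about the forms, so the form is recovered from the
    set of roots: the coordinates of roots along the eps_j are bounded integers, and reflections
    with other Cartan numbers would leave these bounds. Inside a fibre, reflections only give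
    closure under (s, t) -> 2s - t, so the fibre over 2 alpha need not contain 2 alpha. With k the
    counting number of alpha, it has period k, 2k or 4k and is symmetric about 2 alpha. This leaves
    five cosets; the colour condition discards one, and the others are the types [BG], [BB], [GG],
    [GB]. As l is arbitrary, the final enumeration cannot run over all nodes: the middle nodes are
    shown to form one class, so that collapsing, which depends only on ratios of exponents, is
    decided by computation on at most three classes. *)

Definition mid_period (X : nr_type) : nat :=
  match X with BCC | BBv => 1 | CvBC | CvC => 2 end.

Definition long_period (X : nr_type) : nat :=
  match X with BCC => 1 | CvBC => 4 | BBv | CvC => 2 end.

Section Coordinates.
Variables (K : realType) (l : nat).
Implicit Types (v w : 'rV[K]_l.+1) (u : 'I_l -> int) (n : int).

Lemma ord_bound (i : 'I_l) : (1 <= i.+1 <= l)%N.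
Proof. exact: ltn_ord. Qed.
#[local] Hint Resolve ord_bound : core.

Lemma epsE (i : 'I_l) : eps K l i.+1 = delta_mx 0 (lift ord0 i).
Proof. by rewrite /eps (_ : inord i.+1 = lift ord0 i) //; apply: val_inj; rewrite /= inordK // ltnS ltn_ord. Qed.

Lemma eps0 (i : nat) : (1 <= i <= l)%N -> eps K l i 0 0 = 0.
Proof.
case: i => [//|i] /= il; rewrite (epsE (Ordinal il)) mxE.
by rewrite (_ : (0 == lift _ _) = false) ?andbF //; apply/eqP => /(congr1 val).
Qed.

Lemma epsS (i : nat) (j : 'I_l) : (1 <= i <= l)%N ->
  eps K l i 0 (lift ord0 j) = (i == j.+1)%:R.
Proof.
case: i => [//|i] /= il; rewrite (epsE (Ordinal il)) mxE /=.
by rewrite (inj_eq (@lift_inj _ ord0)) -val_eqE /= eqSS eq_sym.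
Qed.

Lemma vb0 : vb K l 0 0 = 1. Proof. by rewrite mxE !eqxx. Qed.

Lemma vbS (j : 'I_l) : vb K l 0 (lift ord0 j) = 0.
Proof. by rewrite mxE. Qed.

Lemma rV_split_eq v w : v 0 0 = w 0 0 ->
  (forall j : 'I_l, v 0 (lift ord0 j) = w 0 (lift ord0 j)) -> v = w.
Proof.
move=> e0 eS; apply/rowP => i; case: (unliftP ord0 i) => [j ->|->] //.
Qed.

Lemma affine_rootsE (X : nr_type) :
  affine_roots K X l = plusZb (shortB K l) 1
    `|` plusZb (midB K l) (mid_period X) `|` plusZb (longB K l) (long_period X).
Proof. by case: X. Qed.

(* The finite part u of a root is determined, up to signs and permutations, by
   the sum of its squares: 1, 2, 4 for B_s, B_m, B_l. *)
Definition root_coords (X : nr_type) n u : Prop :=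
  [\/ \sum_i u i ^+ 2 = 1,
      \sum_i u i ^+ 2 = 2 /\ ((mid_period X)%:Z %| n)%Z |
      [/\ \sum_i u i ^+ 2 = 4, (forall i, (2 %| u i)%Z) &
          ((long_period X)%:Z %| n)%Z]].

Lemma sumsq_eq0 u (P : pred 'I_l) : \sum_(i | P i) u i ^+ 2 = 0 -> forall i, P i -> u i = 0.
Proof.
move=> /eqP; rewrite psumr_eq0 => [/allP h i Pi|i _]; last exact: sqr_ge0.
by have := h i (mem_index_enum i); rewrite Pi /= sqrf_eq0 => /eqP.
Qed.

Lemma sumsq_neq0 u (P : pred 'I_l) : \sum_(i | P i) u i ^+ 2 != 0 ->
  exists2 i, P i & u i != 0.
Proof.
move=> h; apply: contrapT => no; move/eqP: h; apply.
apply: big1 => i Pi; apply/eqP; rewrite sqrf_eq0; apply/negP => ui.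
by apply: no; exists i => //; apply/negP => /eqP u0; rewrite u0 eqxx in ui.
Qed.

Lemma sumsq_ge0 u (P : pred 'I_l) : 0 <= \sum_(i | P i) u i ^+ 2.
Proof. by apply: sumr_ge0 => i _; exact: sqr_ge0. Qed.

Lemma sumsq1 u (P : pred 'I_l) : \sum_(i | P i) u i ^+ 2 = 1 ->
  exists (i : 'I_l) (s : bool), P i /\
    (forall j, P j -> u j = (-1) ^+ s * (j == i)%:R).
Proof.
move=> h1; have [|i Pi ui] := @sumsq_neq0 u P; first by rewrite h1.
move: h1; rewrite (bigD1 i) //= => h1.
have ge0 : 0 <= \sum_(j | P j && (j != i)) u j ^+ 2 := sumsq_ge0 u _.
have us : u i ^+ 2 = 1.
  have : 0 < u i ^+ 2 by rewrite exprn_even_gt0.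
  by move: h1 ge0; move: (u i ^+ 2) (\sum_(j | _) _) => q S; lia.
exists i, (u i < 0); split=> // j Pj.
case: eqVneq => [->|ji]; last first.
  rewrite mulr0; apply: (sumsq_eq0 (P := fun j => P j && (j != i))); last by rewrite Pj.
  by move: h1; rewrite us; move: (\sum_(j | _) _) => S; lia.
move/eqP: us; rewrite sqrf_eq1 => /orP[]/eqP->; by [].
Qed.

Lemma sumsq2 u : \sum_i u i ^+ 2 = 2 ->
  exists (i j : 'I_l) (s t : bool), (i < j)%N /\
    (forall k, u k = (-1) ^+ s * (k == i)%:R + (-1) ^+ t * (k == j)%:R).
Proof.
move=> h1; have [|i _ ui] := @sumsq_neq0 u xpredT; first by rewrite h1.
move: h1; rewrite (bigD1 i) //= => h1.
have ge0 : 0 <= \sum_(j | j != i) u j ^+ 2 := sumsq_ge0 u _.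
have us : u i ^+ 2 = 1.
  have : 0 < u i ^+ 2 by rewrite exprn_even_gt0.
  have : u i ^+ 2 <= 2 by move: h1 ge0; move: (u i ^+ 2) (\sum_(j | _) _) => q S; lia.
  rewrite expr2 => a1 a2.
  have : (u i = 0 \/ u i = 1 \/ u i = -1 \/ 2 <= u i \/ u i <= -2) by lia.
  by case=> [|[|[|[|]]]] => h; nia.
have [|j [t [ji ut]]] := @sumsq1 u (fun j => j != i).
  by move: h1; rewrite us; move: (\sum_(j | _) _) => S; lia.
have uE k : u k = (-1) ^+ (u i < 0)%R * (k == i)%:R + (-1) ^+ t * (k == j)%:R.
  case: (eqVneq k i) => [->|ki]; last by rewrite ut // mulr0 add0r.
  rewrite eq_sym (negbTE ji) mulr0 addr0 mulr1.
  by move/eqP: us; rewrite sqrf_eq1 => /orP[]/eqP->.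
case: (ltngtP i j) => [ij|ij|/val_inj ij]; last by rewrite ij eqxx in ji.
  by exists i, j, (u i < 0), t.
by exists j, i, t, (u i < 0); split=> // k; rewrite uE addrC.
Qed.

Lemma sumsq_delta (i : 'I_l) (s : bool) (c : int) :
  \sum_j (c * ((-1) ^+ s * (j == i)%:R)) ^+ 2 = c ^+ 2.
Proof.
rewrite (bigD1 i) //= eqxx big1 ?addr0; first by rewrite mulr1 exprMn sqrr_sign mulr1.
by move=> j /negbTE ->; rewrite !mulr0 expr0n.
Qed.

Lemma sumsq_delta2 (i j : 'I_l) (s t : bool) : i != j ->
  \sum_k ((-1) ^+ s * (k == i)%:R + (-1) ^+ t * (k == j)%:R : int) ^+ 2 = 2.
Proof.
move=> ij; have ji : j != i by rewrite eq_sym.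
rewrite (bigD1 i) //= (bigD1 j) //= !eqxx (negbTE ij) (negbTE ji).
rewrite big1 ?addr0; first by case: s t => -[].
by move=> k /andP[/negbTE -> /negbTE ->]; rewrite !mulr0 addr0 expr0n.
Qed.

Lemma intr_sign_nat (s b : bool) : ((-1) ^+ s * b%:R : int)%:~R = (-1) ^+ s * b%:R :> K.
Proof. by rewrite intrM rmorph_sign; case: b. Qed.

(** Replaces the three families of translates by arithmetic conditions on integer coordinates, which
    signed permutations visibly preserve. The automorphisms and the bounds on coordinates are
    derived from this form. *)
Lemma affine_rootsP (X : nr_type) v : affine_roots K X l v <->
  exists n u, [/\ v 0 0 = n%:~R,
    (forall i, v 0 (lift ord0 i) = (u i)%:~R) & root_coords X n u].
Proof.
have addE v1 v2 i : (v1 + v2 : 'rV[K]_l.+1) 0 i = v1 0 i + v2 0 i by rewrite mxE.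
have sclE c v1 i : (c *: v1 : 'rV[K]_l.+1) 0 i = c * v1 0 i by rewrite mxE.
have mulz0 n : (vb K l *~ n) 0 0 = n%:~R by rewrite -scaler_int mxE vb0 mulr1.
have mulzS n j : (vb K l *~ n) 0 (lift ord0 j) = 0.
  by rewrite -scaler_int mxE vbS mulr0.
rewrite affine_rootsE; split.
  case=> [[]|].
  - case=> _ [z [[i [s [il ->]]] ->]]; case: i il => [//|i] /= il.
    exists z, (fun j => (-1) ^+ s * (j == Ordinal il)%:R); split.
    + by rewrite addE mulz0 sclE eps0 // mulr0 add0r mul1r.
    + by move=> j; rewrite addE mulzS addr0 sclE epsS // intr_sign_nat eqSS eq_sym -val_eqE.
    + apply: Or31; rewrite -[RHS](sumsq_delta (Ordinal il) s 1).
      by apply: eq_bigr => j _; rewrite mul1r.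
  - case=> _ [z [[i [j [s [t [i0 ij jl ->]]]]] ->]].
    case: i i0 ij => [//|i] _ ij; case: j jl ij => [//|j] jl ij.
    have il : (i < l)%N by lia.
    exists ((mid_period X)%:Z * z), (fun k => (-1) ^+ s * (k == Ordinal il)%:R +
         (-1) ^+ t * (k == Ordinal jl)%:R); split.
    + by rewrite addE mulz0 addE !sclE !eps0 // !mulr0 !add0r.
    + move=> k; rewrite addE mulzS addr0 addE !sclE !epsS // intrD !intr_sign_nat !eqSS.
      by rewrite !(eq_sym _ (k : nat)) -!val_eqE.
    + apply: Or32; split; last by rewrite dvdz_mulr.
      by apply: sumsq_delta2; rewrite -val_eqE /=; lia.
  - case=> _ [z [[i [s [il ->]]] ->]]; case: i il => [//|i] /= il.
    exists ((long_period X)%:Z * z), (fun j => 2 * ((-1) ^+ s * (j == Ordinal il)%:R)); split.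
    + by rewrite addE mulz0 !sclE eps0 // !mulr0 add0r.
    + move=> j; rewrite addE mulzS addr0 !sclE epsS // intrM intr_sign_nat eqSS eq_sym.
      by rewrite -val_eqE mulrCA.
    + apply: Or33; split; last by rewrite dvdz_mulr.
      * by rewrite sumsq_delta.
      * by move=> j; rewrite dvdz_mulr.
case=> n [u [v0 vS [/sumsq1[i [s [_ uE]]]|[/sumsq2[i [j [s [t [ij uE]]]]] /dvdzP[z zE]]|
   [uS u2 /dvdzP[z zE]]]]].
- left; left; exists ((-1) ^+ s *: eps K l i.+1), n; split; first by exists i.+1, s; rewrite /= ltn_ord.
  apply: rV_split_eq => [|j]; first by rewrite addE mulz0 sclE eps0 // mulr0 add0r mul1r.
  rewrite addE mulzS addr0 sclE epsS // vS uE // intr_sign_nat eqSS eq_sym.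
  by rewrite -val_eqE.
- left; right; exists ((-1) ^+ s *: eps K l i.+1 + (-1) ^+ t *: eps K l j.+1), z.
  split; first by exists i.+1, j.+1, s, t; split=> //; rewrite ltn_ord.
  apply: rV_split_eq => [|k].
    by rewrite addE mulz0 addE !sclE !eps0 // !mulr0 !add0r v0 zE mulrC.
  rewrite addE mulzS addr0 addE !sclE !epsS // vS uE // intrD !intr_sign_nat !eqSS.
  by rewrite !(eq_sym _ (k : nat)) -!val_eqE.
(* Half of an even vector with sum of squares 4 has sum of squares 1, which reduces to the short
   case. *)
- right; pose u' i := (u i %/ 2)%Z.
  have u'E i : u i == u' i * 2 by rewrite divzK.
  have [|i [s [_ us]]] := @sumsq1 u' xpredT.
    have : \sum_i u i ^+ 2 = 4 * \sum_i u' i ^+ 2.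
      by rewrite mulr_sumr; apply: eq_bigr => i _; rewrite (eqP (u'E i)); ring.
    by rewrite uS; lia.
  exists ((-1) ^+ s *: (2 *: eps K l i.+1)), z; split; first by exists i.+1, s; rewrite /= ltn_ord.
  apply: rV_split_eq => [|j].
    by rewrite addE mulz0 !sclE eps0 // !mulr0 add0r v0 zE mulrC.
  rewrite addE mulzS addr0 !sclE epsS // vS (eqP (u'E j)) us // intrM intr_sign_nat eqSS eq_sym.
  by rewrite -val_eqE mulrCA mulrC.
Qed.
End Coordinates.

#[local] Hint Resolve ord_bound : core.

(** The coefficients of b over the simple roots: eps_j = beta_j + ... + beta_l, and b is beta_0 plus
    2 eps_1 for BCC, plus eps_1 for C^vee BC and C^vee C, plus eps_1 + eps_2 for BB^vee. *)
Definition mark (X : nr_type) (i : nat) : nat :=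
  match X with
  | BCC => (i == 0) + (1 <= i) + (1 <= i)
  | CvBC | CvC => (i == 0) + (1 <= i)
  | BBv => (i == 0) + (1 <= i) + (2 <= i)
  end%N.

Section Simple.
Variables (K : realType) (X : nr_type) (l : nat).
Hypothesis Xl : nr_rank_ok X l.
Implicit Types (v w : 'rV[K]_l.+1) (n : int).
Local Notation be := (std_simple K X l).

Let l_gt0 : (0 < l)%N. Proof. by move: Xl; case: X => //=; exact: leq_trans. Qed.

Lemma eps_sum (j : nat) : (1 <= j <= l)%N ->
  eps K l j = \sum_(i < l.+1) be i *~ (j <= i)%N.
Proof.
move=> /andP[j1 jl].
transitivity (\sum_(j <= i < l.+1) be i).
  rewrite big_nat_recr //=.
  rewrite (eq_big_nat _ _ (F2 := fun i => (- eps K l i.+1) - (- eps K l i))); last first.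
    move=> i /andP[ji il]; rewrite /std_simple.
    by rewrite (gtn_eqF (leq_trans j1 ji)) (ltn_eqF il) opprK addrC.
  rewrite telescope_sumr // opprK /std_simple gtn_eqF // eqxx.
  by rewrite addrC addrA subrr add0r.
rewrite big_geq_mkord big_mkcond /=; apply: eq_bigr => i _.
by case: (j <= i)%N; rewrite ?mulr1z ?mulr0z.
Qed.

Lemma vb_sum : vb K l = \sum_(i < l.+1) be i *~ (mark X i)%:Z.
Proof.
have d0 : be 0 = \sum_(i < l.+1) be i *~ (i == 0 :> nat).
  rewrite (bigD1 ord0) //= mulr1z big1 ?addr0 // => i.
  by rewrite -val_eqE /= => /negbTE ->; rewrite mulr0z.
have e1 : eps K l 1 = \sum_(i < l.+1) be i *~ (1 <= i)%N by apply: eps_sum.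
have dist (f g : 'I_l.+1 -> nat) : \sum_(i < l.+1) be i *~ (f i + g i)%N =
    \sum_(i < l.+1) be i *~ f i + \sum_(i < l.+1) be i *~ g i.
  by rewrite -big_split; apply: eq_bigr => i _; rewrite PoszD mulrzDr.
have be0 : be 0 = match X with
    | BCC => vb K l - 2 *: eps K l 1
    | CvBC | CvC => vb K l - eps K l 1
    | BBv => vb K l - eps K l 1 - eps K l 2 end by [].
transitivity (match X with
    | BCC => be 0 + eps K l 1 + eps K l 1
    | CvBC | CvC => be 0 + eps K l 1
    | BBv => be 0 + eps K l 1 + eps K l 2 end).
  rewrite be0; case: X => //; rewrite ?subrK //.
    by rewrite scaler_nat mulr2n opprD addrA !subrK.
  by rewrite addrAC !subrK.
rewrite /mark; move: Xl dist d0 e1 (@eps_sum 2); case: X => /= l1 dist -> -> e2;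
  rewrite ?(dist (fun i => _ + _)%N (fun i => _ : nat)) ?(dist (fun i => _ : nat) (fun i => _ : nat)) //.
by rewrite e2.
Qed.

(** The multiple of b decides the sign as soon as it is nonzero, because the marks times the period
    outweigh the finite part; otherwise the eps with the smallest index decides. *)
Lemma root_same_sign v : affine_roots K X l v -> exists c : 'I_l.+1 -> int,
  v = \sum_(i < l.+1) be i *~ c i /\ ((forall i, 0 <= c i) \/ (forall i, c i <= 0)).
Proof.
have sgnE (s : bool) w : (-1) ^+ s *: w = w *~ (-1) ^+ s.
  by rewrite -scaler_int rmorph_sign.
have sgn (s : bool) : (-1) ^+ s = 1 :> int \/ (-1) ^+ s = -1 :> int.
  by case: s; [right|left].
have mark0 : mark X 0 = 1%N by case: X.
have mark_gt0 i : (0 < mark X i)%N by case: X => //=; rewrite /mark; lia.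
rewrite affine_rootsE => -[[]|].
- case=> _ [z [[j [s [jl ->]]] ->]].
  exists (fun i => (-1 : int) ^+ s * (j <= i)%N%:Z + (mark X i)%:Z * z); split.
    rewrite eps_sum // vb_sum mul1r sgnE !mulrz_suml -big_split; apply: eq_bigr => i _.
    by rewrite mulrzDr mulrC !mulrzA.
  have [z0|[z0|z0]] : z <= -1 \/ z = 0 \/ 1 <= z by lia.
  + right=> i; have := mark_gt0 i; case: (sgn s) => ->; case: (j <= i)%N; nia.
  + rewrite z0; case: (sgn s) => ->; [left=> i|right=> i]; case: (j <= i)%N; nia.
  + left=> i; have := mark_gt0 i; case: (sgn s) => ->; case: (j <= i)%N; nia.
- case=> _ [z [[i [j [s [t [i1 ij jl ->]]]]] ->]].
  exists (fun k => (-1 : int) ^+ s * (i <= k)%N%:Z + (-1) ^+ t * (j <= k)%N%:Z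
     + (mark X k * mid_period X)%N%:Z * z); split.
    rewrite !eps_sum ?vb_sum ?sgnE ?mulrz_suml -?big_split; try lia.
    by apply: eq_bigr => k _; rewrite 2!mulrzDr PoszM -mulrA ![_ * Posz (_ <= _)]mulrC !mulrzA.
  have gt0 k : (0 < mark X k * mid_period X)%N by rewrite muln_gt0 mark_gt0; case: X.
  (* Only from index [j] on do both eps contribute, by at most 2 in absolute value; before that the
     contribution is at most 1 and [gt0] suffices. *)
  have mark_ge k : (2 <= mark X k * mid_period X)%N \/ (k < j)%N.
    by case: X => //=; rewrite /mark; lia.
  have [z0|[z0|z0]] : z <= -1 \/ z = 0 \/ 1 <= z by lia.
  + right=> k; move: (gt0 k) (mark_ge k); move: (muln _ _) => Q.
    case: (sgn s) => ->; case: (sgn t) => ->; case: (leqP i k); case: (leqP j k); nia.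
  + rewrite z0; case: (sgn s) => ->; [left=> k|right=> k];
    case: (sgn t) => ->; case: (leqP i k); case: (leqP j k); nia.
  + left=> k; move: (gt0 k) (mark_ge k); move: (muln _ _) => Q.
    case: (sgn s) => ->; case: (sgn t) => ->; case: (leqP i k); case: (leqP j k); nia.
- case=> _ [z [[j [s [jl ->]]] ->]].
  exists (fun i => (j <= i)%N%:Z * 2 * (-1 : int) ^+ s + (mark X i * long_period X)%N%:Z * z); split.
    rewrite eps_sum // vb_sum (_ : 2 = 2%:~R :> K) // scaler_int sgnE !mulrz_suml -big_split; apply: eq_bigr => i _.
    by rewrite [in RHS]mulrzDr PoszM !mulrzA.
  have gt0 k : (0 < mark X k * long_period X)%N by rewrite muln_gt0 mark_gt0; case: X.
  have mark_ge k : (2 <= mark X k * long_period X)%N \/ (k < j)%N.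
    by case: X => //=; rewrite /mark; lia.
  have [z0|[z0|z0]] : z <= -1 \/ z = 0 \/ 1 <= z by lia.
  + right=> i; move: (gt0 i) (mark_ge i); move: (muln _ _) => Q; case: (sgn s) => ->; case: (leqP j i); nia.
  + rewrite z0; case: (sgn s) => ->; [left=> i|right=> i]; case: (j <= i)%N; nia.
  + left=> i; move: (gt0 i) (mark_ge i); move: (muln _ _) => Q; case: (sgn s) => ->; case: (leqP j i); nia.
Qed.
End Simple.

(** * Automorphisms and simple systems *)

Lemma even_or_odd_int (x : int) : (2 %| x)%Z \/ (2 %| x - 1)%Z.
Proof. lia. Qed.

Lemma perm_sorting (K : realDomainType) (n : nat) (f : 'I_n -> K) :
  exists p : 'S_n, forall i j : 'I_n, (i <= j)%N -> f (p j) <= f (p i).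
Proof.
pose r : rel 'I_n := fun i j => f j <= f i.
have rtot : total r by move=> i j; exact: le_total.
have rtr : transitive r by move=> j i k; rewrite /r => ij jk; exact: le_trans ij.
pose t := sort r (enum 'I_n).
have st : size t = n by rewrite size_sort size_enum_ord.
have ut : uniq t by rewrite sort_uniq enum_uniq.
have q_inj : injective (fun i : 'I_n => tnth (in_tuple t) (cast_ord (esym st) i)).
  move=> i j; rewrite !(tnth_nth i) /= => /eqP.
  by rewrite nth_uniq ?st // => /eqP /val_inj.
exists (perm q_inj) => i j ij; rewrite !permE !(tnth_nth i) /=.
have : r (nth i t i) (nth i t j).
  apply: sorted_leq_nth; rewrite ?inE ?st //; first by move=> k; exact: lexx.
  exact: sort_sorted.
by [].
Qed.

Section Automorphisms.
Variables (K : realType) (X : nr_type) (l : nat).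
Implicit Types (v w : 'rV[K]_l.+1).

Lemma rVD v w i : (v + w) 0 i = v 0 i + w 0 i. Proof. by rewrite mxE. Qed.
Lemma rVZ (c : K) v i : (c *: v) 0 i = c * v 0 i. Proof. by rewrite mxE. Qed.

(* The second alternative, sound because sum u_j = sum u_j^2 mod 2, is what the
   reversal of the C^vee C_l diagram needs. *)
Definition shift_ok (d : 'I_l -> int) : Prop :=
  (forall j, ((mid_period X)%:Z %| d j)%Z) \/
  (X = CvC /\ forall j, (2 %| d j - 1)%Z).

(** Long roots have even coordinates, and the long period divides twice the middle period in each of
    the four types. *)
Lemma shift_okE (d u : 'I_l -> int) : shift_ok d ->
  (\sum_i u i ^+ 2 = 2 -> ((mid_period X)%:Z %| \sum_j u j * d j)%Z) /\
  (\sum_i u i ^+ 2 = 4 -> (forall i, (2 %| u i)%Z) ->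
    ((long_period X)%:Z %| \sum_j u j * d j)%Z).
Proof.
case=> [dd|[XE dd]]; split=> [u2|u4 ue].
- by rewrite rpred_sum // => j _; rewrite dvdz_mull.
- rewrite rpred_sum // => j _.
  have : (2 * (mid_period X)%:Z %| u j * d j)%Z by rewrite dvdz_mul.
  by apply: dvdz_trans; case: X.
- have : (2 %| \sum_j u j * d j + \sum_j u j ^+ 2)%Z.
    rewrite -big_split rpred_sum //= => j _; have := dd j.
    have : (2 %| u j * (u j - 1))%Z.
      have [e|o] := even_or_odd_int (u j).
        by rewrite dvdz_mulr.
      by rewrite dvdz_mull.
    rewrite expr2; move: (u j) (d j) => x y h1 h2.
    have -> : x * y + x * x = x * (y - 1) + x * (x - 1) + 2 * x by ring.
    by apply: rpredD; [apply: rpredD; [exact: dvdz_mull|]|exact: dvdz_mulr].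
  by rewrite u2 XE rpredDr.
- by rewrite XE rpred_sum // => j _; rewrite dvdz_mulr.
Qed.

Lemma root_coords_transport (n n' : int) (u u' d : 'I_l -> int) (sg : bool)
    (s : 'I_l -> bool) (p : 'S_l) :
  (forall j, u' (p j) = (-1) ^+ s j * u j) ->
  shift_ok d ->
  n' = (-1) ^+ sg * n + \sum_j u j * d j ->
  root_coords X n u -> root_coords X n' u'.
Proof.
move=> u'E dd ->.
have sumE : \sum_i u' i ^+ 2 = \sum_i u i ^+ 2.
  rewrite (reindex_perm p) /=; apply: eq_bigr => i _.
  by rewrite u'E exprMn sqrr_sign mul1r.
rewrite /root_coords sumE => -[->|[u2 n2]|[u4 u2 n4]].
- exact: Or31.
- by apply: Or32; split=> //; rewrite rpredD ?dvdz_mull // (shift_okE u dd).1.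
- apply: Or33; split=> //.
    by move=> i; rewrite -(permKV p i) u'E dvdz_mull.
  by rewrite rpredD ?dvdz_mull // (shift_okE u dd).2.
Qed.

(** Besides a signed permutation and a translation, [sg] allows b to be reversed; this is needed for
    functionals that are negative on b. *)
Definition aut_mx (sg : bool) (s : 'I_l -> bool) (d : 'I_l -> int) (p : 'S_l)
    : 'M[K]_l.+1 :=
  \matrix_(i < l.+1) match unlift ord0 i with
    | None => (-1) ^+ sg *: vb K l
    | Some j => (-1) ^+ s j *: (eps K l (p j).+1 + (d j)%:~R *: vb K l)
    end.

Variables (sg : bool) (s : 'I_l -> bool) (d : 'I_l -> int) (p : 'S_l).
Local Notation M := (aut_mx sg s d p).

Lemma vb_aut : vb K l *m M = (-1) ^+ sg *: vb K l.
Proof. by rewrite -rowE rowK unlift_none. Qed.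

Lemma eps_aut (j : 'I_l) :
  eps K l j.+1 *m M = (-1) ^+ s j *: (eps K l (p j).+1 + (d j)%:~R *: vb K l).
Proof. by rewrite epsE -rowE rowK liftK. Qed.

Lemma rV_decomp v : v = v 0 0 *: vb K l + \sum_j v 0 (lift ord0 j) *: eps K l j.+1.
Proof.
rewrite [LHS]row_sum_delta big_ord_recl; congr (_ + _).
by apply: eq_bigr => j _; rewrite epsE.
Qed.

Lemma aut_mx0 v : (v *m M) 0 0 =
  (-1) ^+ sg * v 0 0 + \sum_j v 0 (lift ord0 j) * ((-1) ^+ s j * (d j)%:~R).
Proof.
rewrite {1}(rV_decomp v) mulmxDl -scalemxAl vb_aut mulmx_suml rVD summxE.
rewrite !rVZ vb0 mulr1 mulrC; congr (_ + _); apply: eq_bigr => j _.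
by rewrite -scalemxAl eps_aut !(rVZ, rVD) eps0 // vb0 add0r mulr1.
Qed.

Lemma aut_mxS v (j : 'I_l) : (v *m M) 0 (lift ord0 (p j)) =
  (-1) ^+ s j * v 0 (lift ord0 j).
Proof.
rewrite {1}(rV_decomp v) mulmxDl -scalemxAl vb_aut mulmx_suml rVD summxE.
rewrite !rVZ vbS !mulr0 add0r (bigD1 j) //= big1 ?addr0 => [|i ij];
  rewrite -scalemxAl eps_aut !(rVZ, rVD) epsS // vbS mulr0 addr0.
  by rewrite eqxx mulr1 mulrC.
by rewrite eqSS val_eqE (inj_eq perm_inj) (negbTE ij) !mulr0.
Qed.

Lemma aut_mx_unit : M \in unitmx.
Proof.
rewrite -row_free_unit -kermx_eq0; apply/rowV0P => v /sub_kermxP vM.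
have vS j : v 0 (lift ord0 j) = 0.
  have := aut_mxS v j; rewrite vM mxE => /esym/eqP.
  by rewrite mulf_eq0 signr_eq0 => /eqP.
apply: rV_split_eq => [|j]; rewrite [RHS]mxE ?vS //.
have := aut_mx0 v; rewrite vM mxE big1 => [|j _]; last by rewrite vS mul0r.
by move/esym/eqP; rewrite addr0 mulf_eq0 signr_eq0 => /eqP.
Qed.

Hypothesis dd : shift_ok d.

Lemma shift_ok_sign (e : 'I_l -> int) (c : 'I_l -> bool) (q : 'I_l -> 'I_l) :
  (forall j, e j = (-1) ^+ c j * d (q j)) -> shift_ok e.
Proof.
move=> eE; case: dd => [h|[XE h]]; [left|right; split=> //] => j; rewrite eE.
  by rewrite dvdz_mull.
by have := h (q j); case: (c j); rewrite ?expr1 ?expr0; lia.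
Qed.

Lemma aut_mx_roots v : affine_roots K X l (v *m M) <-> affine_roots K X l v.
Proof.
rewrite !affine_rootsP; split=> -[n [u [v0 vS Xu]]].
  pose u' j := (-1) ^+ s j * u (p j).
  have v'S j : v 0 (lift ord0 j) = (u' j)%:~R.
    by rewrite /u' intrM rmorph_sign -vS aut_mxS signrMK.
  pose n' := (-1) ^+ sg * (n - \sum_j u' j * ((-1) ^+ s j * d j)).
  exists n', u'; split=> //.
    have := aut_mx0 v; rewrite v0 => /(congr1 (fun x => (-1) ^+ sg * (x - \sum_j v 0 (lift ord0 j) * ((-1) ^+ s j * (d j)%:~R)))).
    rewrite addrK signrMK => <-; rewrite /n' intrM rmorph_sign intrB rmorph_sum.
    congr (_ * (_ - _)); apply: eq_bigr => j _.
    by rewrite v'S !rmorphM rmorph_sign.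
  (* The inverse automorphism has the same shape, with permutation p^-1 and with signs and shifts
     reindexed by it; the shifts only change sign, so they remain admissible. *)
  apply: (@root_coords_transport n n' u u' (fun i => - (-1) ^+ sg * d (p^-1%g i)) sg (fun i => s (p^-1%g i)) p^-1%g) => // [j||].
  + by rewrite /u' permKV.
  + by apply: (@shift_ok_sign _ (fun=> ~~ sg) p^-1%g) => j; case: (sg); rewrite ?expr0 ?expr1; ring.
  + rewrite /n' mulrBr; congr (_ + _); rewrite [in RHS](reindex_perm p) /= mulr_sumr -sumrN.
    apply: eq_bigr => j _; rewrite permK /u' mulrACA -expr2 sqrr_sign; ring.
exists ((-1) ^+ sg * n + \sum_j u j * ((-1) ^+ s j * d j)), (fun i => (-1) ^+ s (p^-1%g i) * u (p^-1%g i)); split.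
- rewrite aut_mx0 v0 intrD intrM rmorph_sign rmorph_sum; congr (_ + _).
  by apply: eq_bigr => j _; rewrite vS !rmorphM rmorph_sign.
- by move=> j; rewrite -{1}(permKV p j) aut_mxS vS intrM rmorph_sign.
- apply: (@root_coords_transport n _ u _ (fun j => (-1) ^+ s j * d j) sg s p) => // [j|].
    by rewrite permK.
  exact: (@shift_ok_sign _ s id).
Qed.

End Automorphisms.

Section Alcove.
Variables (K : realType) (X : nr_type) (l : nat).
Hypothesis Xl : nr_rank_ok X l.
Implicit Types (v w : 'rV[K]_l.+1).
Local Notation be := (std_simple K X l).

Lemma std_simple_root (i : nat) : (i <= l)%N -> affine_roots K X l (be i).
Proof.
have l0 : (0 < l)%N by move: Xl; case: X => //=; exact: leq_trans.
move=> il; rewrite affine_rootsE /std_simple; case: ifP => [_|i0]; last case: ifP => [/eqP iEl|ij].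
- move: Xl; case: X => /= lX.
  + right; exists ((-1) ^+ true *: (2 *: eps K l 1)), 1; split; first by exists 1%N, true.
    by rewrite expr1 scaleN1r mulr1z addrC.
  + left; left; exists ((-1) ^+ true *: eps K l 1), 1; split; first by exists 1%N, true.
    by rewrite expr1 scaleN1r mulr1z addrC.
  + left; right; exists ((-1) ^+ true *: eps K l 1 + (-1) ^+ true *: eps K l 2), 1.
    split; first by exists 1%N, 2%N, true, true.
    by rewrite expr1 !scaleN1r mulr1z [RHS]addrC addrA.
  + left; left; exists ((-1) ^+ true *: eps K l 1), 1; split; first by exists 1%N, true.
    by rewrite expr1 scaleN1r mulr1z addrC.
- left; left; exists (eps K l l), 0; split; last by rewrite mulr0 mulr0z addr0.
  by exists l, false; rewrite l0 leqnn scale1r.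
- left; right; exists (eps K l i - eps K l i.+1), 0; split; last by rewrite mulr0 mulr0z addr0.
  exists i, i.+1, false, true; split=> //; first by rewrite lt0n i0.
    by rewrite ltn_neqAle ij.
  by rewrite scale1r expr1 scaleN1r.
Qed.

(** Rounding x / (m y) to the nearest integer; the bound m |y| / 2 is exactly what makes the height
    of beta_0 nonnegative in [alcove]. *)
Lemma nearest_multiple (m : nat) (x y : K) : (0 < m)%N -> y != 0 ->
  exists2 d : int, (m%:Z %| d)%Z & `|x + d%:~R * y| * 2 <= m%:R * `|y|.
Proof.
move=> m0 y0; have m0' : (0 : K) < m%:R by rewrite ltr0n.
pose q := Num.floor (x / (m%:R * y) + 2^-1).
exists (- (m%:Z * q)); first by rewrite rpredN dvdz_mulr.
have /andP[q1 q2] := floor_itv (x / (m%:R * y) + 2^-1).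
have xE : x = x / (m%:R * y) * (m%:R * y).
  by rewrite mulfVK // mulf_neq0 // gt_eqF.
rewrite {1}xE; move: q1 q2; rewrite -/q; move: (x / _) => z q1 q2.
have -> : z * (m%:R * y) + (- (m%:Z * q))%:~R * y = (z - q%:~R) * (m%:R * y).
  by rewrite intrN intrM; ring.
rewrite normrM normrM (ger0_norm (ltW m0')) mulrAC ler_piMl //.
  by rewrite mulr_ge0 // ltW.
move: q2; rewrite intrD => q2; have : `|z - q%:~R| <= 2^-1; last by lra.
by rewrite ler_norml; lra.
Qed.

(* The automorphisms bring all h(eps_j) into [0, mid_period * h(b) / 2] in
   decreasing order; then the h(beta_i) are nonnegative, hence positive, since h
   does not vanish on roots. *)
Lemma alcove (h : {scalar 'rV[K]_l.+1}) :
  (forall v, affine_roots K X l v -> h v != 0) -> h (vb K l) != 0 ->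
  exists M : 'M[K]_l.+1,
    [/\ M \in unitmx, (forall v, affine_roots K X l (v *m M) <-> affine_roots K X l v) &
        forall i, (i <= l)%N -> 0 < h (be i *m M)].
Proof.
move=> h_neq0; set y := h (vb K l) => y0.
have mp0 : (0 < mid_period X)%N by case: X.
have [d dP] : exists d : 'I_l -> int, forall j, ((mid_period X)%:Z %| d j)%Z /\
    `|h (eps K l j.+1) + (d j)%:~R * y| * 2 <= (mid_period X)%:R * `|y|.
  have dP (j : 'I_l) : exists e : int, ((mid_period X)%:Z %| e)%Z /\
      `|h (eps K l j.+1) + e%:~R * y| * 2 <= (mid_period X)%:R * `|y|.
    by have [e e1 e2] := nearest_multiple (h (eps K l j.+1)) mp0 y0; exists e.
  by exists (fun j => projT1 (cid (dP j))) => j; exact: projT2 (cid (dP j)).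
pose x (j : 'I_l) := h (eps K l j.+1) + (d j)%:~R * y.
have [p pP] := perm_sorting (fun j : 'I_l => `|x j|).
pose M := aut_mx K (y < 0) (fun j => x (p j) < 0) (fun j => d (p j)) p.
have MX : forall v, affine_roots K X l (v *m M) <-> affine_roots K X l v.
  by apply: aut_mx_roots; left=> j; have [] := dP (p j).
exists M; split=> //; first exact: aut_mx_unit.
have hb : h (vb K l *m M) = `|y|.
  by rewrite vb_aut linearZ /= -/y mulr_sign; case: (ltrP y 0) => y1; [rewrite ltr0_norm|rewrite ger0_norm].
have he (j : 'I_l) : h (eps K l j.+1 *m M) = `|x (p j)|.
  rewrite eps_aut linearZ linearD /= linearZ /= -/y -/(x (p j)) mulr_sign.
  by case: (ltrP (x (p j)) 0) => y1; [rewrite ltr0_norm|rewrite ger0_norm].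
have xb j : `|x j| * 2 <= (mid_period X)%:R * `|y| by have [] := dP j.
have y1 : 0 <= `|y| by [].
have l0 : (0 < l)%N by move: Xl; case: X => //=; exact: leq_trans.
move=> i il; rewrite lt0r h_neq0 /=; last first.
  by apply/MX; exact: std_simple_root.
have e1 : h (eps K l 1 *m M) = `|x (p (Ordinal l0))| by rewrite -he.
rewrite /std_simple; case: ifP => [_|i0]; last case: ifP => [/eqP iEl|ij].
- move: Xl xb; case: X => /= lX xb; have xb1 := xb (p (Ordinal l0)).
  + by rewrite mulmxBl -scalemxAl linearB linearZ /= hb e1; lra.
  + by rewrite mulmxBl linearB /= hb e1; lra.
  + have e2 : h (eps K l 2 *m M) = `|x (p (Ordinal lX))| by rewrite -he.
    have xb2 := xb (p (Ordinal lX)).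
    by rewrite !mulmxBl !linearB /= hb e1 e2; lra.
  + by rewrite mulmxBl linearB /= hb e1; lra.
- have ll : (l.-1 < l)%N by rewrite prednK.
  have -> : eps K l l = eps K l (Ordinal ll).+1 by rewrite /= prednK.
  by rewrite he.
- case: i il i0 ij => // i il _ ij.
  have il' : (i.+1 < l)%N by rewrite ltn_neqAle ij.
  rewrite mulmxBl linearB /= (he (Ordinal il)) (he (Ordinal il')) subr_ge0.
  exact: pP.
Qed.
End Alcove.

(** The height with respect to the basis [s], which is the functional handed to [alcove]. *)
Definition coord_sum (K : fieldType) (V : vectType K) (n : nat) (s : n.-tuple V) (v : V) : K :=
  \sum_i coord s i v.

Lemma coord_sum_linear (K : fieldType) (V : vectType K) (n : nat) (s : n.-tuple V) :
  scalar (coord_sum s).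
Proof.
move=> c u v; rewrite /coord_sum mulr_sumr -big_split.
by apply: eq_bigr => i _; rewrite linearP.
Qed.

HB.instance Definition _ (K : fieldType) (V : vectType K) (n : nat) (s : n.-tuple V) :=
  GRing.isLinear.Build K V K *%R (coord_sum s) (coord_sum_linear s).

Definition same_sign (I : Type) (D : numDomainType) (c : I -> D) : Prop :=
  (forall i, 0 <= c i) \/ (forall i, c i <= 0).

Lemma same_sign_le_sum (I : finType) (D : numDomainType) (c : I -> D) i :
  same_sign c -> `|c i| <= `|\sum_j c j|.
Proof.
case=> c0.
  have S0 : 0 <= \sum_(j | j != i) c j by apply: sumr_ge0.
  rewrite (bigD1 i) //= !ger0_norm ?lerDl //; exact: addr_ge0.
have S0 : \sum_(j | j != i) c j <= 0 by apply: sumr_le0.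
rewrite (bigD1 i) //= !ler0_norm // ?lerN2 ?gerDl //.
by rewrite -oppr_ge0 opprD addr_ge0 ?oppr_ge0.
Qed.

Lemma bounded_line_eq0 (K : archiRealFieldType) (A B C : K) :
  (forall n : nat, `|A + B *+ n| <= C) -> B = 0.
Proof.
move=> h; apply/eqP; apply/negPn/negP => B0.
have C0 : 0 <= C by apply: le_trans (h 0%N).
have nB : 0 < `|B| by rewrite normr_gt0.
pose n := Num.bound ((C + `|A|) / `|B|).
have : (C + `|A|) / `|B| < n%:R by apply: archi_boundP; rewrite divr_ge0 // addr_ge0.
rewrite ltr_pdivrMr // => /lt_geF /negP; apply.
rewrite -[n%:R * _]mulrC mulr_natr -normrMn -lerBlDr.
have -> : `|B *+ n| = `|(A + B *+ n) - A| by congr (`|_|); rewrite addrC addKr.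
by apply: le_trans (h n); rewrite lerBlDr ler_normB.
Qed.

Section SimpleSystems.
Variables (K : realType) (X : nr_type) (l : nat).
Hypothesis Xl : nr_rank_ok X l.
Local Notation be := (std_simple K X l).
Variable s : l.+1.-tuple 'rV[K]_l.+1.
Hypothesis s_basis : basis_of fullv s.
Hypothesis s_root : forall i : 'I_l.+1, affine_roots K X l s`_i.
Hypothesis s_sign : forall v, affine_roots K X l v ->
  exists c : 'I_l.+1 -> int, v = \sum_(i < l.+1) s`_i *~ c i /\ same_sign c.

Lemma affine_root_neq0 v : affine_roots K X l v -> v != 0.
Proof.
move=> /affine_rootsP[n [u [_ vS Xu]]]; apply/eqP => v0.
have u0 i : u i = 0.
  by have := vS i; rewrite v0 mxE => /esym/eqP; rewrite intr_eq0 => /eqP.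
move: Xu; rewrite /root_coords big1 => [|i _]; last by rewrite u0 expr0n.
by case=> [//|[]//|[]//].
Qed.

Let s_free : free s. Proof. exact: basis_free s_basis. Qed.

Lemma coord_int (c : 'I_l.+1 -> int) i : coord s i (\sum_(i < l.+1) s`_i *~ c i) = (c i)%:~R.
Proof.
rewrite -(coord_sum_free (fun i => (c i)%:~R : K) i s_free); congr (coord _ _ _).
by apply: eq_bigr => j _; rewrite scaler_int.
Qed.

Lemma coord_same_sign v : affine_roots K X l v -> same_sign (fun i => coord s i v).
Proof.
move=> /s_sign[c [-> [c0|c0]]]; [left|right] => i; rewrite coord_int.
  by rewrite ler0z.
by rewrite lerz0.
Qed.

Lemma coord_sum_neq0 v : affine_roots K X l v -> coord_sum s v != 0.
Proof.
move=> Xv; apply/negP => /eqP h0; have /negP := affine_root_neq0 Xv; apply.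
rewrite (coord_basis s_basis (memvf v)) big1 // => i _.
have := same_sign_le_sum i (coord_same_sign Xv); rewrite -/(coord_sum s v) h0 normr0.
by rewrite normr_le0 => /eqP ->; rewrite scale0r.
Qed.

(** Otherwise the roots eps_1 + n b would all have the same height, which bounds each of their
    coordinates; so the coordinates of b would all vanish. *)
Lemma coord_sum_vb : coord_sum s (vb K l) != 0.
Proof.
have l0 : (0 < l)%N by move: Xl; case: X => //=; exact: leq_trans.
apply/negP => /eqP h0.
have Xn (n : nat) : affine_roots K X l (eps K l 1 + vb K l *+ n).
  rewrite affine_rootsE; left; left; exists (eps K l 1), n%:Z; rewrite mul1r; split=> //.
  by exists 1%N, false; rewrite scale1r.
suff b0 : vb K l = 0 by have := vb0 K l; rewrite b0 mxE => /esym/eqP; rewrite oner_eq0.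
rewrite (coord_basis s_basis (memvf (vb K l))) big1 // => i _.
suff -> : coord s i (vb K l) = 0 by rewrite scale0r.
apply: (@bounded_line_eq0 K (coord s i (eps K l 1)) _ `|coord_sum s (eps K l 1)|) => n.
have := same_sign_le_sum i (coord_same_sign (Xn n)).
by rewrite -/(coord_sum _ _) !linearD !linearMn /= h0 mul0rn addr0.
Qed.

(** No cancellation is possible: a [k] with c_k A_ki nonzero must have c_k = A_ki = 1, and then the
    other entries of row [k] are bounded by 0. *)
Lemma nonneg_inverse_unit (m : nat) (c : 'I_m -> int) (A : 'I_m -> 'I_m -> int) (i : 'I_m) :
  (forall k, 0 <= c k) -> (forall k j, 0 <= A k j) ->
  (forall j, \sum_k c k * A k j = (i == j)%:R) -> exists k, forall j, A k j = (i == j)%:R.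
Proof.
move=> c0 A0 cA.
have [k ck] : exists k, c k * A k i != 0.
  apply: contrapT => no; have := cA i; rewrite eqxx big1 // => k _.
  by apply/eqP; apply/negPn/negP => h; apply: no; exists k.
have le1 j : c k * A k j <= (i == j)%:R.
  by rewrite -cA (bigD1 k) //= lerDl sumr_ge0 // => k' _; rewrite mulr_ge0.
exists k => j; have ck0 := c0 k; have Ak0 := A0 k i; have Aj0 := A0 k j.
have := le1 i; rewrite eqxx => lei; have := le1 j.
move: ck; rewrite mulf_eq0 negb_or => /andP[ck Ak].
have ck1 : 1 <= c k by lia.
have Ak1 : 1 <= A k i by lia.
move: lei; case: eqVneq => [<-|_]; move: (c k) (A k i) (A k j) ck1 Ak1 Aj0 => x y z x1 y1 z0; nia.
Qed.

(* A simple system and the adapted standard one are nonnegative integral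
   combinations of each other, so they are equal. *)
Lemma simple_system_conj : exists M : 'M[K]_l.+1,
  [/\ M \in unitmx, (forall v, affine_roots K X l (v *m M) <-> affine_roots K X l v) &
    exists q : 'I_l.+1 -> 'I_l.+1, injective q /\ forall i : 'I_l.+1, be i *m M = s`_(q i)].
Proof.
have [M [Mu MX Mpos]] := alcove Xl (coord_sum_neq0) coord_sum_vb.
exists M; split=> //.
(* Positive height selects the nonnegative alternative; it serves both for the beta_k M over [s] and
   for [s] over the beta_k M. *)
have sgn (c : 'I_l.+1 -> int) (t : 'I_l.+1 -> 'rV[K]_l.+1) : same_sign c -> (forall i, 0 < coord_sum s (t i)) ->
    0 < coord_sum s (\sum_i t i *~ c i) -> forall i, 0 <= c i.
  move=> [//|c0] t0; rewrite linear_sum ltNge => /negP[]; apply: sumr_le0 => i _.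
  have ci : (c i)%:~R <= 0 :> K by rewrite lerz0.
  by rewrite -scaler_int linearZ; exact: mulr_le0_ge0 ci (ltW (t0 i)).
have s1 (i : 'I_l.+1) : coord_sum s s`_i = 1.
  rewrite /coord_sum (bigD1 i) //= coord_free // eqxx big1 ?addr0 // => j ji.
  by rewrite coord_free // eq_sym (negbTE ji).
have AP (k : 'I_l.+1) : exists A : 'I_l.+1 -> int, be k *m M = \sum_(j < l.+1) s`_j *~ A j /\ forall j, 0 <= A j.
  have Xk : affine_roots K X l (be k *m M).
    by apply/MX; apply: std_simple_root => //; rewrite -ltnS.
  have [A [AE As]] := s_sign Xk; exists A; split=> //; apply: (sgn _ (fun i => s`_i)) => //.
    by move=> i; rewrite s1.
  by rewrite -AE Mpos // -ltnS.
pose A k := projT1 (cid (AP k)).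
have AE (k : 'I_l.+1) : be k *m M = \sum_(j < l.+1) s`_j *~ A k j := (projT2 (cid (AP k))).1.
have A0 k : forall j, 0 <= A k j := (projT2 (cid (AP k))).2.
have sE (i : 'I_l.+1) : exists k : 'I_l.+1, be k *m M = s`_i.
  have Xi : affine_roots K X l (s`_i *m invmx M) by apply/MX; rewrite mulmxKV.
  have [c [cE cs]] := root_same_sign Xl Xi.
  have cE' : s`_i = \sum_(k < l.+1) (be k *m M) *~ c k.
    rewrite -[s`_i](mulmxKV Mu) cE mulmx_suml; apply: eq_bigr => k _.
    by rewrite -!scaler_int -scalemxAl.
  have c0 : forall k, 0 <= c k.
    apply: (sgn c (fun k => be k *m M)) => // [k|]; first by rewrite Mpos // -ltnS.
    by rewrite -cE' s1.
  have [|k kP] := nonneg_inverse_unit (A := A) (i := i) c0 (fun k => A0 k).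
    move=> j; apply: (@intr_inj K); rewrite rmorph_sum.
    transitivity (coord s j s`_i); last first.
      by rewrite coord_free //; case: (_ == _).
    rewrite [in RHS]cE' linear_sum; apply: eq_bigr => k _.
    by rewrite -scaler_int linearZ /= AE coord_int rmorphM.
  exists k; rewrite AE (bigD1 i) //= kP eqxx mulr1z big1 ?addr0 // => j ji.
  by rewrite kP eq_sym (negbTE ji) mulr0z.
pose k i := projT1 (cid (sE i)); have kE (i : 'I_l.+1) : be (k i) *m M = s`_i := projT2 (cid (sE i)).
have k_inj : injective k.
  move=> i j kij; have := kE i; rewrite kij kE => /eqP.
  by rewrite nth_uniq ?size_tuple ?free_uniq // => /eqP/val_inj.
exists (invF k_inj); split; first exact: can_inj (f_invF k_inj).
by move=> i; rewrite -kE f_invF.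
Qed.
End SimpleSystems.

(** * The invariant form *)

Definition dot (K : realType) (l : nat) (u v : 'rV[K]_l.+1) : K :=
  \sum_(j < l) u 0 (lift ord0 j) * v 0 (lift ord0 j).

Section Form.
Variables (K : realType) (X : nr_type) (l : nat).
Implicit Types (v w : 'rV[K]_l.+1).

(** A root with a coordinate 1 is not long, because long roots have even coordinates; its squares
    then sum to at most 2. These bounds are what determines the form below. *)
Lemma affine_root_bound v (i j : 'I_l) : affine_roots K X l v ->
  [/\ `|v 0 (lift ord0 i)| <= 2, exists z : int, v 0 (lift ord0 i) = z%:~R &
      i != j -> v 0 (lift ord0 j) = 1 -> `|v 0 (lift ord0 i)| <= 1].
Proof.
move=> /affine_rootsP[n [u [_ vS Xu]]].
have le_sum : u i ^+ 2 <= \sum_k u k ^+ 2.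
  by rewrite (bigD1 i) //= lerDl sumr_ge0 // => k _; exact: sqr_ge0.
split.
- rewrite vS -intr_norm (ler_int _ _ 2).
  have : u i ^+ 2 <= 4 by case: Xu le_sum => [->|[-> _]|[-> _ _]] // h; apply: le_trans h _.
  by rewrite expr2; nia.
- by exists (u i).
- rewrite !vS => ij /eqP; rewrite -[1]/(1%:~R) eqr_int => /eqP uj.
  rewrite -intr_norm (ler_int _ _ 1).
  have le_sum2 : u i ^+ 2 + u j ^+ 2 <= \sum_k u k ^+ 2.
    rewrite (bigD1 i) //= lerD2l (bigD1 j) 1?eq_sym //= lerDl.
    by rewrite sumr_ge0 // => k _; exact: sqr_ge0.
  have : u i ^+ 2 <= 1.
    move: le_sum2; rewrite uj expr1n; case: Xu => [->|[-> _]|[_ /(_ j)]]; try by move: (u i ^+ 2); lia.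
  by rewrite expr2; nia.
Qed.

Variables (F : vectType K) (I : {symmetric F}) (f : {linear 'rV[K]_l.+1 -> F}).
Hypothesis I_gt0 : forall v, affine_roots K X l v -> 0 < I (f v) (f v).
Hypothesis I_refl : forall v w, affine_roots K X l v -> affine_roots K X l w ->
  affine_roots K X l (w - (2 * I (f v) (f w) / I (f v) (f v)) *: v).
Local Notation e j := (eps K l j.+1).
Local Notation b := (vb K l).

Lemma symC (x y : F) : I x y = I y x.
Proof. by rewrite hermC /= expr0 mul1r. Qed.

Lemma short_root (j : 'I_l) (n : int) : affine_roots K X l (e j + b *~ n).
Proof.
rewrite affine_rootsE; left; left; exists (e j), n; rewrite mul1r; split=> //.
by exists j.+1, false; rewrite scale1r.
Qed.

Lemma short_root0 (j : 'I_l) : affine_roots K X l (e j).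
Proof. by have := short_root j 0; rewrite mulr0z addr0. Qed.

Lemma sub_root (i j : 'I_l) (t : bool) : i != j -> affine_roots K X l (e i + (-1) ^+ t *: e j).
Proof.
move=> ij; rewrite affine_rootsE; left; right; exists (e i + (-1) ^+ t *: e j), 0.
split; last by rewrite mulr0 mulr0z addr0.
case: (ltngtP i j) => [lij|lij|/val_inj h]; last by rewrite h eqxx in ij.
  by exists i.+1, j.+1, false, t; rewrite scale1r; split.
by exists j.+1, i.+1, t, false; rewrite scale1r addrC; split.
Qed.

(* Otherwise the reflections in v of the roots v + k b would be unbounded. *)
Lemma form_line_vb (v : 'rV[K]_l.+1) (j : 'I_l) : affine_roots K X l v ->
  v 0 (lift ord0 j) = 1 -> (forall k, affine_roots K X l (v + b *+ k)) ->
  I (f v) (f b) = 0.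
Proof.
move=> Xv vj Xk; have v_gt0 := I_gt0 Xv; pose c := 2 * I (f v) (f b) / I (f v) (f v).
suff : c = 0.
  by move/eqP; rewrite /c mulf_eq0 invr_eq0 (gt_eqF v_gt0) orbF mulf_eq0 pnatr_eq0 => /eqP.
(* The [j]-th coordinate of the reflection of v + k b in v is -(1 + c k), and coordinates of roots
   are at most 2 in absolute value. *)
apply: (@bounded_line_eq0 K 1 c 2) => k.
have [+ _ _] := affine_root_bound j j (I_refl Xv (Xk k)).
rewrite linearD raddfMn linearDr /= linearMnr /=.
have -> : 2 * (I (f v) (f v) + I (f v) (f b) *+ k) / I (f v) (f v) = 2 + c *+ k.
  by rewrite mulrDr mulrDl mulfK ?gt_eqF // /c mulrnAr mulrnAl.
rewrite -scaleNr rVD rVZ rVD vj -scaler_nat rVZ vbS mulr0 addr0 mulr1.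
by rewrite -normrN; congr (`|_| <= _); ring.
Qed.

Lemma form_short_vb (j : 'I_l) (n : int) : I (f (e j + b *~ n)) (f b) = 0.
Proof.
apply: (@form_line_vb _ j) => [||k]; first exact: short_root.
  by rewrite rVD epsS // eqxx -scaler_int rVZ vbS mulr0 addr0.
by rewrite -addrA -(mulrzDr b n k%:Z); exact: short_root.
Qed.

(** Both eps_j and eps_j + b are orthogonal to b, hence so is their difference. *)
Lemma form_vb (j : 'I_l) : I (f b) (f b) = 0.
Proof.
have := form_short_vb j 1; have := form_short_vb j 0.
by rewrite mulr0z addr0 mulr1z linearD linearDl /= => ->; rewrite add0r.
Qed.

(** Reflecting eps_j + eps_i and eps_j - eps_i in eps_i leaves the [j]-th coordinate 1 and gives
    [i]-th coordinates -1 - c and 1 - c; both have absolute value at most 1 only for c = 0. *)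
Lemma form_eps (i j : 'I_l) : i != j -> I (f (e i)) (f (e j)) = 0.
Proof.
move=> ij; have Xi := short_root0 i; have i_gt0 := I_gt0 Xi.
have ji : j != i by rewrite eq_sym.
pose c := 2 * I (f (e i)) (f (e j)) / I (f (e i)) (f (e i)).
suff : c = 0.
  by move/eqP; rewrite /c mulf_eq0 invr_eq0 (gt_eqF i_gt0) orbF mulf_eq0 pnatr_eq0 => /eqP.
have h (t : bool) : `|- (-1) ^+ t - c| <= 1.
  have [_ _] := affine_root_bound i j (I_refl Xi (sub_root t ji)).
  rewrite linearD [f (_ *: _)]linearZ /= linearDr linearZr_LR /=.
  have -> : 2 * (I (f (e i)) (f (e j)) + (-1) ^+ t * I (f (e i)) (f (e i))) / I (f (e i)) (f (e i)) = c + (-1) ^+ t * 2.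
    by rewrite mulrDr mulrDl mulrCA -!mulrA mulfV ?gt_eqF // mulr1 /c mulrA.
  rewrite -scaleNr !rVD !rVZ !epsS // !eqxx !eqSS !val_eqE (negbTE ij) (negbTE ji) !mulr0 !addr0.
  move=> /(_ isT erefl); rewrite !mulr1 add0r; congr (`|_| <= _); ring.
have := h false; have := h true; rewrite expr1 expr0 opprK !ler_norml.
by lra.
Qed.

(** With x, y the two squared lengths, the reflection of eps_i in eps_i - eps_j has [j]-th
    coordinate 2x / (x + y), an integer strictly between 0 and 2. *)
Lemma form_eps_eq (i j : 'I_l) : I (f (e i)) (f (e i)) = I (f (e j)) (f (e j)).
Proof.
case: (eqVneq i j) => [->//|ij]; have ji : j != i by rewrite eq_sym.
have Xi := short_root0 i; have i_gt0 := I_gt0 Xi; have j_gt0 := I_gt0 (short_root0 j).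
have Xij := sub_root true ij; have ij_gt0 := I_gt0 Xij.
move: i_gt0 j_gt0 ij_gt0 (I_refl Xij Xi).
rewrite expr1 scaleN1r linearB /= !linearBl !linearBr /= (form_eps ij) (form_eps ji) ?subr0 ?sub0r ?opprK.
move: (I (f (e i)) _) (I (f (e j)) _) => x y x0 y0 xy0 Xt.
have [_ [z tz] _] := affine_root_bound j j Xt.
move: tz; rewrite -scaleNr rVD rVZ -scaleN1r rVD rVZ !epsS // eqxx eqSS val_eqE (negbTE ij).
rewrite add0r add0r mulr1 mulrN1 opprK => tz.
have z1 : z = 1.
  have : 0 < (z%:~R : K) by rewrite -tz divr_gt0 // mulr_gt0.
  have : (z%:~R : K) < 2 by rewrite -tz ltr_pdivrMr //; lra.
  by rewrite ltr0z (ltr_int _ _ 2); lia.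
by move: tz; rewrite z1 => /(congr1 (fun t => t * (x + y))); rewrite mulfVK ?gt_eqF //; lra.
Qed.

Lemma form_unique : (0 < l)%N ->
  exists2 c, 0 < c & forall v w, I (f v) (f w) = c * dot v w.
Proof.
move=> l0; pose i0 := Ordinal l0; exists (I (f (e i0)) (f (e i0))).
  exact: I_gt0 (short_root0 i0).
have eb (j : 'I_l) : I (f (e j)) (f b) = 0 by have := form_short_vb j 0; rewrite mulr0z addr0.
have be (j : 'I_l) : I (f b) (f (e j)) = 0 by rewrite symC eb.
have bb := form_vb i0.
have fE v : f v = v 0 0 *: f b + \sum_j v 0 (lift ord0 j) *: f (e j).
  rewrite {1}(rV_decomp v) linearD linearZ linear_sum; congr (_ + _).
  by apply: eq_bigr => j _; rewrite linearZ.
move=> v w; rewrite (fE v) (fE w) linearDl /= !linearDr /= !linearZl_LR !linearZr_LR /= bb !mulr0 add0r.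
rewrite linear_sumr big1 ?mulr0 => [|j _]; last by rewrite linearZr_LR /= be mulr0.
rewrite !linear_sumlz /= big1 => [|j _]; last by rewrite linearZl_LR /= eb mulr0.
rewrite mulr0 !add0r /dot mulr_sumr; apply: eq_bigr => j _.
rewrite linear_sumr (bigD1 j) //= big1 ?addr0 => [|k kj].
  by rewrite linearZl_LR linearZr_LR /= (form_eps_eq j i0) mulrA mulrC.
by rewrite linearZl_LR linearZr_LR /= form_eps ?mulr0 // eq_sym.
Qed.
End Form.

Definition comb (K : fieldType) (V : lmodType K) (n : nat) (x : 'I_n -> V) (v : 'rV[K]_n) : V :=
  \sum_i v 0 i *: x i.

Lemma comb_linear (K : fieldType) (V : lmodType K) (n : nat) (x : 'I_n -> V) :
  linear (comb x).
Proof.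
move=> c u v; rewrite /comb scaler_sumr -big_split.
by apply: eq_bigr => i _; rewrite !mxE scalerDl scalerA.
Qed.

HB.instance Definition _ (K : fieldType) (V : lmodType K) (n : nat) (x : 'I_n -> V) :=
  GRing.isLinear.Build K 'rV[K]_n V *:%R (comb x) (comb_linear x).

Lemma std_simple_free (K : realType) (X : nr_type) (l : nat) (c : 'I_l.+1 -> K) :
  nr_rank_ok X l -> \sum_i c i *: std_simple K X l i = 0 -> forall i, c i = 0.
Proof.
move=> Xl; pose B := \matrix_(i < l.+1) std_simple K X l i.
(* The rows of [C] are the coefficients of b and of the eps_j over the simple roots, as given by
   [vb_sum] and [eps_sum], so [C] is inverse to [B]. *)
pose C : 'M[K]_l.+1 := \matrix_(i, k) if unlift ord0 i is Some j then ((j.+1 <= k)%N)%:R else (mark X k)%:R.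
have CB : C *m B = 1%:M.
  apply/row_matrixP => i; rewrite row_mul row1 mulmx_sum_row.
  case: (unliftP ord0 i) => [j ->|->].
    rewrite -epsE (eps_sum K Xl (ord_bound j)).
    apply: eq_bigr => k _; rewrite rowK 2!mxE liftK.
    by case: (_ <= _)%N; rewrite ?scale1r ?scale0r.
  rewrite -/(vb K l) (vb_sum K Xl); apply: eq_bigr => k _.
  by rewrite rowK 2!mxE unlift_none scaler_nat pmulrn.
move=> c0 i; have BC := mulmx1C CB.
have : (\row_i c i) *m B = 0.
  by rewrite mulmx_sum_row -[RHS]c0; apply: eq_bigr => k _; rewrite rowK mxE.
by move=> /(congr1 (mulmx^~ C)); rewrite -mulmxA BC mulmx1 mul0mx => /rowP/(_ i); rewrite !mxE.
Qed.

(** Roots are integral combinations of the linearly independent beta_j, whereas this vector would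
    have a coefficient 1/2. *)
Lemma std_simple_half (K : realType) (X : nr_type) (l : nat) (i : 'I_l.+1) :
  nr_rank_ok X l -> ~ affine_roots K X l (2^-1 *: std_simple K X l i).
Proof.
move=> Xl /(root_same_sign Xl)[c [cE _]].
have := @std_simple_free K X l (fun j => 2^-1 * (j == i)%:R - (c j)%:~R) Xl.
move=> /(_ _ i); rewrite eqxx mulr1 => h.
have /h/eqP : \sum_j (2^-1 * (j == i)%:R - (c j)%:~R) *: std_simple K X l j = 0.
  under eq_bigr do rewrite scalerBl scaler_int.
  rewrite sumrB -cE (bigD1 i) //= eqxx mulr1 big1 ?addr0 ?subrr // => j /negbTE ->.
  by rewrite mulr0 scale0r.
rewrite subr_eq0 => /eqP /(congr1 (fun x => 2 * x)).
rewrite mulfV ?pnatr_eq0 // -[2]/(2%:~R) -intrM => /esym/eqP.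
by rewrite (eqr_int _ _ 1); lia.
Qed.

(** * Roots of a marked system and their projection *)

Section Marked.
Variables (K : realType) (F : vectType K) (I : {symmetric F}) (R : set F)
  (G : {vspace F}) (a : F).
Hypothesis mR : mERS I R G.
Hypothesis ga : generated_by a (root_lattice R `&` [set` G]).
Local Notation pi := (quot_proj G).
Local Notation RG := (quot_roots G R).

Lemma form_ge0 x : 0 <= I x x.
Proof.
have [[_ [l _ [e [eb e_orth e_sgn]]]] _ _ _] := mR.
rewrite (coord_basis eb (memvf x)) linear_sumlz; apply: sumr_ge0 => i _.
rewrite linear_sumr (bigD1 i) //= big1 => [|j ji]; last first.
  by rewrite linearZl_LR linearZr_LR /= -!tnth_nth e_orth ?mulr0 // eq_sym.
rewrite addr0 linearZl_LR linearZr_LR /= mulrA -expr2 mulr_ge0 ?sqr_ge0 //.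
rewrite -tnth_nth; have [h1 h2 h3] := e_sgn i.
case: (ltnP i l) => il; first exact: ltW (h1 il).
by rewrite h2 // il /=; rewrite -[X in (_ < X)%N]addn0 ltn_ord.
Qed.

Lemma root_gt0 x : R x -> 0 < I x x.
Proof.
by move=> Rx; rewrite lt0r form_ge0 andbT; have [[[_ [_ h _ _ _]] _] _ _ _] := mR; exact: h.
Qed.

Lemma root_refl x y : R x -> R y -> R (y - (2 * I x y / I x x) *: x).
Proof.
move=> Rx Ry; have [[[_ [_ _ h _ _]] _] _ _ _] := mR.
have : (coroot_refl I x @` R) (coroot_refl I x y) by exists y.
by rewrite h // /coroot_refl linearZl_LR /= mulrAC.
Qed.

Lemma root_opp x : R x -> R (- x).
Proof.
move=> Rx; have := root_refl Rx Rx.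
by rewrite mulfK ?gt_eqF ?root_gt0 // scaler_nat mulr2n opprD addrA subrr sub0r.
Qed.

Lemma gen_in_G : a \in G.
Proof.
have : [set a *~ z | z in [set: int]] a by exists 1.
by rewrite -[X in X a]ga => -[].
Qed.

Lemma gen_in_lattice : root_lattice R a.
Proof.
have : [set a *~ z | z in [set: int]] a by exists 1.
by rewrite -[X in X a]ga => -[].
Qed.

Lemma gen_neq0 : a != 0.
Proof.
have [_ _ _ [a' a'0 ga']] := mR; apply/negP => /eqP a0.
have : [set a' *~ z | z in [set: int]] a' by exists 1.
rewrite -[X in X a']ga' [X in X a']ga => -[z _ za].
by move: a'0; rewrite -za a0 mul0rz eqxx.
Qed.

Lemma lattice_G x : root_lattice R x -> x \in G -> exists z : int, x = a *~ z.
Proof.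
move=> Lx Gx; have : (root_lattice R `&` [set` G]) x by split.
by rewrite ga => -[z _ <-]; exists z.
Qed.

Lemma lattice_root x : R x -> root_lattice R x.
Proof.
move=> Rx; exists 1%N, (fun=> x), (fun=> 1); split=> //.
by rewrite big_ord1.
Qed.

Lemma latticeD x y : root_lattice R x -> root_lattice R y -> root_lattice R (x + y).
Proof.
move=> [n [v [c [vR ->]]]] [m [w [d [wR ->]]]].
exists (n + m)%N, (fun i : 'I_(n + m) => match fintype.split i with inl j => v j | inr j => w j end),
  (fun i : 'I_(n + m) => match fintype.split i with inl j => c j | inr j => d j end); split.
  by move=> i; case: (fintype.split i).
rewrite big_split_ord; congr (_ + _); apply: eq_bigr => i _.
  by have := @unsplitK n m (inl i); rewrite /= => ->.
by have := @unsplitK n m (inr i); rewrite /= => ->.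
Qed.

Lemma latticeZ x (z : int) : root_lattice R x -> root_lattice R (x *~ z).
Proof.
move=> [n [v [c [vR ->]]]]; exists n, v, (fun i => c i * z); split=> //.
by rewrite mulrz_suml; apply: eq_bigr => i _; rewrite mulrzA.
Qed.

Lemma lattice_sum n (x : 'I_n -> F) : (forall i, root_lattice R (x i)) ->
  root_lattice R (\sum_i x i).
Proof.
move=> Lx; elim/big_ind : _ => // [|? ?]; last exact: latticeD.
by exists 0%N, (fun=> 0), (fun=> 0); split; [case|rewrite big_ord0].
Qed.

Lemma pi_eqP x y : (pi x = pi y) <-> (x - y \in G).
Proof.
have -> : (x - y \in G) = (x - y \in lker pi) by rewrite lker_quot_proj.
by rewrite memv_ker linearB subr_eq0; split=> /eqP.
Qed.

Lemma pi_gen t : pi (t *: a) = 0.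
Proof.
apply/eqP; rewrite -memv_ker lker_quot_proj; exact: memvZ gen_in_G.
Qed.

Lemma form_gen t y : I (t *: a) y = 0.
Proof.
have [_ rad _ _] := mR; have : radical I a by apply: rad; exact: gen_in_G.
by move=> h; rewrite linearZl_LR /= h mulr0.
Qed.

Lemma form_pi x y x' y' : pi x = pi x' -> pi y = pi y' -> I x y = I x' y'.
Proof.
have [_ rad _ _] := mR => ex ey.
by rewrite -!(quot_formE _ _ rad) ex ey.
Qed.

Variables (X : nr_type) (l : nat) (f : {linear quot G -> 'rV[K]_l.+1}).
Hypothesis Xl : nr_rank_ok X l.
Hypothesis f_iso : root_system_iso RG (affine_roots K X l) f.

Let l_gt0 : (0 < l)%N. Proof. by move: Xl; case: X => //=; exact: leq_trans. Qed.

Lemma root_coordP v : affine_roots K X l v <-> exists2 x, R x & f (pi x) = v.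
Proof.
have [_ <-] := f_iso; split=> [[_ [x Rx <-] <-]|[x Rx <-]]; first by exists x.
by exists (pi x) => //; exists x.
Qed.

Lemma quot_rootP y : RG y <-> affine_roots K X l (f y).
Proof.
have [fb <-] := f_iso; split=> [RGy|[y' RGy' /(bij_inj fb) <-]//].
by exists y.
Qed.

(** [form_unique] needs a linear map into F. A linear section of f o pi provides one, built from
    lifts of the unit vectors; the choice of lifts is invisible to I because G lies in its
    radical. *)
Lemma form_dot : exists2 c, 0 < c & forall x y, I x y = c * dot (f (pi x)) (f (pi y)).
Proof.
have [fb fX] := f_iso; have [fi _ fiK] := fb.
have sec (v : 'rV[K]_l.+1) : exists x, f (pi x) = v.
  have /memv_imgP[x _ xE] : fi v \in limg pi by rewrite limg_quot_proj memvf.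
  by exists x; rewrite -xE fiK.
pose x i := projT1 (cid (sec (delta_mx 0 i))).
have xE i : f (pi (x i)) = delta_mx 0 i := projT2 (cid (sec (delta_mx 0 i))).
have xK v : f (pi (comb x v)) = v.
  rewrite /comb linear_sum linear_sum [RHS]row_sum_delta; apply: eq_bigr => i _.
  by rewrite linearZ linearZ /= xE.
have pix y : pi (comb x (f (pi y))) = pi y by apply: (bij_inj fb); rewrite xK.
have [|v w Xv Xw|c c0 cE] := @form_unique K X l F I (comb x) _ _ l_gt0.
- move=> v /root_coordP[y Ry <-]; rewrite (form_pi (pix y) (pix y)).
  exact: root_gt0.
- have /root_coordP[y Ry yE] := Xv; have /root_coordP[z Rz zE] := Xw.
  rewrite -yE -zE (form_pi (pix y) (pix z)) (form_pi (pix y) (pix y)).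
  rewrite -linearZ -linearB -linearZ -linearB /=; apply/root_coordP.
  by exists (z - (2 * I y z / I y y) *: y) => //; exact: root_refl.
- by exists c => // y z; rewrite -cE; apply: form_pi; rewrite pix.
Qed.
End Marked.

(** The fibres along [a] are sets of this kind: reflections act on them as point symmetries, which
    yields a coset rather than a group. The value q = 0 covers a single point. *)
Lemma refl_closed_int (P : int -> Prop) (z0 : int) : P z0 ->
  (forall s t, P s -> P t -> P (2 * s - t)) ->
  exists q : nat, forall z, P z <-> (q%:Z %| z - z0)%Z.
Proof.
move=> P0 Prefl.
have [all0|/existsNP[z1 /not_implyP[Pz1 z10]]] := pselect (forall z, P z -> z = z0).
  exists 0%N => z; rewrite dvd0z subr_eq0; split=> [/all0 ->|/eqP ->] //.
pose S d := `[< (0 < d)%N /\ P (z0 + d%:Z) >].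
have [d0 Sd0] : exists d, S d.
  have [lt|lt] : z0 < z1 \/ z1 < z0 by move: z10 => /eqP; lia.
    exists `|z1 - z0|%N; apply/asboolP; split; first by lia.
    by rewrite (_ : z0 + _ = z1) //; lia.
  exists `|z1 - z0|%N; apply/asboolP; split; first by lia.
  by rewrite (_ : z0 + _ = 2 * z0 - z1); [exact: Prefl | lia].
have [d /asboolP[dgt Pd] dmin] := find_ex_minn (ex_intro S d0 Sd0).
have Pn (n : nat) : P (z0 + d%:Z * n) /\ P (z0 + d%:Z * n.+1).
  elim: n => [|n [h1 h2]]; first by rewrite mulr0 addr0 mulr1.
  split=> //; rewrite (_ : _ + _ = 2 * (z0 + d%:Z * n.+1) - (z0 + d%:Z * n)).
    exact: Prefl.
  by lia.
have Pz (n : int) : P (z0 + d%:Z * n).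
  case: (intP n) => [|k|k]; first by have [] := Pn 0%N.
    by have [_] := Pn k.
  have [_] := Pn k => /(Prefl _ _ P0).
  by congr P; lia.
exists d => z; split=> [Pz'|/dvdzP[q zE]]; last first.
  by rewrite (_ : z = z0 + d%:Z * q); [exact: Pz | lia].
have dne : d%:Z != 0 by lia.
have zE := divz_eq (z - z0) d%:Z; have r0 := modz_ge0 (z - z0) dne.
have rd := ltz_pmod (z - z0) (_ : 0 < d%:Z).
apply/dvdz_mod0P; move: (divz _ _) (modz _ _) zE r0 rd => q r zE r0 /(_ dgt) rd.
apply: contrapT => /eqP rne.
have Pr : S `|r|%N \/ S `|d%:Z - r|%N.
  (* Two point symmetries compose to a translation by an even multiple of d only, so the parity of
     the quotient matters: z yields z0 + r if it is even and z0 + d - r if it is odd, and either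
     contradicts the minimality of d. *)
  have [e [e2|e2]] : exists e, q = 2 * e \/ q = 2 * e + 1.
    by exists (q %/ 2)%Z; have := divz_eq q 2; have := modz_ge0 q (_ : 2 != 0); have := ltz_pmod q (_ : 0 < 2); lia.
    left; apply/asboolP; split; first by lia.
    have := Prefl _ _ (Pz 0) (Prefl _ _ (Pz e) Pz').
    by congr P; lia.
  right; apply/asboolP; split; first by lia.
  have := Prefl _ _ (Pz (e + 1)) Pz'.
  by congr P; lia.
by case: Pr => /dmin; lia.
Qed.

(** * Fibres over simple roots *)

(* [WW] if 2 alpha is not a root of R/G; otherwise the two letters are the
   colours (black or gray) of alpha and of (alpha')^*. *)
Inductive node_type := WW | BG | BB | GG | GB.

(* With k the counting number of alpha, the fibre of R over 2 alpha is
   2 alpha + (star_offset + star_period Z) a. *)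
Definition star_period (t : node_type) (k : nat) : nat :=
  match t with WW | BG => k | BB | GG => 2 * k | GB => 4 * k end.

Definition star_offset (t : node_type) (k : nat) : nat :=
  match t with WW | BG | BB => 0 | GG => k | GB => 2 * k end.

Definition doubled (t : node_type) : bool := if t is WW then false else true.

(* What reflecting the fibres over alpha' and 2 alpha' in those over alpha and
   2 alpha imposes, with n = - <alpha', alpha^vee>; a zero counting number is
   allowed and stands for a fibre with one element. *)
Definition edge_ok (n : nat) (t : node_type) (k : nat) (t' : node_type) (k' : nat) : bool :=
  [&& k' %| n * k,
      doubled t' ==> (star_period t' k' %| 2 * n * k),
      doubled t ==> (2 * k' %| n * star_offset t k) && (2 * k' %| n * star_period t k) &
      doubled t && doubled t' ==>
        (star_period t' k' %| n * star_offset t k) && (star_period t' k' %| n * star_period t k)]%N.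

Section Fibres.
Variables (K : realType) (F : vectType K) (I : {symmetric F}) (R : set F)
  (G : {vspace F}) (a : F).
Hypothesis mR : mERS I R G.
Hypothesis ga : generated_by a (root_lattice R `&` [set` G]).
Local Notation pi := (quot_proj G).
Local Notation RG := (quot_roots G R).
Variables (X : nr_type) (l : nat) (f : {linear quot G -> 'rV[K]_l.+1}).
Hypothesis Xl : nr_rank_ok X l.
Hypothesis f_iso : root_system_iso RG (affine_roots K X l) f.
Variable alpha : 'I_l.+1 -> F.
Hypothesis alpha_dc : forall i, Rdc R (alpha i).
Hypothesis alpha_std : forall i : 'I_l.+1, f (pi (alpha i)) = std_simple K X l i.
Hypothesis alpha_black : forall i,
  (exists y, [/\ R y, pi y = pi (alpha i) & ~ R (2 *: y)]) -> ~ R (2 *: alpha i).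

Lemma alpha_root i : R (alpha i). Proof. by have [] := alpha_dc i. Qed.

Lemma mulz_inj (s t : int) : a *~ s = a *~ t -> s = t.
Proof.
move=> /eqP; rewrite -!scaler_int -subr_eq0 -scalerBl scaler_eq0.
by rewrite (negbTE (gen_neq0 mR ga)) orbF subr_eq0 eqr_int => /eqP.
Qed.

Lemma alpha_comb_eq0 (c : 'I_l.+1 -> int) t :
  \sum_i alpha i *~ c i + t *: a = 0 -> (forall i, c i = 0) /\ t = 0.
Proof.
move=> e0; have c0 i : c i = 0.
  have /(congr1 (f \o pi)) := e0; rewrite /= !linearD /= !(pi_gen ga) !linear0 addr0.
  rewrite linear_sum linear_sum /= => h.
  have /(_ _ i)/eqP := @std_simple_free K X l (fun i => (c i)%:~R) Xl.
  rewrite intr_eq0 => /(_ _)/eqP; apply; rewrite -[RHS]h.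
  by apply: eq_bigr => j _; rewrite scaler_int -alpha_std !raddfMz.
split=> //; move: e0; rewrite big1 => [|i _]; last by rewrite c0 mulr0z.
by rewrite add0r => /eqP; rewrite scaler_eq0 (negbTE (gen_neq0 mR ga)) orbF => /eqP.
Qed.

(** The vector [t *: a] lies both in the root lattice and in G, and [a] generates that
    intersection. *)
Lemma fibre_int (w : F) (t : K) : root_lattice R w -> R (w + t *: a) ->
  exists z : int, t = z%:~R.
Proof.
move=> Lw Rt; have [||z zE] := @lattice_G K F R G a ga (t *: a).
- have -> : t *: a = (w + t *: a) + w *~ (-1) by rewrite mulrN1z addrAC subrr add0r.
  by apply: latticeD; [exact: lattice_root|exact: latticeZ].
- exact: memvZ (gen_in_G ga).
exists z; move: zE => /eqP; rewrite -scaler_int -subr_eq0 -scalerBl scaler_eq0.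
by rewrite (negbTE (gen_neq0 mR ga)) orbF subr_eq0 => /eqP.
Qed.

Lemma root_pi_int w y : root_lattice R w -> R y -> pi y = pi w ->
  exists z : int, y = w + a *~ z.
Proof.
move=> Lw Ry /pi_eqP yw; have [||z zE] := @lattice_G K F R G a ga (y - w).
- by rewrite -mulrN1z; apply: latticeD; [exact: lattice_root|exact: latticeZ].
- exact: yw.
by exists z; rewrite -zE addrC subrK.
Qed.

(* The reflections in c alpha_i + t a and in alpha_i compose to a translation
   along a on each fibre. *)
Lemma refl_fibre w i (u c t n : K) : 2 * I (alpha i) w = n * I (alpha i) (alpha i) ->
  c != 0 -> R (w + u *: a) -> R (c *: alpha i + t *: a) ->
  R (w + (u - n / c * t) *: a).
Proof.
move=> nE c0 Rw Rc.
have pia x r : pi (x + r *: a) = pi x by rewrite linearD /= (pi_gen ga) addr0.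
have Ia x r y s : I (x + r *: a) (y + s *: a) = I x y by apply: (form_pi mR); exact: pia.
have i_gt0 := root_gt0 mR (alpha_root i).
have := root_refl mR Rc Rw.
rewrite !Ia !linearZl_LR linearZr_LR /=.
have -> : 2 * (c * I (alpha i) w) / (c * (c * I (alpha i) (alpha i))) = n / c.
  by rewrite mulrCA nE; field; rewrite c0 gt_eqF.
have -> : w + u *: a - (n / c) *: (c *: alpha i + t *: a) = (w - n *: alpha i) + (u - n / c * t) *: a.
  rewrite scalerDr !scalerA mulfVK // opprD scalerBl.
  by rewrite addrACA.
move=> Rx; have := root_refl mR (alpha_root i) Rx.
have -> : I (alpha i) (w - n *: alpha i + (u - n / c * t) *: a) = I (alpha i) w - n * I (alpha i) (alpha i).
  by rewrite -{1}[alpha i]addr0 -{1}(scale0r a) Ia linearBr /= linearZr_LR.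
have -> : 2 * (I (alpha i) w - n * I (alpha i) (alpha i)) / I (alpha i) (alpha i) = - n.
  by rewrite mulrBr nE; field; rewrite gt_eqF.
by congr R; rewrite scaleNr opprK addrAC subrK.
Qed.

Lemma lattice_alpha i : root_lattice R (alpha i).
Proof. exact: lattice_root (alpha_root i). Qed.

Lemma lattice_alpha2 i : root_lattice R (2 *: alpha i).
Proof. by rewrite scaler_nat mulr2n; apply: latticeD; exact: lattice_alpha. Qed.

(** Positivity of [k] is deliberately left out; with k = 0 the fibre over alpha_i is one root. *)
Definition node (i : 'I_l.+1) (t : node_type) (k : nat) : Prop :=
  (forall z : int, R (alpha i + a *~ z) <-> (k%:Z %| z)%Z) /\
  (if t is WW then ~ RG (2 *: pi (alpha i)) else
   forall z : int, R (2 *: alpha i + a *~ z) <->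
     ((star_period t k)%:Z %| z - (star_offset t k)%:Z)%Z).

Lemma refl1 w i (u n s : int) : 2 * I (alpha i) w = n%:~R * I (alpha i) (alpha i) ->
  R (w + a *~ u) -> R (alpha i + a *~ s) -> R (w + a *~ (u - n * s)).
Proof.
move=> nE Rw Ri; have := @refl_fibre w i u%:~R 1 s%:~R n%:~R nE (oner_neq0 _).
rewrite scale1r !scaler_int => /(_ Rw Ri); rewrite divr1 -intrM -intrB scaler_int.
by [].
Qed.

(** Here the translation is by n s / 2, whose integrality has to come from [fibre_int]; doubling
    keeps the equation within the integers. *)
Lemma refl2 w i (u n s : int) : root_lattice R w ->
  2 * I (alpha i) w = n%:~R * I (alpha i) (alpha i) ->
  R (w + a *~ u) -> R (2 *: alpha i + a *~ s) ->
  exists z, R (w + a *~ z) /\ 2 * z = 2 * u - n * s.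
Proof.
move=> Lw nE Rw Ri; have := @refl_fibre w i u%:~R 2 s%:~R n%:~R nE.
rewrite pnatr_eq0 !scaler_int => /(_ isT Rw Ri) h.
have [z zE] := fibre_int Lw h; exists z; split.
  by rewrite -scaler_int -zE.
apply: (@intr_inj K); rewrite intrM -zE intrB !intrM; field; done.
Qed.

Lemma form_self i : 2 * I (alpha i) (alpha i) = 2%:~R * I (alpha i) (alpha i).
Proof. by []. Qed.

Lemma form_self2 i : 2 * I (alpha i) (2 *: alpha i) = 4%:~R * I (alpha i) (alpha i).
Proof. by rewrite linearZr_LR /=; ring. Qed.

(* The excluded case q = 4 k, q | p is the one ruled out by the colour condition
   on paired simple systems. *)
Lemma classify_period (k q : nat) (p : int) :
  (k%:Z %| p)%Z -> (k %| q)%N -> (q %| 4 * k)%N -> (q%:Z %| 2 * p)%Z ->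
  ((0 < k)%N -> q = (4 * k)%N -> ~ (q%:Z %| p)%Z) ->
  exists t, [/\ doubled t, q = star_period t k & (q%:Z %| p - (star_offset t k)%:Z)%Z].
Proof.
move=> /dvdzP[p' ->] /dvdnP[q' ->].
case: (posnP k) => [->|k0].
  (* For k = 0 all periods and offsets vanish, so any doubled type would do. *)
  by rewrite !muln0 !mulr0 => _ _ _; exists BG; split => //.
rewrite dvdn_pmul2r // mulrA PoszM dvdz_mul2r; last by lia.
move=> q4 q2 nb.
have nb' : q' = 4%N -> ~ (q'%:Z %| p')%Z.
  by move=> q'4; have := nb isT (congr1 (muln^~ k) q'4); rewrite dvdz_mul2r; last by lia.
(* After division by k, q' divides 4 and 2 p'. The value 1 is [BG]; the value 2 is [BB] or [GG]
   according to the parity of p'; for 4, p' is even but not divisible by 4, which is [GB]. *)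
have [q'E|[q'E|q'E]] : q' = 1%N \/ q' = 2%N \/ q' = 4%N.
  have : (q' <= 4)%N by exact: dvdn_leq q4.
  by case: q' q4 {q2 nb nb'} => [|[|[|[|[|]]]]] //; auto.
- exists BG; rewrite q'E /= mul1n; split=> //; by rewrite subr0 mul1r dvdz_mull.
- have [pe|po] := even_or_odd_int p'.
    exists BB; rewrite q'E /= subr0; split=> //.
    by rewrite dvdz_mul2r //; lia.
  exists GG; rewrite q'E /=; split=> //.
  by rewrite -[X in _ - X]mul1r -mulrBl dvdz_mul2r //; lia.
- exists GB; rewrite q'E /=; split=> //.
  rewrite (_ : p' * k%:Z - _ = (p' - 2) * k); last by lia.
  rewrite dvdz_mul2r; last by lia.
  have := nb' q'E; move: q2; rewrite q'E; clear; lia.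
Qed.

Lemma fibre1_exists i : exists k : nat, forall z : int, R (alpha i + a *~ z) <-> (k%:Z %| z)%Z.
Proof.
have R0 : R (alpha i + a *~ 0) by rewrite mulr0z addr0; exact: alpha_root.
have [|k kP] := @refl_closed_int (fun z => R (alpha i + a *~ z)) 0 R0; last first.
  by exists k => z; rewrite kP subr0.
have dbl s t : R (alpha i + a *~ s) -> R (alpha i + a *~ t) -> R (alpha i + a *~ (t - 2 * s)).
  by move=> Rs Rt; have := refl1 (form_self i) Rt Rs.
move=> s t Rs Rt.
have Rs' := dbl _ _ Rs R0; have Rs'' := dbl _ _ Rs' R0.
have := dbl _ _ Rt R0 => Rt'; have := dbl _ _ Rs Rs => Rns.
have := dbl _ _ Rt Rt => Rnt.
by have := dbl _ _ Rns Rnt; congr (R (_ + _ *~ _)); lia.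
Qed.

(** Let the fibre over 2 alpha be the coset of p modulo q. Reflecting alpha in it shows that k
    divides p and q, reflecting it in alpha + k a that q divides 4k, and reflecting it in itself
    that q divides 2p: these are the hypotheses of [classify_period]. *)
Lemma node_exists i : exists t k, node i t k.
Proof.
have [k kP] := fibre1_exists i.
have [RG2|nRG2] := pselect (RG (2 *: pi (alpha i))); last by exists WW, k.
have Rk : R (alpha i + a *~ k) by apply/kP.
have R0 : R (alpha i + a *~ 0) by rewrite mulr0z addr0; exact: alpha_root.
have [z0 Rz0] : exists z : int, R (2 *: alpha i + a *~ z).
  case: RG2 => y Ry; rewrite -linearZ => /(root_pi_int (lattice_alpha2 i) Ry)[z yE].
  by exists z; rewrite -yE.
have kz z : R (2 *: alpha i + a *~ z) -> (k%:Z %| z)%Z.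
  move=> Rz; have [z' [Rz' z'E]] := refl2 (lattice_alpha i) (form_self i) R0 Rz.
  by move: Rz' => /kP; rewrite (_ : z' = - z) ?rpredN //; lia.
have k4 z s : R (2 *: alpha i + a *~ z) -> R (alpha i + a *~ s) -> R (2 *: alpha i + a *~ (z - 4 * s)).
  by move=> Rz Rs; exact: refl1 (form_self2 i) Rz Rs.
have k2 z s : R (2 *: alpha i + a *~ z) -> R (2 *: alpha i + a *~ s) -> R (2 *: alpha i + a *~ (z - 2 * s)).
  move=> Rz Rs; have [z' [Rz' z'E]] := refl2 (lattice_alpha2 i) (form_self2 i) Rz Rs.
  by move: Rz'; rewrite (_ : z' = z - 2 * s) //; lia.
have [|q qP] := @refl_closed_int (fun z => R (2 *: alpha i + a *~ z)) z0 Rz0.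
  move=> s t Rs Rt; have Rns := k2 _ _ Rs Rs; have Rnt := k2 _ _ Rt Rt.
  by have := k2 _ _ Rnt Rns; congr (R (_ + _ *~ _)); lia.
have Rq : R (2 *: alpha i + a *~ (z0 + q)) by apply/qP; rewrite addrC addKr.
have kz0 := kz _ Rz0.
have kq : (k %| q)%N.
  have : (k%:Z %| q%:Z)%Z by rewrite (_ : q%:Z = (z0 + q) - z0) ?rpredB // ?kz //; lia.
  by [].
have q4k : (q %| 4 * k)%N.
  have := k4 _ _ Rz0 Rk => /qP.
  by rewrite (_ : _ - z0 = - (4 * k)%N%:Z) ?rpredN //; lia.
have q2p : (q%:Z %| 2 * z0)%Z.
  have := k2 _ _ Rz0 Rz0 => /qP.
  by rewrite (_ : _ - z0 = - (2 * z0)) ?rpredN //; lia.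
have [|t [dt qE pE]] := classify_period kz0 kq q4k q2p.
  (* If q = 4k divides the offset, then 2 alpha is a root while 2 (alpha + k a) is not, against
     [alpha_black]. *)
  move=> k0 q4E qz0; have : ~ R (2 *: alpha i).
    apply: alpha_black; exists (alpha i + a *~ k); split=> //.
      by rewrite -scaler_int linearD /= (pi_gen ga) addr0.
    rewrite scalerDr.
    rewrite (_ : 2 *: (a *~ k) = a *~ (2 * k%:Z)); last first.
      by rewrite -[2%:R]/(2%:~R) scaler_int -mulrzA mulrC.
    move=> /qP; rewrite q4E in qz0 * => h; have := rpredD h qz0; rewrite subrK.
    have -> : ((4 * k)%N%:Z %| 2 * k%:Z)%Z = (4 * k %| 2 * k)%N by [].
    by move: k0 => + /dvdn_leq; clear; lia.
  apply; have := qP 0; rewrite mulr0z addr0 => ->.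
  by rewrite sub0r rpredN.
exists t, k; split=> //.
suff {dt} h z : R (2 *: alpha i + a *~ z) <->
    ((star_period t k)%:Z %| z - (star_offset t k)%:Z)%Z by case: t dt qE pE h.
rewrite qP -qE (_ : z - (star_offset t k)%:Z = (z - z0) + (z0 - (star_offset t k)%:Z)).
  by rewrite (rpredDr _ pE); split.
by rewrite addrA subrK.
Qed.
End Fibres.

(** * Divisibility along edges and coprimality of the counting numbers *)

Section Constraints.
Variables (K : realType) (F : vectType K) (I : {symmetric F}) (R : set F)
  (G : {vspace F}) (a : F).
Hypothesis mR : mERS I R G.
Hypothesis ga : generated_by a (root_lattice R `&` [set` G]).
Local Notation pi := (quot_proj G).
Local Notation RG := (quot_roots G R).
Variables (X : nr_type) (l : nat) (f : {linear quot G -> 'rV[K]_l.+1}).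
Hypothesis Xl : nr_rank_ok X l.
Hypothesis f_iso : root_system_iso RG (affine_roots K X l) f.
Variable alpha : 'I_l.+1 -> F.
Hypothesis alpha_dc : forall i, Rdc R (alpha i).
Hypothesis alpha_std : forall i : 'I_l.+1, f (pi (alpha i)) = std_simple K X l i.


Local Notation node := (node R G a alpha).

(** Up to sign, alpha_i + k a translates the fibre over alpha_j by n k and the one over 2 alpha_j by
    2 n k, while 2 alpha_i + s a translates them by n s / 2 and n s. The values s = offset and s =
    offset + period give the last two clauses. *)
Lemma edge_constraints (i j : 'I_l.+1) (n : nat) t k t' k' :
  2 * I (alpha i) (alpha j) = - n%:R * I (alpha i) (alpha i) ->
  node i t k -> node j t' k' -> edge_ok n t k t' k'.
Proof.
move=> nE [iP iD] [jP jD].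
have nE1 : 2 * I (alpha i) (alpha j) = (- n%:Z)%:~R * I (alpha i) (alpha i).
  by rewrite nE intrN.
have nE2 : 2 * I (alpha i) (2 *: alpha j) = (- (2 * n%:Z))%:~R * I (alpha i) (alpha i).
  by rewrite linearZr_LR /= nE intrN intrM; ring.
have Rj : R (alpha j + a *~ 0) by rewrite mulr0z addr0; exact: (alpha_root alpha_dc).
have Rik : R (alpha i + a *~ k) by apply/iP.
have dj (d : nat) (z : int) (m : nat) : z = m -> (d%:Z %| z)%Z -> (d %| m)%N by move=> ->.
have refl1' := refl1 mR ga alpha_dc.
have refl2' := refl2 mR ga alpha_dc.
have Lj := lattice_alpha alpha_dc j; have Lj2 := lattice_alpha2 alpha_dc j.
have iD' : doubled t -> forall z, R (2 *: alpha i + a *~ z) <->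
    ((star_period t k)%:Z %| z - (star_offset t k)%:Z)%Z by case: t iD.
have jD' : doubled t' -> forall z, R (2 *: alpha j + a *~ z) <->
    ((star_period t' k')%:Z %| z - (star_offset t' k')%:Z)%Z by case: t' jD.
have R2j : doubled t' -> R (2 *: alpha j + a *~ (star_offset t' k')).
  by move=> dt; apply/(jD' dt); rewrite subrr.
have R2i : doubled t -> R (2 *: alpha i + a *~ (star_offset t k)) /\
    R (2 *: alpha i + a *~ (star_offset t k + star_period t k)%N).
  by move=> dt; split; apply/(iD' dt); rewrite ?subrr // PoszD addrAC subrr add0r.
have e3 : doubled t -> forall s : nat, R (2 *: alpha i + a *~ s) -> (2 * k' %| n * s)%N.
  move=> _ s Rs; have [z [Rz zE]] := refl2' _ _ _ _ _ Lj nE1 Rj Rs.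
  have /dvdzP[q qE] := (jP z).1 Rz; have : ((2 * k')%N%:Z %| (2 * k')%N%:Z * q)%Z by exact: dvdz_mulr.
  by apply: dj; lia.
have e4 : doubled t -> doubled t' -> forall s : nat, R (2 *: alpha i + a *~ s) ->
    (star_period t' k' %| n * s)%N.
  move=> _ dt' s Rs; have [z [Rz zE]] := refl2' _ _ _ _ _ Lj2 nE2 (R2j dt') Rs.
  by have /(jD' dt') := Rz; apply: dj; lia.
rewrite /edge_ok; apply/and4P; split.
- by have /jP := refl1' _ _ _ _ _ nE1 Rj Rik; apply: dj; lia.
- apply/implyP => dt'; have /(jD' dt') := refl1' _ _ _ _ _ nE2 (R2j dt') Rik.
  by apply: dj; lia.
- apply/implyP => dt; have [R1 R2] := R2i dt; have h1 := e3 dt _ R1; rewrite h1 /=.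
  by have := e3 dt _ R2; rewrite mulnDr dvdn_addr.
- apply/implyP => /andP[dt dt']; have [R1 R2] := R2i dt; have h1 := e4 dt dt' _ R1.
  by rewrite h1 /=; have := e4 dt dt' _ R2; rewrite mulnDr dvdn_addr.
Qed.

Lemma root_comb x : R x -> exists (d : 'I_l.+1 -> int) (z : int),
  same_sign d /\ x = \sum_i alpha i *~ d i + a *~ z.
Proof.
move=> Rx; have [fb _] := f_iso.
have /(root_same_sign Xl)[d [dE ds]] : affine_roots K X l (f (pi x)).
  by apply/(root_coordP f_iso); exists x.
have Lw : root_lattice R (\sum_i alpha i *~ d i).
  by apply: lattice_sum => i; apply: latticeZ; exact: lattice_alpha.
have [|z zE] := root_pi_int ga Lw Rx; last by exists d, z.
apply: (bij_inj fb); rewrite dE linear_sum linear_sum; apply: eq_bigr => i _.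
by rewrite -alpha_std !raddfMz.
Qed.

Lemma comb_inj (d d' : 'I_l.+1 -> int) (z z' : int) :
  \sum_i alpha i *~ d i + a *~ z = \sum_i alpha i *~ d' i + a *~ z' ->
  (forall i, d i = d' i) /\ z = z'.
Proof.
move=> e; have [|h1 h2] := alpha_comb_eq0 mR ga Xl alpha_std (c := fun i => d i - d' i) (t := (z - z')%:~R).
  rewrite scaler_int mulrzBr; under eq_bigr do rewrite mulrzBr.
  by rewrite sumrB addrACA -opprD e subrr.
split=> [i|]; apply/eqP; rewrite -subr_eq0 ?h1 //.
by move/eqP: h2; rewrite intr_eq0.
Qed.

Lemma root_int x y : R x -> R y -> exists z : int, 2 * I x y = z%:~R * I x x.
Proof.
move=> Rx Ry; have [[[_ [_ _ _ h _]] _] _ _ _] := mR.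
have [z zE] := h x y Rx Ry; exists z; rewrite -zE linearZl_LR /= mulrAC mulfVK //.
by rewrite gt_eqF // (root_gt0 mR).
Qed.

(* Reflecting in simple roots lowers the height of a positive root and keeps its
   coefficient on a. *)
Lemma root_descent (g : nat) :
  (forall i (c : nat) (z : int), (c == 1%N) || (c == 2%N) -> R (c%:R *: alpha i + a *~ z) -> (g%:Z %| z)%Z) ->
  forall N (c : 'I_l.+1 -> nat) (z : int), (\sum_i c i <= N)%N ->
  R (\sum_i alpha i *~ (c i)%:Z + a *~ z) -> (g%:Z %| z)%Z.
Proof.
move=> gP; elim=> [|N IH] c z cN; set x := _ + _ => Rx.
all: have x_gt0 := root_gt0 mR Rx.
all: have Ix y : I x y = \sum_i (c i)%:R * I (alpha i) y.
all: try by rewrite linearDl /= -scaler_int (form_gen mR ga) addr0 linear_sumlz;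
  apply: eq_bigr => i _; rewrite -scaler_int linearZl_LR.
  move: x_gt0; rewrite Ix big1 ?ltxx // => i _.
  have : (c i <= 0)%N by apply: leq_trans cN; rewrite (bigD1 i) //= leq_addr.
  by rewrite leqn0 => /eqP ->; rewrite mul0r.
(* I(x, x) is positive and equals the sum of the c_i I(alpha_i, x), so some term is positive. *)
have [i [ci Ii]] : exists i, (0 < c i)%N /\ 0 < I (alpha i) x.
  apply: contrapT => no; move: x_gt0; rewrite {1}Ix ltNge => /negP[].
  apply: sumr_le0 => i _; have [c0|c0] := posnP (c i); first by rewrite c0 mul0r.
  apply: mulr_ge0_le0 => //; rewrite leNgt; apply/negP => h.
  by apply: no; exists i.
have i_gt0 := root_gt0 mR (alpha_root alpha_dc i).
have [n nE] := root_int (alpha_root alpha_dc i) Rx.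
have n0 : 0 < n.
  have : 0 < n%:~R * I (alpha i) (alpha i) by rewrite -nE mulr_gt0.
  by rewrite pmulr_lgt0 // ltr0z.
have := root_refl mR (alpha_root alpha_dc i) Rx.
rewrite nE mulfK ?gt_eqF // => Rx'.
have [d [z' [ds dE]]] := root_comb Rx'.
have [|cd zz'] := @comb_inj (fun j => (c j)%:Z - n * (j == i)%:R) d z z'.
  rewrite -dE /x [RHS]addrAC; congr (_ + _).
  under eq_bigr do rewrite mulrzBr.
  rewrite sumrB; congr (_ - _); rewrite (bigD1 i) //= eqxx mulr1 big1 ?addr0 ?scaler_int //.
  by move=> j /negbTE ->; rewrite mulr0 mulr0z.
case: ds => ds.
  rewrite zz'; apply: (IH (fun j => `|d j|%N)).
    rewrite -ltnS; apply: leq_trans cN; rewrite (bigD1 i) //= [X in (_ < X)%N](bigD1 i) //=.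
    have -> : (\sum_(j | j != i) `|d j| = \sum_(j | j != i) c j)%N.
      by apply: eq_bigr => j /negbTE ji; rewrite -cd ji mulr0 subr0.
    by rewrite ltn_add2r; have := cd i; have := ds i; rewrite eqxx; lia.
  by under eq_bigr do rewrite gez0_abs //; rewrite -dE.
(* The reflected root is negative here. Only the coefficient at [i] has changed, so the others are
   both nonnegative and nonpositive. *)
have xE : x = (c i)%:R *: alpha i + a *~ z.
  rewrite /x (bigD1 i) //= big1 ?addr0 => [|j ji]; first by rewrite scaler_nat.
  by have := cd j; have := ds j; rewrite (negbTE ji) mulr0 subr0 => h1 h2; rewrite (_ : c j = 0%N) ?mulr0z //; lia.
apply: (gP i (c i)); last by rewrite -xE.
(* The Cartan integer of alpha_i with respect to x is 2 / c_i, which leaves c_i = 1 or 2, the two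
   cases covered by [gP]. *)
have [m mE] := root_int Rx (alpha_root alpha_dc i).
have Ixy y : I x y = (c i)%:R * I (alpha i) y.
  by rewrite xE linearDl /= -scaler_int (form_gen mR ga) addr0 linearZl_LR.
rewrite !Ixy (symC I (alpha i) x) Ixy in mE.
have : (2 * (c i)%:Z)%:~R * I (alpha i) (alpha i) = (m * (c i)%:Z * (c i)%:Z)%:~R * I (alpha i) (alpha i).
  by rewrite !intrM -!mulrA; move: mE; rewrite mulrCA.
move=> /(mulIf (lt0r_neq0 i_gt0)) /intr_inj.
have cz : (c i)%:Z != 0 by lia.
move=> /(mulIf cz) mc.
have : (c i %| 2)%N.
  have : ((c i)%:Z %| m * (c i)%:Z)%Z by exact: dvdz_mull.
  by rewrite -mc.
by case: (c i) => [|[|[|k]]].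
Qed.

(** The fibres over the 2 alpha_i need no extra hypothesis, their offsets and periods being
    multiples of k_i. So g divides the coefficient on [a] of every root, while [a] is itself an
    integral combination of roots. *)
Lemma gen_count_gcd (t : 'I_l.+1 -> node_type) (k : 'I_l.+1 -> nat) (g : nat) :
  (forall i, node i (t i) (k i)) -> (forall i, (g %| k i)%N) -> g = 1%N.
Proof.
move=> nP gk.
have gP i (c : nat) (z : int) : (c == 1%N) || (c == 2%N) ->
    R (c%:R *: alpha i + a *~ z) -> (g%:Z %| z)%Z.
  have [n1 n2] := nP i; case/orP=> /eqP ->.
    by rewrite scale1r => /n1; apply: dvdz_trans; exact: gk.
  have gQ : (g%:Z %| (star_period (t i) (k i))%:Z)%Z.
    by case: (t i) => /=; rewrite ?PoszM ?dvdz_mull //; exact: gk.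
  have gO : (g%:Z %| (star_offset (t i) (k i))%:Z)%Z.
    by case: (t i) => /=; rewrite ?PoszM ?dvdz_mull ?dvdz0 //; exact: gk.
  move=> Rz; suff h : ((star_period (t i) (k i))%:Z %| z - (star_offset (t i) (k i))%:Z)%Z.
    by rewrite -(subrK (star_offset (t i) (k i))%:Z z) rpredD // (dvdz_trans gQ).
  case: (t i) n2 {gQ gO} => [|/(_ z)[+ _]|/(_ z)[+ _]|/(_ z)[+ _]|/(_ z)[+ _]]; try exact.
  case; exists (2 *: alpha i + a *~ z) => //.
  by rewrite -scaler_int linearD /= (pi_gen ga) addr0 linearZ.
have rootP x : R x -> exists (d : 'I_l.+1 -> int) (z : int),
    x = \sum_i alpha i *~ d i + a *~ (g%:Z * z).
  move=> Rx; have [d [z [ds xE]]] := root_comb Rx; exists d.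
  suff /dvdzP[q zq] : (g%:Z %| z)%Z by exists q; rewrite xE zq mulrC.
  case: ds => ds.
    apply: (root_descent gP (c := fun i => `|d i|%N) (leqnn _)).
    by under eq_bigr do rewrite gez0_abs //; rewrite -xE.
  rewrite -rpredN; apply: (root_descent gP (c := fun i => `|d i|%N) (leqnn _)).
  have -> : \sum_i alpha i *~ `|d i|%N + a *~ (- z) = - x; last exact: (root_opp mR Rx).
  rewrite xE opprD mulrNz; congr (_ - _); rewrite -sumrN; apply: eq_bigr => i _.
  by rewrite -mulrNz; congr (_ *~ _); have := ds i; lia.
have [n [v [c [vR aE]]]] := gen_in_lattice ga.
pose D j := projT1 (cid (rootP _ (vR j))).
have DE j : exists z, v j = \sum_i alpha i *~ D j i + a *~ (g%:Z * z) := projT2 (cid (rootP _ (vR j))).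
pose Z j := projT1 (cid (DE j)).
have ZE j : v j = \sum_i alpha i *~ D j i + a *~ (g%:Z * Z j) := projT2 (cid (DE j)).
have [|_] := @comb_inj (fun i => \sum_j D j i * c j) (fun=> 0) (g%:Z * \sum_j Z j * c j) 1.
  rewrite [in RHS]big1 ?add0r ?mulr1z => [|i _]; last by rewrite mulr0z.
  rewrite [RHS]aE; under [RHS]eq_bigr do rewrite ZE mulrzDl.
  rewrite big_split /=; congr (_ + _).
    under eq_bigr do rewrite mulrz_sumr; rewrite exchange_big /=.
    by apply: eq_bigr => j _; rewrite mulrz_suml; apply: eq_bigr => i _; rewrite mulrzA.
  rewrite mulr_sumr mulrz_sumr; apply: eq_bigr => j _.
  by rewrite mulrA mulrzA.
move: (\sum_j _) => q gq.
have : (g%:Z %| g%:Z * q)%Z by exact: dvdz_mulr.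
rewrite gq.
by rewrite -[(_ %| _)%Z]/(g %| 1)%N dvdn1 => /eqP.
Qed.
End Constraints.

(* [twice_knr t k] is 2 k^nr(alpha). *)
Definition twice_knr (t : node_type) (k : nat) : nat :=
  match t with WW | BB | GB => 2 * k | BG | GG => k end.

Definition node_colour (t : node_type) : colour :=
  match t with WW => White | BG | BB => Black | GG | GB => Gray end.

Definition star_colour (t : node_type) : colour :=
  match t with WW => White | BB | GB => Black | BG | GG => Gray end.

(* (alpha')^* = 2 alpha + (star_shift) a when 2 alpha is a root of R/G. *)
Definition star_shift (t : node_type) (k : nat) : nat := star_period t k - star_offset t k.

Lemma star_shiftE t k : (star_shift t k + star_offset t k)%N = star_period t k.
Proof. by case: t; rewrite /star_shift /=; lia. Qed.

(** This expresses that the fibre over 2 alpha is symmetric about 2 alpha. *)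
Lemma star_offset2 t k : (2 * star_offset t k = star_period t k)%N \/ star_offset t k = 0%N.
Proof. by case: t => /=; lia. Qed.

(** * Colours, counting numbers and k^nr of a node *)

Section NodeInvariants.
Variables (K : realType) (F : vectType K) (I : {symmetric F}) (R : set F)
  (G : {vspace F}) (a : F).
Hypothesis mR : mERS I R G.
Hypothesis ga : generated_by a (root_lattice R `&` [set` G]).
Local Notation pi := (quot_proj G).
Local Notation RG := (quot_roots G R).
Variables (X : nr_type) (l : nat) (f : {linear quot G -> 'rV[K]_l.+1}).
Hypothesis Xl : nr_rank_ok X l.
Hypothesis f_iso : root_system_iso RG (affine_roots K X l) f.
Variable alpha : 'I_l.+1 -> F.
Hypothesis alpha_dc : forall i, Rdc R (alpha i).
Hypothesis alpha_std : forall i : 'I_l.+1, f (pi (alpha i)) = std_simple K X l i.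



Local Notation node := (node R G a alpha).

Lemma counting_eq x (k : nat) : (0 < k)%N ->
  (forall z : int, R (x + a *~ z) <-> (k%:Z %| z)%Z) -> counting R a x = k.
Proof.
move=> k0 xk; rewrite /counting.
set P := [set _ | _]; have Pk : P k.
  split=> // [|j j0]; first by apply/(xk k).
  by move=> /(xk j)/= kj; exact: dvdn_leq.
have [c0 Rc cmin] := xgetPex 0%N (ex_intro P k Pk).
have [_ Rk kmin] := Pk.
by apply/eqP; rewrite eqn_leq kmin // cmin.
Qed.

Lemma pi_shift x (z : int) : pi (x + a *~ z) = pi x.
Proof. by rewrite -scaler_int linearD /= (pi_gen ga) addr0. Qed.

Lemma RG_half i : ~ RG (2^-1 *: pi (alpha i)).
Proof.
move=> /(quot_rootP f_iso); rewrite linearZ /= alpha_std.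
exact: std_simple_half.
Qed.

Lemma alpha_pi_neq0 i : pi (alpha i) != 0.
Proof.
apply/eqP => p0; have := affine_root_neq0 (std_simple_root K Xl (ltn_ord i)).
by rewrite -alpha_std p0 linear0 eqxx.
Qed.

Section Node.
Variables (i : 'I_l.+1) (t : node_type) (k : nat).
Hypothesis nP : node i t k.
Hypothesis k0 : (0 < k)%N.

Lemma doubled_fibre : doubled t -> forall z : int, R (2 *: alpha i + a *~ z) <->
  ((star_period t k)%:Z %| z - (star_offset t k)%:Z)%Z.
Proof. by have [_] := nP; case: t. Qed.

Lemma doubled_RG : doubled t <-> RG (2 *: pi (alpha i)).
Proof.
have [_ n2] := nP; split=> [dt|]; last by case: t n2.
have /(doubled_fibre dt) R2 : ((star_period t k)%:Z %| (star_offset t k)%:Z - (star_offset t k)%:Z)%Z.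
  by rewrite subrr.
exists (2 *: alpha i + a *~ star_offset t k); first exact: R2.
by rewrite /= pi_shift linearZ.
Qed.

Lemma node_counting : counting R a (alpha i) = k.
Proof. by have [n1 _] := nP; exact: counting_eq. Qed.

Lemma period_gt0 : (0 < star_period t k)%N.
Proof. by case: t => /=; lia. Qed.

Lemma fibre_counting (z : int) : doubled t -> R (2 *: alpha i + a *~ z) ->
  counting R a (2 *: alpha i + a *~ z) = star_period t k.
Proof.
move=> dt /(doubled_fibre dt) Qz; apply: counting_eq; first exact: period_gt0.
move=> w; rewrite -addrA -mulrzDr (doubled_fibre dt).
by rewrite (addrC z) -addrA (rpredDr _ Qz).
Qed.

(** By symmetry of the fibre, 2 alpha minus the offset is a root; it is the one selected by
    [primed], and one period further lies 2 alpha plus [star_shift]. *)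
Lemma star_primed_doubled : doubled t ->
  star R a (primed R G a (alpha i)) = 2 *: alpha i + a *~ star_shift t k.
Proof.
move=> dt; rewrite /primed asboolT; last exact/doubled_RG.
set P := [set _ | _].
have Pof y : P y -> exists n : nat, [/\ y = 2 *: alpha i + a *~ (- n%:Z),
    R y & star R a y = 2 *: alpha i + a *~ ((star_period t k)%:Z - n%:Z)].
  move=> [Ry _ [n yE] _]; exists n.
  have yE' : y = 2 *: alpha i + a *~ (- n%:Z) by rewrite yE mulrNz -pmulrn.
  split=> //; rewrite /star {2}yE' fibre_counting // -?yE' // yE' -addrA; congr (_ + _).
  by rewrite pmulrn -mulrzDr addrC.
have P0 : P (2 *: alpha i + a *~ (- (star_offset t k)%:Z)).
  have R0 : R (2 *: alpha i + a *~ (- (star_offset t k)%:Z)).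
    apply/(doubled_fibre dt); rewrite -opprD rpredN -PoszD addnn -mul2n.
    by case: (star_offset2 t k) => ->; rewrite ?muln0 ?dvdz0 ?dvdzz.
  split=> //.
  - by rewrite pi_shift linearZ.
  - by exists (star_offset t k); rewrite pmulrn mulrNz.
  - exists (star_shift t k); first by move: (star_shiftE t k) k0; case: t; rewrite /star_shift /=; lia.
    rewrite /star fibre_counting // -addrA !pmulrn -mulrzDr.
    by congr (_ + a *~ _); rewrite -(star_shiftE t k); lia.
have Px := xgetPex 0 (ex_intro P _ P0).
have [n [xE Rx sE]] := Pof _ Px; have [_ _ _ [m m0]] := Px.
rewrite sE (pmulrn a m) => /addrI /(mulz_inj mR ga) nm; congr (_ + a *~ _).
have : (star_period t k %| n + star_offset t k)%N.
  by move: Rx; rewrite xE => /(doubled_fibre dt); rewrite -opprD rpredN.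
have := star_offset2 t k; move: nm; rewrite -!(star_shiftE t k).
move: (star_shift t k) (star_offset t k) => s o nm so /dvdnP[q qE].
(* Positivity of m means that n is below the period, which divides n + o; since o is 0 or half the
   period, n = o. *)
suff : o = n by lia.
have [q0|[q1|q2]] : q = 0%N \/ q = 1%N \/ (2 <= q)%N by lia.
- by rewrite q0 in qE; lia.
- by rewrite q1 in qE; lia.
- nia.
Qed.

Lemma star_primed_white : doubled t = false ->
  star R a (primed R G a (alpha i)) = alpha i + a *~ k.
Proof.
move=> dt; rewrite /primed asboolF => [|/doubled_RG]; last by rewrite dt.
by rewrite /star node_counting pmulrn.
Qed.

Local Notation gamma := (star R a (primed R G a (alpha i))).

Lemma star_root_doubled : doubled t -> R (2 *: alpha i + a *~ star_shift t k).
Proof.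
move=> dt; apply/(doubled_fibre dt); rewrite -(star_shiftE t k).
have := star_shiftE t k; case: (star_offset2 t k) => [|->]; last by rewrite subr0 addn0.
move=> o2; rewrite -o2 => so; rewrite (_ : star_shift t k = star_offset t k) ?subrr //; lia.
Qed.

Lemma star_counting : counting R a gamma = star_period t k.
Proof.
case dt: (doubled t); last first.
  rewrite star_primed_white // (_ : star_period t k = k); last by case: t dt.
  have [n1 _] := nP; apply: counting_eq => // z.
  by rewrite -addrA -mulrzDr n1 (rpredDl _ (dvdzz _)).
by rewrite star_primed_doubled // fibre_counting //; exact: star_root_doubled.
Qed.

Lemma pi_star : pi gamma = (if doubled t then 2 else 1) *: pi (alpha i).
Proof.
case dt: (doubled t); first by rewrite star_primed_doubled // pi_shift linearZ.
by rewrite star_primed_white // pi_shift scale1r.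
Qed.

Lemma half_alpha : ~ R (2^-1 *: alpha i). Proof. by have [] := alpha_dc i. Qed.

Lemma colour_alpha : colour_of R G (alpha i) = node_colour t.
Proof.
rewrite /colour_of; case dt: (doubled t); last first.
  have nRG : ~ RG (2 *: pi (alpha i)) by move/doubled_RG; rewrite dt.
  rewrite asboolF => [|[R2|/half_alpha//]]; last first.
    by apply: nRG; exists (2 *: alpha i) => //; rewrite linearZ.
  by rewrite asboolF => [|[//|/RG_half]]; case: t dt.
rewrite [in X in if _ then _ else X]asboolT; last by left; exact/doubled_RG.
have R2P : R (2 *: alpha i) <-> ((star_period t k)%:Z %| (star_offset t k)%:Z)%Z.
  by have := doubled_fibre dt 0; rewrite mulr0z addr0 sub0r rpredN.
case: (boolP (star_period t k %| star_offset t k)%N) => h.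
  rewrite asboolT; last by left; apply/R2P.
  by case: t dt h k0 => //= _ /dvdn_leq; lia.
rewrite asboolF => [|[/R2P/= h'|/half_alpha//]]; last by case/negP: h; exact: h'.
by case: t dt h => //=; rewrite dvdn0.
Qed.

(** In the doubled case gamma / 2 is alpha + (star_shift / 2) a, which is a root exactly when 2k
    divides [star_shift]: this happens for [BB] and [GB]. *)
Lemma colour_star : colour_of R G gamma = star_colour t.
Proof.
rewrite /colour_of pi_star; case dt: (doubled t); last first.
  have nRG : ~ RG (2 *: pi (alpha i)) by move/doubled_RG; rewrite dt.
  rewrite star_primed_white // asboolF.
    rewrite scale1r asboolF; first by case: t dt.
    by case=> [//|]; exact: RG_half.
  case=> R2; [apply: nRG|have h := @RG_half i; apply: h].
    by exists (2 *: (alpha i + a *~ k)) => //=; rewrite linearZ /= pi_shift.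
  by exists (2^-1 *: (alpha i + a *~ k)) => //=; rewrite linearZ /= pi_shift.
rewrite [in X in if _ then _ else X]asboolT; last first.
  right; rewrite scalerA mulVf ?pnatr_eq0 // scale1r.
  by exists (alpha i) => //; exact: (alpha_root alpha_dc).
rewrite star_primed_doubled //; set y := _ + _.
have Ry : R y by exact: star_root_doubled.
have i_gt0 := root_gt0 mR (alpha_root alpha_dc i).
(* A root over 4 alpha would give alpha the Cartan number 1/2 with respect to it. *)
have nR2 : ~ R (2 *: y).
  move=> R2; have [z] := root_int mR R2 (alpha_root alpha_dc i).
  have piy : pi (2 *: y) = pi (4 *: alpha i).
    by rewrite linearZ /= pi_shift -linearZ /= scalerA; congr (pi (_ *: _)); ring.
  rewrite (form_pi mR piy (erefl (pi (alpha i)))) (form_pi mR piy piy).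
  rewrite !linearZl_LR linearZr_LR /= => h.
  have : (8%:Z%:~R) * I (alpha i) (alpha i) = (z * 16)%:~R * I (alpha i) (alpha i).
    by move: h; rewrite intrM => h; lra.
  by move=> /(mulIf (lt0r_neq0 i_gt0)) /intr_inj; lia.
have R12 : R (2^-1 *: y) <-> exists2 z : int, 2 * z = star_shift t k & (k%:Z %| z)%Z.
  have yE : 2^-1 *: y = alpha i + ((star_shift t k)%:R / 2) *: a.
    rewrite /y scalerDr scalerA mulVf ?pnatr_eq0 // scale1r.
    by rewrite -[a *~ _]scaler_int scalerA mulrC.
  have [n1 _] := nP; rewrite yE; split=> [Rh|[z zE /n1]].
    have [z zE] := fibre_int mR ga (lattice_alpha alpha_dc i) Rh; exists z.
      apply: (@intr_inj K); rewrite intrM -zE mulrC mulfVK ?pnatr_eq0 //.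
    by apply/n1; rewrite -scaler_int -zE.
  rewrite -scaler_int; congr (R (_ + _ *: _)).
  by apply: (mulIf (_ : (2 : K) != 0)); rewrite ?pnatr_eq0 // mulfVK ?pnatr_eq0 // -[RHS]/((star_shift t k)%:Z%:~R) -zE intrM mulrC.
have R12' : R (2^-1 *: y) <-> star_colour t = Black.
  rewrite R12; case: t dt => //= _; rewrite /star_shift /=; split=> //.
  - case=> z zE /dvdzP[q qE]; have q01 : q <= 0 \/ 1 <= q by lia.
    by case: q01; nia.
  - by move=> _; exists k%:Z => //; lia.
  - case=> z zE /dvdzP[q qE]; have q01 : q <= 0 \/ 1 <= q by lia.
    by case: q01; nia.
  - by move=> _; exists k%:Z => //; lia.
case: (pselect (star_colour t = Black)) => h.
  by rewrite asboolT ?h //; right; apply/R12'.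
rewrite asboolF => [|[//|/R12'//]].
by case: t dt h.
Qed.

(** When 2 alpha is a root of R/G, alpha = gamma / 2 - (star_shift / 2) a, and [twice_knr] coincides
    with [star_shift]; otherwise gamma = alpha + k a. *)
Lemma knr_alpha : knr R G a (alpha i) = (twice_knr t k)%:R / 2.
Proof.
pose c : K := if doubled t then 2^-1 else 1.
have rE : ratioG G (alpha i) gamma = c.
  have pn := alpha_pi_neq0 i.
  rewrite /ratioG; set P := [set _ | _].
  have Pc : P c.
    split=> //; rewrite pi_star /c; case: (doubled t).
    - by rewrite scalerA mulVf ?pnatr_eq0 // scale1r.
    - by rewrite !scale1r.
    - by rewrite scaler_eq0 pnatr_eq0.
    - by rewrite scale1r.
  have [p1 _ p3] := Pc; have [q1 _ _] := xgetPex 0 (ex_intro P c Pc).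
  apply/eqP; rewrite -subr_eq0; have : (xget 0 P - c) *: pi gamma = 0.
    by rewrite scalerBl -q1 -p1 subrr.
  by move/eqP; rewrite scaler_eq0 (negbTE p3) orbF.
rewrite /knr /= rE; set P := [set _ | _].
have Pc : P ((twice_knr t k)%:R / 2).
  rewrite /P /= /c; case dt: (doubled t); last first.
    rewrite scale1r star_primed_white // (_ : twice_knr t k = k * 2)%N; last by case: t dt => //= _; rewrite mulnC.
    by rewrite natrM mulfK ?pnatr_eq0 // -scaler_int addrK.
  rewrite star_primed_doubled // scalerDr scalerA mulVf ?pnatr_eq0 // scale1r.
  rewrite -scaler_int scalerA mulrC (_ : star_shift t k = twice_knr t k) ?addrK //.
  by case: t dt => //= _; rewrite /star_shift /=; lia.
have := xgetPex 0 (ex_intro P _ Pc); move: (xget 0 P) => x; rewrite /P /= => xP.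
move: Pc; rewrite /P /= {1}xP => /addrI /oppr_inj /eqP.
by rewrite -subr_eq0 -scalerBl scaler_eq0 (negbTE (gen_neq0 mR ga)) orbF subr_eq0 => /eqP.
Qed.

End Node.
End NodeInvariants.

(** * Exponents *)

Section Dot.
Variables (K : realType) (l : nat).
Implicit Types (u v w : 'rV[K]_l.+1).

Lemma dotC u v : dot u v = dot v u.
Proof. by apply: eq_bigr => j _; rewrite mulrC. Qed.

Lemma dotDl u v w : dot (u + v) w = dot u w + dot v w.
Proof. by rewrite /dot -big_split; apply: eq_bigr => j _; rewrite rVD mulrDl. Qed.

Lemma dotZl (c : K) u v : dot (c *: u) v = c * dot u v.
Proof. by rewrite /dot mulr_sumr; apply: eq_bigr => j _; rewrite rVZ mulrA. Qed.

Lemma dotNl u v : dot (- u) v = - dot u v.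
Proof. by rewrite -scaleN1r dotZl mulN1r. Qed.

Lemma dotBl u v w : dot (u - v) w = dot u w - dot v w.
Proof. by rewrite dotDl dotNl. Qed.

Lemma dotZr (c : K) u v : dot u (c *: v) = c * dot u v.
Proof. by rewrite dotC dotZl dotC. Qed.

Lemma dotBr u v w : dot u (v - w) = dot u v - dot u w.
Proof. by rewrite dotC dotBl !(dotC _ u). Qed.

Lemma dot_vbl v : dot (vb K l) v = 0.
Proof. by rewrite /dot big1 // => j _; rewrite vbS mul0r. Qed.

Lemma dot_vbr v : dot v (vb K l) = 0.
Proof. by rewrite dotC dot_vbl. Qed.

Lemma dot_eps (i j : nat) : (1 <= i <= l)%N -> (1 <= j <= l)%N ->
  dot (eps K l i) (eps K l j) = (i == j)%:R.
Proof.
case: i j => [|i] [|j] // il jl; rewrite /dot (bigD1 (Ordinal jl)) //= !epsS // eqxx mulr1.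
rewrite big1 ?addr0 // => k kj; rewrite !epsS //.
by rewrite (_ : (j.+1 == k.+1) = false) ?mulr0 // eqSS eq_sym; apply/negbTE.
Qed.

End Dot.

(* The squared length of beta_i, with |eps_j| = 1, times the mark n_i. *)
Definition node_weight (X : nr_type) (l i : nat) : nat :=
  match X with
  | BCC => if i == l then 2 else 4
  | CvBC | CvC => if (i == 0) || (i == l) then 1 else 2
  | BBv => if (i == l) || (i <= 1) then 2 else 4
  end%N.

Definition dotE := (dotBl, dotBr, dotZl, dotZr, dot_vbl, dot_vbr).

Lemma std_simple_weight (K : realType) (X : nr_type) (l i : nat) :
  nr_rank_ok X l -> (i <= l)%N ->
  dot (std_simple K X l i) (std_simple K X l i) * (mark X i)%:R = (node_weight X l i)%:R.
Proof.
move=> Xl il; rewrite /std_simple; case: eqP => [->|/eqP i0]; last case: eqP => [->|/eqP iEl].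
- case: X Xl => /= Xl; rewrite !dotE !dot_eps //= ?Xl ?(leq_trans _ Xl) // ?eqxx /=.
  + by rewrite (ltn_eqF Xl) /=; ring.
  + by ring.
  + by rewrite orbT; ring.
  + by ring.
- have l0 : (0 < l)%N by rewrite (leq_trans _ il) // lt0n; case: X Xl => //=; case: (l) i0.
  by rewrite dot_eps ?l0 ?leqnn // eqxx mul1r /mark /node_weight eqxx ?orbT; case: X Xl => //= Xl; rewrite ?l0 ?gtn_eqF //= ?Xl.
- have iB : (1 <= i <= l)%N by rewrite lt0n i0 il.
  have iB' : (1 <= i.+1 <= l)%N by rewrite /= (ltn_neqAle i l) iEl il.
  rewrite !dotE !dot_eps // !eqxx (gtn_eqF (ltnSn i)) (ltn_eqF (ltnSn i)).
  case: X Xl => /= _; rewrite /mark /node_weight (negbTE iEl) ?(negbTE i0) ?lt0n ?i0 /= ?orbF; try by ring.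
  by rewrite [(i <= 1)%N]leqNgt; case: (1 < i)%N => /=; ring.
Qed.

Section Exponents.
Variables (K : realType) (F : vectType K) (I : {symmetric F}) (R : set F)
  (G : {vspace F}) (a : F).
Hypothesis mR : mERS I R G.
Hypothesis ga : generated_by a (root_lattice R `&` [set` G]).
Local Notation pi := (quot_proj G).
Local Notation RG := (quot_roots G R).
Variables (X : nr_type) (l : nat) (f : {linear quot G -> 'rV[K]_l.+1}).
Hypothesis Xl : nr_rank_ok X l.
Hypothesis f_iso : root_system_iso RG (affine_roots K X l) f.
Variable alpha : 'I_l.+1 -> F.
Hypothesis alpha_dc : forall i, Rdc R (alpha i).
Hypothesis alpha_std : forall i : 'I_l.+1, f (pi (alpha i)) = std_simple K X l i.



Local Notation node := (node R G a alpha).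

Let l_gt0 : (0 < l)%N. Proof. by move: Xl; case: X => //=; exact: leq_trans. Qed.

Lemma affine_root_dot (v : 'rV[K]_l.+1) : affine_roots K X l v ->
  [\/ dot v v = 1, dot v v = 2 | dot v v = 4].
Proof.
move=> /affine_rootsP[n [u [_ vS Xu]]].
have -> : dot v v = (\sum_i u i ^+ 2)%:~R.
  rewrite rmorph_sum; apply: eq_bigr => i _.
  by rewrite vS -intrM.
by case: Xu => [->|[-> _]|[-> _ _]]; [apply: Or31|apply: Or32|apply: Or33].
Qed.

(** Collapsing compares exponents, so the positivity of the common factor is enough. The witness 2 /
    c turns the squared lengths 1, 2, 4 into 2, 4, 8, and short roots exist, so the gcd is 2. *)
Lemma norm_factor_gt0 : 0 < norm_factor I R.
Proof.
have [c c0 cE] := form_dot mR Xl f_iso.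
rewrite /norm_factor; set P := [set _ | _].
suff Pt : P (2 / c) by have [] := xgetPex 0 (ex_intro P _ Pt).
have IE x : 2 / c * I x x = 2 * dot (f (pi x)) (f (pi x)).
  by rewrite cE; field; rewrite gt_eqF.
have vals x : R x -> exists z : int, 2 / c * I x x = z%:~R /\ (2 %| z)%Z.
  move=> Rx; have /affine_root_dot : affine_roots K X l (f (pi x)).
    by apply/(root_coordP f_iso); exists x.
  by rewrite IE; case=> ->; [exists 2|exists 4|exists 8]; split=> //; ring.
split; first by rewrite divr_gt0.
- by move=> x /vals[z [zE _]]; exists z.
- move=> z [x /vals[z' [-> z2]]] /intr_inj <-; exact: z2.
- move=> d; apply.
  have /(root_coordP f_iso)[x Rx xE] := short_root0 K X (Ordinal l_gt0).
  by exists x => //; rewrite IE xE dot_eps ?eqxx ?mulr1 //; exact: ord_bound.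
Qed.

Lemma sum_pi_alpha (n : {ffun 'I_l.+1 -> nat}) :
  f (\sum_i pi (alpha i) *+ n i) = \sum_i (n i)%:R *: std_simple K X l i.
Proof.
by rewrite linear_sum; apply: eq_bigr => i _; rewrite raddfMn /= alpha_std scaler_nat.
Qed.

Lemma lattice_radicalP y : (root_lattice RG `&` radical (@quot_form _ _ I G)) y <->
  exists z : int, f y = vb K l *~ z.
Proof.
have [c c0 cE] := form_dot mR Xl f_iso; have [fb fX] := f_iso.
have [_ rad _ _] := mR.
have sec y' : exists x, pi x = y'.
  by have /memv_imgP[x _ ->] : y' \in limg pi; [rewrite limg_quot_proj memvf|exists x].
have qE u v : quot_form I u v = c * dot (f u) (f v).
  have [x <-] := sec u; have [x' <-] := sec v.
  by rewrite quot_formE.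
split=> [[[n [v [m [vR yE]]] yrad]]|[z yE]]; last split.
- have y0 : exists z : int, f y 0 0 = z%:~R.
    rewrite yE linear_sum summxE.
    elim/big_ind : _ => [|_ _ [p ->] [q ->]|i _]; first by exists 0.
      by exists (p + q); rewrite intrD.
    have /(quot_rootP f_iso)/affine_rootsP[p [_ [p0 _ _]]] := vR i.
    by exists (p * m i); rewrite raddfMz -scaler_int rVZ p0 intrM mulrC.
  have [z zE] := y0; exists z; apply: rV_split_eq => [|j].
    by rewrite zE -scaler_int rVZ vb0 mulr1.
  rewrite -scaler_int rVZ vbS mulr0.
  have [fi _ fiK] := fb; have := yrad (fi (eps K l j.+1)); rewrite qE fiK.
  move=> /eqP; rewrite mulf_eq0 gt_eqF //= => /eqP.
  rewrite /dot (bigD1 j) //= epsS ?eqxx ?mulr1; last exact: ord_bound.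
  rewrite big1 ?addr0 // => k kj; rewrite epsS; last exact: ord_bound.
  by rewrite eqSS val_eqE eq_sym (negbTE kj) mulr0.
- have [fi fiK fiK'] := fb; pose j := Ordinal l_gt0.
  pose u n := fi (eps K l j.+1 + vb K l *~ n).
  have uR n : RG (u n) by apply/(quot_rootP f_iso); rewrite fiK'; exact: short_root.
  (* This writes z b as z (eps_1 + b) - z eps_1. *)
  exists 2%N, (fun i => if i == ord0 then u 1 else u 0), (fun i => if i == ord0 then z else - z).
  split; first by move=> i; case: ifP.
  apply: (bij_inj fb); rewrite !big_ord_recl big_ord0 addr0 /= linearD /=.
  by rewrite !raddfMz /= /u !fiK' yE mulrNz -mulrzBl mulr0z addr0 addrAC subrr add0r mulr1z.
- move=> w; rewrite qE yE -scaler_int dotZl dot_vbl !mulr0 //.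
Qed.

(** The radical part of the lattice corresponds to Z b, whose generators are b and -b; positive
    coefficients single out b. *)
Lemma marksE i : marks I R G alpha i = mark X i.
Proof.
have [fb _] := f_iso; rewrite /marks; set P := [set _ | _].
have fmark (n : {ffun 'I_l.+1 -> nat}) : (forall i, n i = mark X i) ->
    f (\sum_i pi (alpha i) *+ n i) = vb K l.
  move=> nE; rewrite sum_pi_alpha (vb_sum K Xl); apply: eq_bigr => j _.
  by rewrite nE scaler_nat pmulrn.
pose n0 := [ffun i : 'I_l.+1 => mark X i].
have n0E j : n0 j = mark X j by rewrite ffunE.
have P0 : P n0.
  split; first by move=> j; rewrite n0E; case: X; rewrite /mark; lia.
  apply/seteqP; split=> y.
    move=> /lattice_radicalP[z yE]; exists z => //; apply: (bij_inj fb).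
    by rewrite raddfMz /= fmark.
  by move=> [z _ <-]; apply/lattice_radicalP; exists z; rewrite raddfMz /= fmark.
have [n_gt0 n_gen] := xgetPex [ffun=> 0%N] (ex_intro P _ P0).
move: (xget _ P) n_gt0 n_gen => n n_gt0 n_gen.
have [z zE] : exists z : int, f (\sum_i pi (alpha i) *+ n i) = vb K l *~ z.
  by apply/lattice_radicalP; rewrite n_gen; exists 1.
have [z' z'E] : exists z' : int, vb K l *~ z *~ z' = vb K l.
  have [fi _ fiK] := fb.
  have : (root_lattice RG `&` radical (@quot_form _ _ I G)) (fi (vb K l)).
    by apply/lattice_radicalP; exists 1; rewrite fiK.
  by rewrite n_gen => -[z' _ z'E]; exists z'; have := congr1 f z'E; rewrite raddfMz /= zE fiK.
have zz : z * z' = 1.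
  apply: (@intr_inj K); have := congr1 (fun v : 'rV[K]_l.+1 => v 0 0) z'E.
  by rewrite -mulrzA -scaler_int rVZ vb0 mulr1.
have nz j : (n j)%:Z = (mark X j)%:Z * z.
  apply: (@intr_inj K); apply/eqP; rewrite -subr_eq0; apply/eqP.
  apply: (@std_simple_free K X l (fun j => (n j)%:Z%:~R - ((mark X j)%:Z * z)%:~R) Xl).
  under eq_bigr do rewrite scalerBl.
  rewrite sumrB -sum_pi_alpha zE (vb_sum K Xl) mulrz_suml -sumrB big1 // => k _.
  by rewrite scaler_int mulrzA subrr.
have nj := n_gt0 i; have := nz i; have := nz ord0; have n00 := n_gt0 ord0.
have -> : mark X (@ord0 l) = 1%N by case: X.
move=> h0 hi; have z0 : 1 <= z by move: (n ord0) n00 h0 => n' n00; rewrite mul1r => <-.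
have z'0 : 1 <= z' by nia.
have z1 : z = 1 by nia.
by move: hi; rewrite z1 mulr1 => -[].
Qed.

(** Each exponent is [node_weight] / [twice_knr] times one positive constant. Cross-multiplication
    turns the comparison into one of natural numbers, which can be evaluated. *)
Lemma collapsedP (t : 'I_l.+1 -> node_type) (k : 'I_l.+1 -> nat) (i : 'I_l.+1) :
  (forall j, node j (t j) (k j)) -> (forall j, (0 < k j)%N) ->
  collapsed I R G a alpha i <-> exists j : 'I_l.+1,
    (node_weight X l i * twice_knr (t j) (k j) < node_weight X l j * twice_knr (t i) (k i))%N.
Proof.
move=> nP k0; have [c c0 cE] := form_dot mR Xl f_iso.
have kn0 j : (0 < twice_knr (t j) (k j))%N by have := k0 j; case: (t j) => /=; lia.
pose e (j : 'I_l.+1) : K := (node_weight X l j)%:R / (twice_knr (t j) (k j))%:R.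
have eE (j : 'I_l.+1) : exponent I R G a alpha j = norm_factor I R * c * e j.
  rewrite /exponent (knr_alpha mR ga Xl alpha_std (nP j) (k0 j)) marksE.
  have kj : (twice_knr (t j) (k j))%:R != 0 :> K by rewrite pnatr_eq0 -lt0n kn0.
  have jl : (j <= l)%N by rewrite -ltnS.
  rewrite /IR cE alpha_std /e -(std_simple_weight K Xl jl).
  move: (dot _ _) (norm_factor _ _) (mark _ _)%:R kj => x y z; move: (_%:R) => w w0.
  by field; rewrite w0.
have nc0 : 0 < norm_factor I R * c by rewrite mulr_gt0 // norm_factor_gt0.
have ltE (j j' : 'I_l.+1) : (exponent I R G a alpha j < exponent I R G a alpha j') =
    (node_weight X l j * twice_knr (t j') (k j') < node_weight X l j' * twice_knr (t j) (k j))%N.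
  rewrite !eE ltr_pM2l // /e ltr_pdivrMr ?ltr0n // mulrAC ltr_pdivlMr ?ltr0n //.
  by rewrite -!natrM ltr_nat.
rewrite /collapsed /max_exponent; split=> [lt|[j]].
  apply: contrapT => no; move: lt; rewrite ltNge => /negP; apply.
  have le j : exponent I R G a alpha j <= exponent I R G a alpha i.
    by rewrite leNgt; apply/negP; rewrite ltE => h; apply: no; exists j.
  by apply/bigmax_leP; split.
by rewrite -ltE => lt; apply: lt_le_trans lt _; apply: le_bigmax.
Qed.
End Exponents.

(** * Diagrams and rows *)

Section Combinatorics.
Local Open Scope nat_scope.

Definition node_class : Type := (nat * node_type * nat)%type.

(* Exponents are proportional to w / (2 k^nr). *)
Definition lighter (c c' : node_class) : bool :=
  let: (w, t, k) := c in let: (w', t', k') := c' in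
  w * twice_knr t' k' < w' * twice_knr t k.

Definition class_data (s : seq node_class) (c : node_class) : node_data :=
  let: (w, t, k) := c in
  Node (node_colour t) k (if has (lighter c) s then None else Some (star_colour t))
    (star_period t k).

(** For l = 1 there is no middle node, and its class must not influence the largest exponent. *)
Definition chain_classes (l : nat) (c0 cm cl : node_class) : seq node_class :=
  if 2 <= l then [:: c0; cm; cl] else [:: c0; cl].

Definition chain_data (l : nat) (c0 cm cl : node_class) : Defs.row :=
  let s := chain_classes l c0 cm cl in
  chain_row l (class_data s c0) (class_data s cm) (class_data s cl).

Definition fork_data (l : nat) (c0 cm cl : node_class) : Defs.row :=
  let s := [:: c0; cm; cl] in
  fork_row l (class_data s c0) (class_data s cm) (class_data s cl).

(* Rows are compared only at the indices 0, ..., l. *)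
Definition row_in (l : nat) (r : Defs.row) (s : seq Defs.row) : Prop :=
  exists2 r', List.In r' s & forall i, i <= l -> r i = r' i.

Lemma row_in_refl l r s : List.In r s -> row_in l r s.
Proof. by exists r. Qed.

Lemma chain_row1 l d0 dm dm' dl i : l <= 1 -> i <= l ->
  chain_row l d0 dm dl i = chain_row l d0 dm' dl i.
Proof. by rewrite /chain_row; case: l => [|[|]] //; case: i => [|[|]]. Qed.




Section Diagram.
Variables (X : nr_type) (l : nat) (t : nat -> node_type) (k : nat -> nat).

Definition diagram_class (i : nat) : node_class := (node_weight X l i, t i, k i).

Definition diagram_row : Defs.row :=
  fun i => class_data [seq diagram_class j | j <- iota 0 l.+1] (diagram_class i).

Lemma class_data_ext (s s' : seq node_class) c :
  (forall p, has p s = has p s') -> class_data s c = class_data s' c.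
Proof. by move=> e; rewrite /class_data e. Qed.

Lemma has_diagram (p : pred node_class) : reflect (exists2 i, i <= l & p (diagram_class i))
  (has p [seq diagram_class j | j <- iota 0 l.+1]).
Proof.
rewrite has_map; apply: (iffP hasP) => -[i]; first by rewrite mem_iota; exists i.
by exists i => //; rewrite mem_iota.
Qed.

(** [class_data] sees its list only through [has], hence only through the classes that occur.
    Passing to two or three classes makes the collapse test computable for a symbolic l. *)
Lemma chain_diagram (cm : node_class) : 1 <= l ->
  (forall i, 0 < i < l -> diagram_class i = cm) ->
  forall i, i <= l -> diagram_row i =
    chain_data l (diagram_class 0) cm (diagram_class l) i.
Proof.
move=> l1 mid; have e (p : pred node_class) : has p [seq diagram_class j | j <- iota 0 l.+1] =
    has p (chain_classes l (diagram_class 0) cm (diagram_class l)).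
  apply/has_diagram/idP => [[i il]|].
    have [->|i0] := posnP i.
      by rewrite /chain_classes; case: ifP => _ /= ->.
    case: (ltngtP i l) il => // [il _|-> _]; last first.
      by rewrite /chain_classes; case: ifP => _ /= ->; rewrite !orbT.
    rewrite mid ?i0 // /chain_classes (_ : 2 <= l); last by apply: leq_trans il.
    by move=> /= ->; rewrite orbT.
  rewrite /chain_classes; case: ifP => [l2|_] /=; rewrite orbF.
    case/or3P => h; [by exists 0| |by exists l].
    by exists 1; [|rewrite mid].
  by case/orP => h; [exists 0|exists l].
move=> i il; rewrite /diagram_row (class_data_ext _ e) /chain_data /chain_row.
case: eqP => [->//|/eqP i0]; case: eqP => [->//|/eqP iNl].
have iB : 0 < i < l by rewrite lt0n i0 ltn_neqAle iNl.
by rewrite (mid i iB).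
Qed.

Lemma fork_diagram (cm : node_class) : 3 <= l -> diagram_class 1 = diagram_class 0 ->
  (forall i, 1 < i < l -> diagram_class i = cm) ->
  forall i, i <= l -> diagram_row i =
    fork_data l (diagram_class 0) cm (diagram_class l) i.
Proof.
move=> l3 d1 mid; have e (p : pred node_class) : has p [seq diagram_class j | j <- iota 0 l.+1] =
    has p [:: diagram_class 0; cm; diagram_class l].
  apply/has_diagram/idP => [[i il]|] /=; rewrite ?orbF.
    case: i il => [|[|i]] il; [by move=> ->|by rewrite d1 => ->|].
    case: (ltngtP i.+2 l) il => // [il _|-> _ ->]; last by rewrite !orbT.
    by rewrite mid // => ->; rewrite orbT.
  case/or3P => h; [by exists 0| |by exists l].
  by exists 2; [exact: leq_trans l3|rewrite mid].
move=> i il; rewrite /diagram_row (class_data_ext _ e) /fork_data /fork_row.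
case: i il => [|[|i]] il; [by []|by rewrite d1|].
rewrite [i.+2 <= 1]/=; case: eqP => [<-//|/eqP iNl].
by rewrite (mid i.+2) //= ltn_neqAle iNl.
Qed.

Lemma equal_middle (i0 : nat) :
  (forall i, i0 <= i -> i.+1 < l -> (k i %| k i.+1) && (k i.+1 %| k i)) ->
  forall i, i0 <= i < l -> k i = k i0.
Proof.
move=> h; elim=> [|i IH] /andP[]; first by rewrite leqn0 => /eqP ->.
rewrite leq_eqVlt => /orP[/eqP ->//|i0i] il.
have /andP[h1 h2] := h i i0i il.
have <- : k i = k i0 by apply: IH; apply/andP; split; [exact: i0i|exact: ltnW].
by apply/eqP; rewrite eqn_dvd h1 h2.
Qed.

End Diagram.

Ltac find_row := first [left; reflexivity | right; find_row].

Lemma mem_divisors_of m n : m %| n -> 0 < n -> m \in divisors n.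
Proof. by move=> mn n0; rewrite -dvdn_divisors. Qed.

(** By coprimality each number divides 2. It is applied to the two ends of a chain of type C^vee BC
    or C^vee C. *)
Lemma coprime_gcd_1 (k d : nat) : gcdn k d = 1 -> k %| 2 * d -> d %| 2 * k ->
  k \in [:: 1; 2] /\ d \in [:: 1; 2].
Proof.
move=> g; have c : coprime k d by rewrite /coprime g.
by rewrite Gauss_dvdl // Gauss_dvdl 1?coprime_sym // => h1 h2; split; apply: (@mem_divisors_of _ 2).
Qed.


Lemma chain_reduce (X : nr_type) (l : nat) (T : nat -> node_type) (k : nat -> nat)
    (w0 wm wl m : nat) (s : seq Defs.row) : 1 <= l ->
  node_weight X l 0 = w0 -> node_weight X l l = wl ->
  (forall i, 0 < i < l -> [/\ node_weight X l i = wm, T i = WW & k i = m]) ->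
  row_in l (chain_data l (w0, T 0, k 0) (wm, WW, m) (wl, T l, k l)) s ->
  row_in l (diagram_row X l T k) s.
Proof.
move=> l1 <- <- mid [r rs rE]; exists r => // i il; rewrite -rE //.
by apply: chain_diagram => // j /mid[e1 e2 e3]; rewrite /diagram_class e1 e2 e3.
Qed.

Lemma row_in_chain1 (l : nat) (d0 dm dm' dl : node_data) (s : seq Defs.row) : l <= 1 ->
  List.In (chain_row l d0 dm dl) s -> row_in l (chain_row l d0 dm' dl) s.
Proof. by move=> l1 h; exists (chain_row l d0 dm dl) => // i il; exact: chain_row1. Qed.

Section Rows.
Variables (l : nat) (T : nat -> node_type) (k : nat -> nat).
Local Notation edge i j n := (edge_ok n (T i) (k i) (T j) (k j)).
Hypothesis k_gcd : forall g, (forall i, i <= l -> g %| k i) -> g = 1.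
Hypothesis T_end : doubled (T l).

Section Chain.
Hypothesis l1 : 1 <= l.
Hypothesis T_mid : forall i, 0 < i < l -> T i = WW.
Hypothesis E_mid : forall i, 0 < i -> i.+1 < l -> edge i i.+1 1 && edge i.+1 i 1.
Hypothesis E_end : 2 <= l -> edge l.-1 l 1 && edge l l.-1 2.

Lemma chain_middle i : 0 < i < l -> k i = k 1.
Proof.
apply: equal_middle => j j0 jl; have jB : 0 < j < l by rewrite j0 ltnW.
have jB' : 0 < j.+1 < l by [].
have /andP[/and4P[h1 _ _ _] /and4P[h2 _ _ _]] := E_mid j0 jl.
by rewrite !mul1n in h1 h2; rewrite h1 h2.
Qed.

Lemma chain_end : 2 <= l -> edge_ok 1 WW (k 1) (T l) (k l) && edge_ok 2 (T l) (k l) WW (k 1).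
Proof.
move=> l2; have lB : 0 < l.-1 < l by case: l l2 => [|[|]] /=.
by have := E_end l2; rewrite T_mid // chain_middle.
Qed.

Lemma chain_gcd : 2 <= l -> forall g, g %| k 0 -> g %| k 1 -> g %| k l -> g = 1.
Proof.
move=> l2 g g0 g1 gl; apply: k_gcd => i; case: i => // i.
by rewrite leq_eqVlt => /orP[/eqP ->//|il]; rewrite chain_middle.
Qed.

Lemma chain_gcd1 : l = 1 -> forall g, g %| k 0 -> g %| k l -> g = 1.
Proof. by move=> ll g g0 g1; apply: k_gcd => -[|[|i]] //; rewrite ?ll // -ll. Qed.

Lemma chain_gt0 : 0 < k 0 -> (2 <= l -> 0 < k 1) -> 0 < k l -> forall i, i <= l -> 0 < k i.
Proof.
move=> h0 h1 hl i; case: i => // i; rewrite leq_eqVlt => /orP[/eqP ->//|il].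
rewrite chain_middle // h1 //; exact: leq_trans il.
Qed.

Lemma chain_mid_class X wm : (forall i, 0 < i < l -> node_weight X l i = wm) ->
  forall i, 0 < i < l -> [/\ node_weight X l i = wm, T i = WW & k i = k 1].
Proof. by move=> h i il; rewrite h // T_mid // chain_middle. Qed.

Lemma chain_conclude X w0 wm wl : 0 < k 0 -> (2 <= l -> 0 < k 1) -> 0 < k l ->
  node_weight X l 0 = w0 -> node_weight X l l = wl ->
  (forall i, 0 < i < l -> node_weight X l i = wm) ->
  row_in l (chain_data l (w0, T 0, k 0) (wm, WW, k 1) (wl, T l, k l)) (rows X l) ->
  (forall i, i <= l -> 0 < k i) /\ row_in l (diagram_row X l T k) (rows X l).
Proof.
move=> k0 k1 kl e0 el em hr; split; first exact: chain_gt0.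
by apply: chain_reduce hr => // i iB; have [] := chain_mid_class em iB.
Qed.

(** For l >= 2, k_l divides k_1, which divides k_0, so k_l is a common divisor and equals 1; in the
    other direction k_1 divides 2 and k_0 divides 2 k_1. For l = 1, k_l divides k_0 and k_0 divides
    4 k_l. Evaluating [edge_ok] on these candidates leaves the rows. *)
Lemma BCC_rows : T 0 = WW ->
  (2 <= l -> edge 0 1 1 && edge 1 0 2) -> (l = 1 -> edge 0 l 1 && edge l 0 4) ->
  (forall i, i <= l -> 0 < k i) /\ row_in l (diagram_row BCC l T k) (rows BCC l).
Proof.
move=> T0 E0 E1.
have e0 : node_weight BCC l 0 = 4 by rewrite /node_weight ltn_eqF.
have el : node_weight BCC l l = 2 by rewrite /node_weight eqxx.
have em i : 0 < i < l -> node_weight BCC l i = 4.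
  by case/andP=> _ il; rewrite /node_weight ltn_eqF.
suff [h0 h1 hl hr] : [/\ 0 < k 0, 2 <= l -> 0 < k 1, 0 < k l &
    row_in l (chain_data l (4, T 0, k 0) (4, WW, k 1) (2, T l, k l)) (rows BCC l)].
  exact: chain_conclude e0 el em hr.
rewrite T0 /chain_data /chain_classes /= /rows_BCC.
have [l2|l2] := leqP 2 l.
  have := E0 l2; rewrite T0 T_mid // => /andP[/and4P[d1 _ _ _] /and4P[d2 _ _ _]].
  have /andP[h2 /and4P[m2 _ h1 _]] := chain_end l2.
  have kl : k l = 1.
    case/and4P: h2 => h2 _ _ _; rewrite !mul1n in h2 d1.
    by apply: chain_gcd => //; apply: dvdn_trans h2 _.
  move: m2 h1 h2 d1 d2; rewrite kl; move: (k 0) (k 1) (T l) T_end => d m t dt m2 h1 h2 d1 d2.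
  have m4 : m \in [:: 1; 2] by rewrite (mem_divisors_of m2).
  have d4 : d \in [:: 1; 2; 4].
    apply: (@mem_divisors_of _ 4) => //; apply: dvdn_trans d2 _.
    by move: m4; rewrite !inE => /orP[]/eqP->.
  move: m4 d4; rewrite !inE => /orP[]/eqP mE /or3P[]/eqP dE;
  move: m2 h1 h2 d1 d2; rewrite mE dE; case: t dt => //= _;
  rewrite /edge_ok //= => *; split=> //; apply: row_in_refl; find_row.
have ll : l = 1 by apply/eqP; rewrite eqn_leq l1 andbT.
have := E1 ll; rewrite T0 => /andP[h1 h2].
have kl : k l = 1.
  by apply: chain_gcd1 => //; case/and4P: h1; rewrite mul1n.
move: h1 h2; rewrite kl; move: (k 0) (T l) T_end => d t dt h1 h2.
have d4 : d \in [:: 1; 2; 4] by case/and4P: h2 => h2 _ _ _; exact: (@mem_divisors_of _ 4).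
move: d4; rewrite !inE => /or3P[]/eqP dE;
move: h1 h2; rewrite dE; case: t dt => //= _;
rewrite /edge_ok //= => *; split=> //; apply: row_in_chain1 => //; find_row.
Qed.

(** For l >= 2, both k_0 and k_l divide k_1, so a common divisor of the ends divides everything and
    the ends are coprime. Since k_1 divides 2 k_0 and 2 k_l, [coprime_gcd_1] bounds them; for l = 1
    it applies directly. *)
Lemma CvBC_rows : T 0 = WW ->
  (2 <= l -> edge 0 1 2 && edge 1 0 1) -> (l = 1 -> edge 0 l 2 && edge l 0 2) ->
  (forall i, i <= l -> 0 < k i) /\ row_in l (diagram_row CvBC l T k) (rows CvBC l).
Proof.
move=> T0 E0 E1.
have e0 : node_weight CvBC l 0 = 1 by [].
have el : node_weight CvBC l l = 1 by rewrite /node_weight eqxx orbT.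
have em i : 0 < i < l -> node_weight CvBC l i = 2.
  by case/andP=> i0 il; rewrite /node_weight gtn_eqF // ltn_eqF.
suff [h0 h1 hl hr] : [/\ 0 < k 0, 2 <= l -> 0 < k 1, 0 < k l &
    row_in l (chain_data l (1, T 0, k 0) (2, WW, k 1) (1, T l, k l)) (rows CvBC l)].
  exact: chain_conclude e0 el em hr.
rewrite T0 /chain_data /chain_classes /= /rows_CvBC.
have [l2|l2] := leqP 2 l.
  have := E0 l2; rewrite T0 T_mid // => /andP[/and4P[d1 _ _ _] /and4P[d2 _ _ _]].
  have /andP[h2 /and4P[m2 _ h1 _]] := chain_end l2.
  have [hk _ _ _] := and4P h2; rewrite !mul1n in hk d2.
  have g1 : gcdn (k l) (k 0) = 1.
    apply: chain_gcd => //; [exact: dvdn_gcdr| |exact: dvdn_gcdl].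
    by apply: dvdn_trans (dvdn_gcdr _ _) d2.
  have [klB k0B] := coprime_gcd_1 g1 (dvdn_trans hk d1) (dvdn_trans d2 m2).
  move: g1 m2 h1 h2 d1 d2 klB k0B; move: (k 0) (k 1) (k l) (T l) T_end => d m kl t dt.
  move=> g1 m2 h1 h2 d1 d2 klB k0B.
  have m4 : m \in [:: 1; 2; 4].
    apply: (@mem_divisors_of _ 4) => //; apply: dvdn_trans m2 _.
    by move: klB; rewrite !inE => /orP[]/eqP->.
  move: m4 klB k0B; rewrite !inE => /or3P[]/eqP mE /orP[]/eqP kE /orP[]/eqP dE;
  move: g1 m2 h1 h2 d1 d2 {hk}; rewrite mE dE kE; case: t dt => //= _;
  rewrite /edge_ok //= => *; split=> //; apply: row_in_refl; find_row.
have ll : l = 1 by apply/eqP; rewrite eqn_leq l1 andbT.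
have := E1 ll; rewrite T0 => /andP[h1 h2].
have g1 : gcdn (k l) (k 0) = 1.
  by apply: chain_gcd1 => //; [exact: dvdn_gcdr|exact: dvdn_gcdl].
have [hk _ _ _] := and4P h1; have [hd _ _ _] := and4P h2.
have [klB k0B] := coprime_gcd_1 g1 hk hd.
move: g1 h1 h2 klB k0B {hk hd}; move: (k 0) (k l) (T l) T_end => d kl t dt.
rewrite !inE => g1 h1 h2 /orP[]/eqP kE /orP[]/eqP dE;
move: g1 h1 h2; rewrite dE kE; case: t dt => //= _;
rewrite /edge_ok //= => *; split=> //; apply: row_in_chain1 => //; find_row.
Qed.

(** The divisibilities are those of [CvBC_rows], but node 0 now has a doubled type as well. The list
    contains each unordered pair of ends in one order only, whence the reversed alternative. *)
Lemma CvC_rows : doubled (T 0) ->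
  (2 <= l -> edge 0 1 2 && edge 1 0 1) -> (l = 1 -> edge 0 l 2 && edge l 0 2) ->
  (forall i, i <= l -> 0 < k i) /\
  (row_in l (diagram_row CvC l T k) (rows CvC l) \/
   row_in l (diagram_row CvC l (fun i => T (l - i)) (fun i => k (l - i))) (rows CvC l)).
Proof.
move=> T0 E0 E1.
have e0 : node_weight CvC l 0 = 1 by [].
have el : node_weight CvC l l = 1 by rewrite /node_weight eqxx orbT.
have em i : 0 < i < l -> node_weight CvC l i = 2.
  by case/andP=> i0 il; rewrite /node_weight gtn_eqF // ltn_eqF.
have revB i : 0 < i < l -> 0 < l - i < l by lia.
suff [[h0 h1 hl] hr] : [/\ 0 < k 0, 2 <= l -> 0 < k 1 & 0 < k l] /\
    (row_in l (chain_data l (1, T 0, k 0) (2, WW, k 1) (1, T l, k l)) (rows CvC l) \/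
     row_in l (chain_data l (1, T l, k l) (2, WW, k 1) (1, T 0, k 0)) (rows CvC l)).
  split; first exact: chain_gt0.
  case: hr => hr; [left|right].
    by apply: chain_reduce hr => // i iB; have [] := chain_mid_class em iB.
  apply: (@chain_reduce CvC l _ _ 1 2 1 (k 1)) => // [i iB|]; last by rewrite subn0 subnn.
  by have [_ e2 e3] := chain_mid_class em (revB _ iB); rewrite em.
rewrite /chain_data /chain_classes /= /rows_CvC.
have [l2|l2] := leqP 2 l.
  have := E0 l2; rewrite (T_mid (i := 1)) // => /andP[d1 d2].
  have /andP[h2 h1] := chain_end l2.
  have [hk _ _ _] := and4P h2; have [hd _ _ _] := and4P d2; rewrite !mul1n in hk hd.
  have [m2 _ _ _] := and4P h1; have [m1 _ _ _] := and4P d1.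
  have g1 : gcdn (k l) (k 0) = 1.
    apply: chain_gcd => //; [exact: dvdn_gcdr| |exact: dvdn_gcdl].
    by apply: dvdn_trans (dvdn_gcdr _ _) hd.
  have [klB k0B] := coprime_gcd_1 g1 (dvdn_trans hk m1) (dvdn_trans hd m2).
  move: g1 h1 h2 d1 d2 klB k0B m2 {m1 hk hd}.
  move: (k 0) (k 1) (k l) (T l) T_end (T 0) T0 => d m kl t dt u du.
  move=> g1 h1 h2 d1 d2 klB k0B m2.
  have m4 : m \in [:: 1; 2; 4].
    apply: (@mem_divisors_of _ 4) => //; apply: dvdn_trans m2 _.
    by move: klB; rewrite !inE => /orP[]/eqP->.
  move: m4 klB k0B; rewrite !inE => /or3P[]/eqP mE /orP[]/eqP kE /orP[]/eqP dE;
  move: g1 h1 h2 d1 d2 {m2}; rewrite mE dE kE; case: t dt => //= _; case: u du => //= _;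
  rewrite /edge_ok //= => *; (split; first by []);
  first [left; apply: row_in_refl; find_row | right; apply: row_in_refl; find_row].
have ll : l = 1 by apply/eqP; rewrite eqn_leq l1 andbT.
have /andP[h1 h2] := E1 ll.
have g1 : gcdn (k l) (k 0) = 1.
  by apply: chain_gcd1 => //; [exact: dvdn_gcdr|exact: dvdn_gcdl].
have [hk _ _ _] := and4P h1; have [hd _ _ _] := and4P h2.
have [klB k0B] := coprime_gcd_1 g1 hk hd.
move: g1 h1 h2 klB k0B {hk hd}; move: (k 0) (k l) (T l) T_end (T 0) T0 => d kl t dt u du.
rewrite !inE => g1 h1 h2 /orP[]/eqP kE /orP[]/eqP dE;
move: g1 h1 h2; rewrite dE kE; case: t dt => //= _; case: u du => //= _;
rewrite /edge_ok //= => *; (split; first by []);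
first [left; apply: row_in_chain1 => //; find_row | right; apply: row_in_chain1 => //; find_row].
Qed.

End Chain.

(** Simple edges among the white nodes give divisibility both ways, so these nodes share one
    counting number; k_l divides it, hence k_l = 1, and it divides 2 k_l. *)
Lemma BBv_rows : 3 <= l -> (forall i, i < l -> T i = WW) ->
  (forall i, 2 <= i -> i.+1 < l -> edge i i.+1 1 && edge i.+1 i 1) ->
  edge l.-1 l 1 && edge l l.-1 2 ->
  edge 0 2 1 && edge 2 0 1 -> edge 1 2 1 && edge 2 1 1 ->
  (forall i, i <= l -> 0 < k i) /\ row_in l (diagram_row BBv l T k) (rows BBv l).
Proof.
move=> l3 T_mid E_mid E_end E0 E1.
have T2 : T 2 = WW by exact: T_mid.
have k20 : k 2 = k 0.
  move: E0; rewrite T2 T_mid ?(leq_trans _ l3) // => /andP[/and4P[h1 _ _ _] /and4P[h2 _ _ _]].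
  by rewrite !mul1n in h1 h2; apply/eqP; rewrite eqn_dvd h1 h2.
have k21 : k 2 = k 1.
  move: E1; rewrite T2 T_mid ?(leq_trans _ l3) // => /andP[/and4P[h1 _ _ _] /and4P[h2 _ _ _]].
  by rewrite !mul1n in h1 h2; apply/eqP; rewrite eqn_dvd h1 h2.
have kmid i : i < l -> k i = k 0.
  case: i => [|[|i]] il //; rewrite -?k20 // -?k21 //.
  apply: (@equal_middle l k 2) => // j j2 jl.
  have /andP[/and4P[h1 _ _ _] /and4P[h2 _ _ _]] := E_mid j j2 jl.
  by rewrite !mul1n in h1 h2; rewrite h1 h2.
have lB : l.-1 < l by case: l l3.
move: E_end; rewrite (T_mid _ lB) (kmid _ lB) => /andP[h2 h1].
have kl : k l = 1.
  apply: k_gcd => i; rewrite leq_eqVlt => /orP[/eqP ->//|il]; rewrite (kmid _ il).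
  by case/and4P: h2; rewrite mul1n.
have d01 : diagram_class BBv l T k 1 = diagram_class BBv l T k 0.
  by rewrite /diagram_class !T_mid ?(leq_trans _ l3) // -k21 -k20 /node_weight !orbT.
have em i : 1 < i < l -> diagram_class BBv l T k i = (4, WW, k 0).
  case/andP=> i1 il; rewrite /diagram_class T_mid // kmid // /node_weight.
  by rewrite ltn_eqF // leqNgt i1.
suff [h0 hr] : 0 < k 0 /\ row_in l (fork_data l (2, WW, k 0) (4, WW, k 0) (2, T l, k l)) (rows BBv l).
  split=> [i|].
    by rewrite leq_eqVlt => /orP[/eqP ->|il]; [rewrite kl|rewrite kmid].
  case: hr => r rs rE; exists r => // i il; rewrite -rE // (fork_diagram l3 d01 em) //.
  by rewrite /diagram_class /node_weight eqxx T_mid ?orbT // (leq_trans _ l3).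
rewrite /rows gtn_eqF // kl; move: h1 h2; rewrite kl /rows_BBv /fork_data.
move: (k 0) (T l) T_end => m t dt h1 h2.
have m4 : m \in [:: 1; 2] by case/and4P: h1 => h1 _ _ _; exact: (@mem_divisors_of _ 2).
move: m4; rewrite !inE => /orP[]/eqP mE;
move: h1 h2; rewrite mE; case: t dt => //= _;
rewrite /edge_ok //= => *; (split; first by []); apply: row_in_refl; find_row.
Qed.

(** Nodes 0 and 1 are both attached to node 2. As k_2 divides k_0 and k_1, it is 1, and k_0, k_1 are
    1 or 2; the list has the unequal pair only as (2, 1), so (1, 2) requires the swap of nodes 0 and
    1. *)
Lemma BBv2_rows : l = 2 -> (forall i, i < l -> T i = WW) ->
  edge 0 l 1 && edge l 0 2 -> edge 1 l 1 && edge l 1 2 ->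
  (forall i, i <= l -> 0 < k i) /\
  (row_in l (diagram_row BBv l T k) (rows BBv l) \/
   row_in l (diagram_row BBv l (fun i => T (if i < l then 1 - i else i))
     (fun i => k (if i < l then 1 - i else i))) (rows BBv l)).
Proof.
move=> l2 T_mid; move: k_gcd T_end T_mid; rewrite l2 => gcd2 T2 T_mid.
have T0 := T_mid 0 isT; have T1 := T_mid 1 isT.
rewrite T0 T1 => /andP[h0 h0'] /andP[h1 h1'].
have k2 : k 2 = 1.
  apply: gcd2 => -[|[|[|i]]] //; first by case/and4P: h0; rewrite mul1n.
  by case/and4P: h1; rewrite mul1n.
suff [p0 p1 hr] : [/\ 0 < k 0, 0 < k 1 &
    row_in 2 (chain_data 2 (2, WW, k 0) (2, WW, k 1) (2, T 2, k 2)) (rows BBv 2) \/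
    row_in 2 (chain_data 2 (2, WW, k 1) (2, WW, k 0) (2, T 2, k 2)) (rows BBv 2)].
  split; first by case=> [|[|[|i]]] //; rewrite k2.
  case: hr => hr; [left|right].
    have := @chain_reduce BBv 2 T k 2 2 2 (k 1) (rows BBv 2); rewrite T0.
    by apply=> //; case=> [|[|i]].
  have := @chain_reduce BBv 2 (fun i => T (if i < 2 then 1 - i else i)) (fun i => k (if i < 2 then 1 - i else i)) 2 2 2 (k 0) (rows BBv 2).
  by rewrite /= T1; apply=> //; case=> [|[|i]].
move: h0 h0' h1 h1'; rewrite k2; move: (k 0) (k 1) (T 2) T2 => m n t dt h0 h0' h1 h1'.
have m4 : m \in [:: 1; 2] by case/and4P: h0' => h _ _ _; exact: (@mem_divisors_of _ 2).
have n4 : n \in [:: 1; 2] by case/and4P: h1' => h _ _ _; exact: (@mem_divisors_of _ 2).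
move: m4 n4; rewrite !inE => /orP[]/eqP mE /orP[]/eqP nE;
move: h0 h0' h1 h1'; rewrite mE nE; case: t dt => //= _;
rewrite /edge_ok //= => *; (split; [by []|by []|]);
first [left; apply: row_in_refl; find_row | right; apply: row_in_refl; find_row].
Qed.

End Rows.

End Combinatorics.

(** * Inner products of the standard simple roots *)

Section StandardDots.
Variables (K : realType) (X : nr_type) (l : nat).
Local Notation be := (std_simple K X l).

Lemma std_simple_mid i : (0 < i < l)%N -> be i = eps K l i - eps K l i.+1.
Proof. by case/andP=> i0 il; rewrite /std_simple gtn_eqF // ltn_eqF. Qed.

Lemma std_simple_end : (0 < l)%N -> be l = eps K l l.
Proof. by move=> l0; rewrite /std_simple gtn_eqF // eqxx. Qed.

Lemma dot_mid_self i : (0 < i < l)%N -> dot (be i) (be i) = 2.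
Proof.
move=> iB; rewrite std_simple_mid // !dotE !dot_eps ?eqxx; try lia.
by rewrite (gtn_eqF (ltnSn i)) (ltn_eqF (ltnSn i)) /=; ring.
Qed.

Lemma dot_mid_next i : (0 < i)%N -> (i.+1 < l)%N -> dot (be i) (be i.+1) = -1.
Proof.
move=> i0 il; rewrite !std_simple_mid ?i0 ?(ltnW il) // !dotE !dot_eps; try lia.
have -> : (i == i.+1) = false by lia.
have -> : (i == i.+2) = false by lia.
have -> : (i.+1 == i.+2) = false by lia.
by rewrite eqxx /=; ring.
Qed.

Lemma dot_end_self : (0 < l)%N -> dot (be l) (be l) = 1.
Proof. by move=> l0; rewrite std_simple_end // dot_eps ?eqxx ?l0 ?leqnn. Qed.

Lemma dot_end_prev : (2 <= l)%N -> dot (be l.-1) (be l) = -1.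
Proof.
move=> l2; have lB : (0 < l.-1 < l)%N by lia.
rewrite std_simple_mid // std_simple_end ?prednK // ?(ltnW l2) // !dotE !dot_eps; try lia.
have -> : (l.-1 == l) = false by lia.
by rewrite eqxx /=; ring.
Qed.

End StandardDots.

(** Squared lengths are 1, 2 or 4, so only a short root can be doubled: this leaves beta_l, and
    beta_0 for C^vee BC and C^vee C. For C^vee BC, 2 beta_0 = 2b - 2 eps_1 is excluded because the
    long period is 4. *)
Lemma root_double (K : realType) (X : nr_type) (l i : nat) : nr_rank_ok X l -> (i <= l)%N ->
  affine_roots K X l (2 *: std_simple K X l i) <->
  (i == l) || (if X is CvC then i == 0%N else false).
Proof.
move=> Xl il; have l0 : (0 < l)%N by move: Xl; case: (X) => //=; exact: leq_trans.
split=> [X2|].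
  have dot1 : dot (std_simple K X l i) (std_simple K X l i) = 1.
    have := affine_root_dot X2; rewrite dotZl dotZr.
    by case: (affine_root_dot (std_simple_root K Xl il)) => -> [] h; lra.
  case: eqVneq => [//|iNl] /=; have [i0|i0] := posnP i; last first.
    by move: dot1; rewrite dot_mid_self ?i0 ?ltn_neqAle ?iNl //; lra.
  move: X2 dot1; rewrite i0; case: (X) Xl => /= Xl X2; rewrite /std_simple /= !dotE !dot_eps ?Xl ?(leq_trans _ Xl) //=; try lra.
  move=> _; move: X2 => /affine_rootsP[n [u [v0 vS]]].
  have u2 : \sum_j u j ^+ 2 = 4.
    apply: (@intr_inj K); rewrite rmorph_sum.
    transitivity (dot (2 *: std_simple K CvBC l 0) (2 *: std_simple K CvBC l 0)).
      by apply: eq_bigr => j _; rewrite vS -intrM.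
    by rewrite !dotE !dot_eps ?Xl //; rewrite ?eqxx /=; ring.
  rewrite /root_coords u2 => -[//|[//]|[_ _]].
  have -> : n = 2; last by [].
  apply: (@intr_inj K); rewrite -v0 !(rVZ, rVD) vb0 -scaleN1r rVZ eps0 ?Xl //; ring.
rewrite affine_rootsE; case: eqVneq => [-> _|_ /=].
  rewrite std_simple_end //; right; exists (2 *: eps K l l), 0.
  by rewrite mulr0 mulr0z addr0; split=> //; exists l, false; rewrite l0 leqnn scale1r.
case: (X) => // /eqP ->; right; exists ((-1) ^+ true *: (2 *: eps K l 1)), 1.
split; first by exists 1%N, true.
rewrite /std_simple /= expr1 scaleN1r mulr1 scalerBr addrC.
by rewrite -scaler_int.
Qed.

(** * From the fibres of a system to its row *)

Section Realization.
Variables (K : realType) (F : vectType K) (I : {symmetric F}) (R : set F)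
  (G : {vspace F}) (a : F).
Hypothesis mR : mERS I R G.
Hypothesis ga : generated_by a (root_lattice R `&` [set` G]).
Local Notation pi := (quot_proj G).
Local Notation RG := (quot_roots G R).
Variables (X : nr_type) (l : nat) (f : {linear quot G -> 'rV[K]_l.+1}).
Hypothesis Xl : nr_rank_ok X l.
Hypothesis f_iso : root_system_iso RG (affine_roots K X l) f.
Variable alpha : 'I_l.+1 -> F.
Hypothesis alpha_dc : forall i, Rdc R (alpha i).
Hypothesis alpha_std : forall i : 'I_l.+1, f (pi (alpha i)) = std_simple K X l i.



Local Notation node := (node R G a alpha).
Variables (t : 'I_l.+1 -> node_type) (k : 'I_l.+1 -> nat).
Hypothesis nP : forall i, node i (t i) (k i).
Local Notation T := (fun i : nat => t (inord i)).
Local Notation Kk := (fun i : nat => k (inord i)).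

Lemma node_inord i : (i <= l)%N -> f (pi (alpha (inord i))) = std_simple K X l i.
Proof. by move=> il; rewrite alpha_std inordK. Qed.

Lemma edge_std (i j n : nat) : (i <= l)%N -> (j <= l)%N ->
  2 * dot (std_simple K X l i) (std_simple K X l j) =
    - n%:R * dot (std_simple K X l i) (std_simple K X l i) ->
  edge_ok n (T i) (Kk i) (T j) (Kk j).
Proof.
move=> il jl dE; have [c c0 cE] := form_dot mR Xl f_iso.
apply: (edge_constraints mR ga Xl alpha_dc _ (nP _) (nP _)).
by rewrite !cE !node_inord // mulrCA dE mulrCA.
Qed.

Lemma diagram_gcd (g : nat) : (forall i, (i <= l)%N -> (g %| Kk i)%N) -> g = 1%N.
Proof.
move=> h; apply: (gen_count_gcd mR ga Xl f_iso alpha_dc alpha_std nP) => i.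
by have := h i; rewrite inord_val -ltnS; apply.
Qed.

Lemma diagram_doubled i : (i <= l)%N ->
  doubled (T i) = (i == l) || (if X is CvC then i == 0%N else false).
Proof.
move=> il; apply/idP/idP.
  move=> /(doubled_RG ga (nP _)) /(quot_rootP f_iso).
  by rewrite linearZ /= node_inord // => /(root_double K Xl il).
move=> /(root_double K Xl il) h; apply/(doubled_RG ga (nP _)); apply/(quot_rootP f_iso).
by rewrite linearZ /= node_inord.
Qed.

Lemma realizes_diagram (r : Defs.row) : (forall i, 0 < k i)%N ->
  (forall i, (i <= l)%N -> diagram_row X l T Kk i = r i) ->
  realizes I R G a X alpha r.
Proof.
move=> k0 rE; split; first by exists f.
move=> i /=; have il : (i <= l)%N by rewrite -ltnS.
rewrite -(rE _ il) /diagram_row /class_data /diagram_class /= inord_val.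
split.
- exact: (colour_alpha ga Xl f_iso alpha_dc alpha_std (nP i) (k0 i)).
- exact: node_counting (nP i) (k0 i).
- exact: (star_counting mR ga Xl (nP i) (k0 i)).
have collE : collapsed I R G a alpha i <->
    has (lighter (node_weight X l i, t i, k i)) [seq diagram_class X l T Kk j | j <- iota 0 l.+1].
  rewrite (collapsedP mR ga Xl f_iso alpha_std i nP k0).
  split=> [[j jP]|/has_diagram[j jl jP]].
    have jl : (j <= l)%N by rewrite -ltnS.
    by apply/has_diagram; exists (j : nat); rewrite //= inord_val.
  by exists (inord j); rewrite inordK.
case: ifP => h; first by apply/collE.
split; first by move=> /collE h'; move: h; rewrite [X in X = _](h' : _ = true).
exact: (colour_star mR ga Xl f_iso alpha_dc alpha_std (nP i) (k0 i)).
Qed.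
End Realization.

(** * Numberings *)

Lemma diagram_row_ext (X : nr_type) (l : nat) (t t' : nat -> node_type) (k k' : nat -> nat) (i : nat) :
  (forall j, (j <= l)%N -> t j = t' j /\ k j = k' j) -> (i <= l)%N ->
  diagram_row X l t k i = diagram_row X l t' k' i.
Proof.
move=> e il; have ce j : (j <= l)%N -> diagram_class X l t k j = diagram_class X l t' k' j.
  by move=> /e[tE kE]; rewrite /diagram_class tE kE.
rewrite /diagram_row ce //; congr class_data; apply/eq_in_map => j.
by rewrite mem_iota => jl; apply: ce.
Qed.

Section Numbering.
Variables (K : realType) (F : vectType K) (I : {symmetric F}) (R : set F)
  (G : {vspace F}) (a : F).
Hypothesis mR : mERS I R G.
Hypothesis ga : generated_by a (root_lattice R `&` [set` G]).
Local Notation pi := (quot_proj G).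
Local Notation RG := (quot_roots G R).
Variables (X : nr_type) (l : nat).
Hypothesis Xl : nr_rank_ok X l.

Definition numbering (alpha : 'I_l.+1 -> F) (f : {linear quot G -> 'rV[K]_l.+1}) : Prop :=
  [/\ root_system_iso RG (affine_roots K X l) f,
      forall i, Rdc R (alpha i),
      forall i : 'I_l.+1, f (pi (alpha i)) = std_simple K X l i &
      forall i, (exists y, [/\ R y, pi y = pi (alpha i) & ~ R (2 *: y)]) ->
        ~ R (2 *: alpha i)].

Lemma iso_mulmx (f : {linear quot G -> 'rV[K]_l.+1}) (M : 'M[K]_l.+1) :
  root_system_iso RG (affine_roots K X l) f -> M \in unitmx ->
  (forall v, affine_roots K X l (v *m M) <-> affine_roots K X l v) ->
  exists g : {linear quot G -> 'rV[K]_l.+1},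
    root_system_iso RG (affine_roots K X l) g /\ forall y, g y = f y *m M.
Proof.
move=> [fb fX] Mu MX; exists (@mulmxr K 1 l.+1 l.+1 M \o f); split=> //; split.
  apply: bij_comp fb; exists (mulmx^~ (invmx M)) => v /=; first exact: mulmxK.
  exact: mulmxKV.
rewrite -[in RHS]fX; apply/seteqP; split=> [_ [y Ry <-]|_ [y Ry <-]] /=.
  have : affine_roots K X l (f y *m M) by apply/MX; rewrite -fX; exists y.
  by rewrite -fX.
have : affine_roots K X l (f y *m invmx M).
  by apply/MX; rewrite mulmxKV // -fX; exists y.
by rewrite -fX => -[y' Ry' y'E]; exists y' => //=; rewrite y'E mulmxKV.
Qed.

Section Swap.
Variables (alpha : 'I_l.+1 -> F) (f : {linear quot G -> 'rV[K]_l.+1}).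
Hypothesis num : numbering alpha f.
Variables (t : 'I_l.+1 -> node_type) (k : 'I_l.+1 -> nat).
Hypothesis nP : forall i, node R G a alpha i (t i) (k i).
Hypothesis k0 : forall i, (0 < k i)%N.

Lemma numbering_realizes (r : Defs.row) :
  (forall i, (i <= l)%N -> diagram_row X l (fun i => t (inord i)) (fun i => k (inord i)) i = r i) ->
  realizes I R G a X alpha r.
Proof.
have [f_iso dc std black] := num; move=> rE.
exact: (realizes_diagram mR ga Xl f_iso dc std nP k0 rE).
Qed.

End Swap.

(** Renumbering by [s] spoils the standard coordinates, and composing f with the automorphism [M]
    restores them; the fibres themselves are untouched. *)
Lemma swap_realizes (alpha : 'I_l.+1 -> F) (f : {linear quot G -> 'rV[K]_l.+1})
    (t : 'I_l.+1 -> node_type) (k : 'I_l.+1 -> nat) (M : 'M[K]_l.+1) (s : nat -> nat) (r : Defs.row) :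
  numbering alpha f -> (forall i, node R G a alpha i (t i) (k i)) -> (forall i, (0 < k i)%N) ->
  M \in unitmx -> (forall v, affine_roots K X l (v *m M) <-> affine_roots K X l v) ->
  (forall i, (i <= l)%N -> (s i <= l)%N /\
     std_simple K X l (s i) *m M = std_simple K X l i) ->
  (forall i, (i <= l)%N ->
     diagram_row X l (fun i => t (inord (s i))) (fun i => k (inord (s i))) i = r i) ->
  realizes I R G a X (fun i : 'I_l.+1 => alpha (inord (s i))) r.
Proof.
move=> [f_iso dc std black] nP k0 Mu MX sP rE.
have [g [g_iso gE]] := iso_mulmx f_iso Mu MX.
have ordl (i : 'I_l.+1) : (i <= l)%N by rewrite -ltnS.
have num : numbering (fun i : 'I_l.+1 => alpha (inord (s i))) g.
  split=> // [i|i]; last exact: black.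
  by have [si sE] := sP i (ordl i); rewrite gE std inordK.
apply: (numbering_realizes num (t := fun i : 'I_l.+1 => t (inord (s i))) (k := fun i => k (inord (s i)))) => //.
  by move=> i; exact: nP.
move=> i il; rewrite -rE //; apply: diagram_row_ext => // j jl.
by rewrite inordK.
Qed.

End Numbering.

(** * Diagram automorphisms *)

Section Reversal.
Variables (K : realType).

Lemma CvC_reversal (l : nat) : (0 < l)%N -> exists M : 'M[K]_l.+1,
  [/\ M \in unitmx, (forall v, affine_roots K CvC l (v *m M) <-> affine_roots K CvC l v) &
    forall i, (i <= l)%N -> std_simple K CvC l (l - i) *m M = std_simple K CvC l i].
Proof.
move=> l0; pose M := aut_mx K false (fun=> true) (fun=> -1) (perm (@rev_ord_inj l)).
exists M; split; first exact: aut_mx_unit.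
  by apply: aut_mx_roots; right.
have eM j : (1 <= j <= l)%N -> eps K l j *m M = vb K l - eps K l (l.+1 - j).
  case: j => // j jl; rewrite (eps_aut K _ _ _ _ (Ordinal jl)) permE /= expr1 scaleN1r opprD.
  rewrite intrN scaleNr scale1r opprK addrC; congr (_ - eps K l _); lia.
have bM : vb K l *m M = vb K l by rewrite vb_aut scale1r.
move=> i il; case: (posnP i) => [->|i0].
  by rewrite subn0 std_simple_end // eM ?l0 ?leqnn // subSnn.
case: (ltngtP i l) il => // [il|->] _; last first.
  rewrite subnn {1}/std_simple /= mulmxBl bM eM ?l0 // std_simple_end // subSS subn0.
  by rewrite opprB addrC subrK.
rewrite !std_simple_mid ?i0 //; last by lia.
rewrite mulmxBl !eM; try lia.
rewrite (_ : l.+1 - (l - i) = i.+1)%N; last by lia.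
rewrite (_ : l.+1 - (l - i).+1 = i)%N; last by lia.
by rewrite opprB addrC addrA subrK.
Qed.

(** Sending eps_1 to b - eps_1 and fixing b and eps_2 exchanges b - eps_1 - eps_2 with eps_1 -
    eps_2. *)
Lemma BBv2_reversal : exists M : 'M[K]_3,
  [/\ M \in unitmx, (forall v, affine_roots K BBv 2 (v *m M) <-> affine_roots K BBv 2 v) &
    forall i, (i <= 2)%N ->
      std_simple K BBv 2 (if i < 2 then 1 - i else i)%N *m M = std_simple K BBv 2 i].
Proof.
pose M := @aut_mx K 2 false (fun j => j == 0 :> nat) (fun j => if j == 0 :> nat then -1 else 0) 1%g.
exists M; split; first exact: aut_mx_unit.
  by apply: aut_mx_roots; left=> j; exact: dvd1z.
have bM : vb K 2 *m M = vb K 2 by rewrite vb_aut scale1r.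
have e1 : eps K 2 1 *m M = vb K 2 - eps K 2 1.
  rewrite (eps_aut K _ _ _ _ (Ordinal (isT : 0 < 2)%N)) perm1 /= expr1 scaleN1r opprD.
  by rewrite intrN scaleNr scale1r opprK addrC.
have e2 : eps K 2 2 *m M = eps K 2 2.
  by rewrite (eps_aut K _ _ _ _ (Ordinal (isT : 1 < 2)%N)) perm1 /= expr0 scale1r scale0r addr0.
case=> [|[|[|i]]] //= _; rewrite /std_simple /= ?mulmxBl ?bM ?e1 ?e2 //.
by rewrite opprB [vb K 2 + _]addrC subrK.
Qed.
End Reversal.

(** * Assembling the types and choosing the numbering *)

Section Classification.
Variables (K : realType) (F : vectType K) (I : {symmetric F}) (R : set F)
  (G : {vspace F}) (a : F).
Hypothesis mR : mERS I R G.
Hypothesis ga : generated_by a (root_lattice R `&` [set` G]).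
Local Notation pi := (quot_proj G).
Local Notation RG := (quot_roots G R).
Variables (X : nr_type) (l : nat).
Hypothesis Xl : nr_rank_ok X l.

Let l_gt0 : (0 < l)%N. Proof. by move: Xl; case: X => //=; exact: leq_trans. Qed.

(** Only types, counting numbers and standard inner products remain here. The involution [s] comes
    with an automorphism of X_l compensating it, as [swap_realizes] requires. *)
Lemma diagram_classification (t : nat -> node_type) (k : nat -> nat) :
  (forall i, (i <= l)%N ->
     doubled (t i) = (i == l) || (if X is CvC then i == 0%N else false)) ->
  (forall g, (forall i, (i <= l)%N -> (g %| k i)%N) -> g = 1%N) ->
  (forall i j n : nat, (i <= l)%N -> (j <= l)%N ->
     2 * dot (std_simple K X l i) (std_simple K X l j) =
       - n%:R * dot (std_simple K X l i) (std_simple K X l i) ->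
     edge_ok n (t i) (k i) (t j) (k j)) ->
  (forall i, (i <= l)%N -> (0 < k i)%N) /\
  (row_in l (diagram_row X l t k) (rows X l) \/
   exists s : nat -> nat, [/\ forall i, (i <= l)%N -> (s i <= l)%N /\ s (s i) = i,
     exists M : 'M[K]_l.+1, [/\ M \in unitmx,
       (forall v, affine_roots K X l (v *m M) <-> affine_roots K X l v) &
       forall i, (i <= l)%N -> std_simple K X l (s i) *m M = std_simple K X l i] &
     row_in l (diagram_row X l (t \o s) (k \o s)) (rows X l)]).
Proof.
move=> dbl gcd edge.
have T_end : doubled (t l) by rewrite dbl // eqxx.
have T_white i : (i < l)%N -> ~~ doubled (t i) -> t i = WW by case: (t i).
have T_mid i : (0 < i < l)%N -> t i = WW.
  move=> /andP[i0 il]; apply: T_white => //; rewrite dbl ?(ltnW il) // ltn_eqF //=.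
  by case: (X) => //; rewrite gtn_eqF.
have E_mid i : (0 < i)%N -> (i.+1 < l)%N ->
    edge_ok 1 (t i) (k i) (t i.+1) (k i.+1) && edge_ok 1 (t i.+1) (k i.+1) (t i) (k i).
  move=> i0 il; apply/andP; split; apply: edge; rewrite ?(ltnW il) // ?(ltnW (ltnW il)) //.
    by rewrite dot_mid_next // dot_mid_self ?i0 ?(ltnW il) //; ring.
  by rewrite dotC dot_mid_next // dot_mid_self //; ring.
have E_end : (2 <= l)%N -> edge_ok 1 (t l.-1) (k l.-1) (t l) (k l) && edge_ok 2 (t l) (k l) (t l.-1) (k l.-1).
  move=> l2; have lB : (0 < l.-1 < l)%N by lia.
  apply/andP; split; apply: edge; rewrite ?leq_pred //.
    by rewrite dot_end_prev // dot_mid_self //; ring.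
  by rewrite dotC dot_end_prev // dot_end_self //; ring.
have edge2 i j m n : (i <= l)%N -> (j <= l)%N ->
    2 * dot (std_simple K X l i) (std_simple K X l j) =
      - m%:R * dot (std_simple K X l i) (std_simple K X l i) ->
    2 * dot (std_simple K X l i) (std_simple K X l j) =
      - n%:R * dot (std_simple K X l j) (std_simple K X l j) ->
    edge_ok m (t i) (k i) (t j) (k j) && edge_ok n (t j) (k j) (t i) (k i).
  move=> il jl e1 e2; apply/andP; split; apply: edge => //.
  by rewrite dotC.
have one : (1 <= 1 <= l)%N by [].
(* Outside BB^vee, beta_0 is a multiple of eps_1 modulo the radical vector b. *)
have dot0 : X <> BBv -> forall j, (0 < j <= l)%N ->
   dot (std_simple K X l 0) (std_simple K X l j) = (if X is BCC then -2 else -1) * dot (eps K l 1) (std_simple K X l j)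
   /\ dot (std_simple K X l 0) (std_simple K X l 0) = (if X is BCC then 4 else 1).
  by move=> Xn j jB; rewrite {1 3 4}/std_simple /=; case: (X) Xn => // _; rewrite !dotE !dot_eps //=; split; ring.
have mid1 : (2 <= l)%N -> dot (eps K l 1) (std_simple K X l 1) = 1.
  move=> l2; rewrite std_simple_mid // dotBr !dot_eps //=; ring.
have end1 : l = 1%N -> dot (eps K l 1) (std_simple K X l l) = 1.
  by move=> ll; rewrite std_simple_end // dot_eps ?ll.
case XE: X Xl T_white => Xl' T_white.
- have T0 : t 0%N = WW by apply: T_white => //; rewrite dbl // XE ltn_eqF.
  have [] := BCC_rows gcd T_end l_gt0 T_mid E_mid E_end T0 _ _; last by move=> k0 hr; split=> //; left.
    move=> l2; have [e0 e00] := dot0 (ltac:(by rewrite XE)) 1%N one.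
    by apply: edge2 => //; rewrite e0 mid1 // ?e00 ?dot_mid_self // XE; ring.
  move=> ll; have [|e0 e00] := dot0 (ltac:(by rewrite XE)) l; first by rewrite l_gt0 leqnn.
  by apply: edge2 => //; rewrite e0 end1 // ?e00 ?dot_end_self // XE; ring.
- have T0 : t 0%N = WW by apply: T_white => //; rewrite dbl // XE ltn_eqF.
  have [] := CvBC_rows gcd T_end l_gt0 T_mid E_mid E_end T0 _ _; last by move=> k0 hr; split=> //; left.
    move=> l2; have [e0 e00] := dot0 (ltac:(by rewrite XE)) 1%N one.
    by apply: edge2 => //; rewrite e0 mid1 // ?e00 ?dot_mid_self // XE; ring.
  move=> ll; have [|e0 e00] := dot0 (ltac:(by rewrite XE)) l; first by rewrite l_gt0 leqnn.
  by apply: edge2 => //; rewrite e0 end1 // ?e00 ?dot_end_self // XE; ring.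
- have T_lt i : (i < l)%N -> t i = WW.
    by move=> il; apply: T_white => //; rewrite dbl ?(ltnW il) // XE ltn_eqF.
  have two : (1 <= 2 <= l)%N by [].
  have d00 : dot (std_simple K X l 0) (std_simple K X l 0) = 2.
    by rewrite XE /std_simple /= !dotE !dot_eps //=; ring.
  have d11 : dot (std_simple K X l 1) (std_simple K X l 1) = 2 by rewrite dot_mid_self.
  have d0 j : dot (std_simple K X l 0) (std_simple K X l j) =
      - dot (eps K l 1) (std_simple K X l j) - dot (eps K l 2) (std_simple K X l j).
    by rewrite {1}XE {1}/std_simple /= !dotE; ring.
  have [l3|l3] := leqP 3 l.
    have d02 : dot (std_simple K X l 0) (std_simple K X l 2) = -1.
      by rewrite d0 std_simple_mid // !dotE !dot_eps //=; ring.
    have d12 : dot (std_simple K X l 1) (std_simple K X l 2) = -1 by rewrite dot_mid_next.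
    have d22 : dot (std_simple K X l 2) (std_simple K X l 2) = 2 by rewrite dot_mid_self.
    have [] := BBv_rows gcd T_end l3 T_lt _ (E_end Xl') _ _; last by move=> k0 hr; split=> //; left.
    + by move=> i i2 il; apply: E_mid => //; exact: leq_trans i2.
    + by apply: edge2 => //; rewrite d02 ?d00 ?d22; ring.
    + by apply: edge2 => //; rewrite d12 ?d11 ?d22; ring.
  have l2 : l = 2%N by lia.
  have d02 : dot (std_simple K X l 0) (std_simple K X l l) = -1.
    by rewrite d0 std_simple_end // !dot_eps ?l_gt0 ?leqnn // l2 /=; ring.
  have d12 : dot (std_simple K X l 1) (std_simple K X l l) = -1.
    by rewrite -(dot_end_prev K X Xl') (_ : l.-1 = 1%N) // l2.
  have dll : dot (std_simple K X l l) (std_simple K X l l) = 1 by rewrite dot_end_self.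
  have [] := BBv2_rows gcd T_end l2 T_lt _ _.
  + by apply: edge2 => //; rewrite d02 ?d00 ?dll; ring.
  + by apply: edge2 => //; rewrite d12 ?d11 ?dll; ring.
  move=> k0 [hr|hr]; split=> //; [by left|right].
  exists (fun i => if (i < l)%N then (1 - i)%N else i); split=> //.
    by move=> i il; rewrite l2; case: i il => [|[|[|i]]]; rewrite l2.
  by rewrite l2; exact: BBv2_reversal.
- have T0 : doubled (t 0%N) by rewrite dbl // XE orbT.
  have [] := CvC_rows gcd T_end l_gt0 T_mid E_mid E_end T0 _ _.
  + move=> l2; have [e0 e00] := dot0 (ltac:(by rewrite XE)) 1%N one.
    by apply: edge2 => //; rewrite e0 mid1 // ?e00 ?dot_mid_self // XE; ring.
  + move=> ll; have [|e0 e00] := dot0 (ltac:(by rewrite XE)) l; first by rewrite l_gt0 leqnn.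
    by apply: edge2 => //; rewrite e0 end1 // ?e00 ?dot_end_self // XE; ring.
  move=> k0 [hr|hr]; split=> //; [by left|right].
  exists (fun i => (l - i)%N); split=> //; last exact: CvC_reversal.
  by move=> i il; rewrite leq_subr subKn.
Qed.
End Classification.

Lemma inord_inord (l : nat) (s : nat -> nat) :
  (forall i, (i <= l)%N -> (s i <= l)%N /\ s (s i) = i) ->
  forall i : 'I_l.+1, inord (s (inord (s i) : 'I_l.+1)) = i.
Proof.
move=> sP i; have il : (i <= l)%N by rewrite -ltnS.
have [si ss] := sP i il; rewrite [in s _]inordK ?ltnS // ss; exact: inord_val.
Qed.

Section Final.
Variables (K : realType) (F : vectType K) (I : {symmetric F}) (R : set F)
  (G : {vspace F}) (a : F).
Hypothesis mR : mERS I R G.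
Hypothesis ga : generated_by a (root_lattice R `&` [set` G]).
Local Notation pi := (quot_proj G).
Local Notation RG := (quot_roots G R).
Variables (X : nr_type) (l : nat).
Hypothesis Xl : nr_rank_ok X l.

Lemma numbering_realizes_row (alpha : 'I_l.+1 -> F) (f : {linear quot G -> 'rV[K]_l.+1}) :
  numbering R X alpha f -> injective alpha ->
  exists alpha' : 'I_l.+1 -> F, [/\ injective alpha', range alpha' = range alpha &
    exists2 r, List.In r (rows X l) & realizes I R G a X alpha' r].
Proof.
move=> num alpha_inj; have [f_iso dc std black] := num.
have ex i := node_exists mR ga Xl dc black i.
pose t i := projT1 (cid (ex i)); have tE i : exists k, node R G a alpha i (t i) k := projT2 (cid (ex i)).
pose k i := projT1 (cid (tE i)); have nP i : node R G a alpha i (t i) (k i) := projT2 (cid (tE i)).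
have [||i j n il jl|k0 [[r rin rE]|[s [sP [M [Mu MX bM]] [r rin rE]]]]] :=
  @diagram_classification K X l Xl (fun i => t (inord i)) (fun i => k (inord i)).
- exact: (diagram_doubled ga Xl f_iso std nP).
- exact: (diagram_gcd mR ga Xl f_iso dc std nP).
- exact: (edge_std mR ga Xl f_iso dc std nP).
all: have k_gt0 i : (0 < k i)%N by have := k0 i; rewrite inord_val -ltnS; apply.
- exists alpha; split=> //; exists r => //.
  exact: (numbering_realizes mR ga Xl num nP k_gt0).
- have sK := inord_inord sP.
  exists (fun i : 'I_l.+1 => alpha (inord (s i))); split.
  + by move=> i j /alpha_inj ij; rewrite -[i]sK -[j]sK ij.
  + apply/seteqP; split=> _ [i _ <-]; first by exists (inord (s i)).
    by exists (inord (s i)) => //; rewrite sK.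
  + exists r => //; apply: (swap_realizes mR ga Xl num nP k_gt0 Mu MX) => // i il.
    by split; [have [] := sP i il|exact: bM].
Qed.

(** Squared lengths of roots never differ by a factor 16. It ensures that half of a root, if a root,
    belongs to R^dc. *)
Lemma affine_root_half (v : 'rV[K]_l.+1) : affine_roots K X l v ->
  ~ affine_roots K X l (2^-1 *: (2^-1 *: v)).
Proof.
move=> /affine_root_dot h1 /affine_root_dot; rewrite !dotZl !dotZr => h2.
by case: h1 => e1; rewrite e1 in h2; case: h2 => e2; lra.
Qed.

(** Transported by f, the image of [Pdc] is a simple system of X_l, which [simple_system_conj]
    identifies with the standard one up to [M]; f is then corrected by the inverse of [M], and the
    numbering is lifted back to [Pdc]. *)
Lemma numbering_exists (f : {linear quot G -> 'rV[K]_l.+1}) (Pdc Pmc : set F) :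
  root_system_iso RG (affine_roots K X l) f -> paired_simple_system R G a Pdc Pmc ->
  exists (alpha : 'I_l.+1 -> F) (g : {linear quot G -> 'rV[K]_l.+1}),
    [/\ injective alpha, Pdc = range alpha & numbering R X alpha g].
Proof.
move=> f_iso [Pdc_dc Pdc_inj [_ [s [sE s_basis s_sign]]] Pdc_black _].
have [fb fX] := f_iso.
have fs_basis : basis_of fullv [seq f y | y <- s].
  have : basis_of (linfun f @: fullv)%VS [seq linfun f y | y <- s].
    apply: limg_basis_of s_basis; apply/eqP; rewrite -subv0; apply/subvP => y.
    rewrite memv_cap memv_ker lfunE memv0 => /andP[_ /eqP f0].
    by apply/eqP; apply: (bij_inj fb); rewrite /= f0 linear0.
  rewrite (eq_map (lfunE f)) (_ : limg _ = fullv) //; apply/vspaceP => v; rewrite memvf.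
  have [fi _ fiK] := fb; have := memv_img (linfun f) (memvf (fi v)).
  by rewrite lfunE /= fiK.
have size_s : size s = l.+1.
  have := size_basis (X := in_tuple _) fs_basis.
  by rewrite size_map dimvf /dim /= mul1n => <-.
case: (ltac:(by exists (Tuple (introT eqP size_s))) : exists u : l.+1.-tuple (quot G), s = u) => u uE.
subst s; pose w : l.+1.-tuple 'rV[K]_l.+1 := [tuple of [seq f y | y <- u]].
have wE (i : 'I_l.+1) : w`_i = f u`_i by rewrite (nth_map 0) // size_tuple.
have u_Pdc (i : 'I_l.+1) : exists2 x, Pdc x & pi x = u`_i.
  have : (pi @` Pdc) u`_i by rewrite sE /=; apply: mem_nth; rewrite size_tuple.
  by case=> x Px xE; exists x.
have sign_dc x : Rdc R x -> exists c : 'I_l.+1 -> int,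
    f (pi x) = \sum_(i < l.+1) w`_i *~ c i /\ same_sign c.
  move=> Rx; have [|c [cE cs]] := s_sign (pi x); first by exists x.
  pose cc (i : 'I_l.+1) := c (cast_ord (esym (size_tuple u)) i).
  exists cc; split; last by case: cs => h; [left|right] => i; exact: h.
  rewrite cE linear_sum (reindex (cast_ord (esym (size_tuple u)))) /=; last first.
    apply: onW_bij; exists (cast_ord (size_tuple u)) => i; exact: val_inj.
  by apply: eq_bigr => i _; rewrite wE raddfMz.
(* The simple system is given for R^dc/G only; the remaining roots are doubles of roots in R^dc, so
   their coefficients are doubled. *)
have w_sign v : affine_roots K X l v -> exists c : 'I_l.+1 -> int,
    v = \sum_(i < l.+1) w`_i *~ c i /\ same_sign c.
  move=> /(root_coordP f_iso)[x Rx <-].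
  have [Rh|nRh] := pselect (R (2^-1 *: x)); last exact: sign_dc.
  have Xx : affine_roots K X l (f (pi x)) by apply/(root_coordP f_iso); exists x.
  have [|c [cE cs]] := sign_dc (2^-1 *: x).
    split=> // R4; apply: (affine_root_half Xx).
    by apply/(root_coordP f_iso); exists (2^-1 *: (2^-1 *: x)) => //; rewrite !linearZ.
  exists (fun i => c i * 2); split.
    have -> : x = (2^-1 *: x) *~ 2.
      by rewrite -scaler_int scalerA mulfV ?pnatr_eq0 // scale1r.
    rewrite !raddfMz /= cE mulrz_suml; apply: eq_bigr => i _.
    by rewrite mulrzA.
  by case: cs => h; [left|right] => i; have := h i; lia.
have w_root (i : 'I_l.+1) : affine_roots K X l w`_i.
  have [x Px xE] := u_Pdc i; rewrite wE -xE; apply/(root_coordP f_iso).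
  by exists x => //; have [] := Pdc_dc x Px.
have [M [Mu MX [q [q_inj qE]]]] := simple_system_conj Xl fs_basis w_root w_sign.
have [||g [g_iso gE]] := iso_mulmx f_iso (M := invmx M).
- by rewrite unitmx_inv.
- by move=> v; rewrite -(MX (v *m _)) mulmxKV.
have ex (i : 'I_l.+1) : exists x, Pdc x /\ pi x = u`_(q i).
  by have [x Px xE] := u_Pdc (q i); exists x.
pose alpha i := projT1 (cid (ex i)).
have aP i : Pdc (alpha i) := (projT2 (cid (ex i))).1.
have aE i : pi (alpha i) = u`_(q i) := (projT2 (cid (ex i))).2.
have u_uniq : uniq u by exact: (free_uniq (basis_free s_basis)).
exists alpha, g; split.
- move=> i j ij; apply: q_inj; have := aE i; rewrite ij aE => /eqP.
  by rewrite nth_uniq ?size_tuple // => /eqP/val_inj.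
- apply/seteqP; split=> [x Px|_ [i _ <-]]; last exact: aP.
  have : (pi @` Pdc) (pi x) by exists x.
  rewrite sE /= => /(nthP 0)[j]; rewrite size_tuple => jl jE.
  exists (invF q_inj (Ordinal jl)) => //; apply: Pdc_inj => //.
  by rewrite aE f_invF.
- split=> //.
  + by move=> i; exact: Pdc_dc.
  + by move=> i; rewrite gE aE -wE -qE mulmxK.
  + by move=> i; apply: Pdc_black; exact: aP.
Qed.
End Final.

Lemma In_tnth (T : Type) (x : T) (s : seq T) : List.In x s ->
  exists k : 'I_(size s), tnth (in_tuple s) k = x.
Proof.
elim: s => //= y s IH [->|/IH[k <-]]; first by exists ord0.
by exists (lift ord0 k); rewrite !(tnth_nth x).
Qed.

Theorem theorem8p12 (K : realType) (F : vectType K) (I : {symmetric F})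
    (R : set F) (G : {vspace F}) (a : F) (X : nr_type) (l : nat)
    (Pdc Pmc : set F) :
  mERS I R G ->
  generated_by a (root_lattice R `&` [set` G]) ->
  ~ reduced (quot_roots G R) ->
  nr_rank_ok X l ->
  (exists f : {linear quot G -> 'rV[K]_l.+1},
     root_system_iso (quot_roots G R) (affine_roots K X l) f) ->
  paired_simple_system R G a Pdc Pmc ->
  exists alpha : 'I_l.+1 -> F,
    [/\ injective alpha, Pdc = range alpha &
        exists k : 'I_(size (rows X l)),
          realizes I R G a X alpha (tnth (in_tuple (rows X l)) k)].
Proof.
move=> mR ga _ Xl [f f_iso] pss.
have [alpha [g [alpha_inj -> num]]] := numbering_exists Xl f_iso pss.
have [alpha' [inj' rng [r rin rP]]] := numbering_realizes_row mR ga Xl num alpha_inj.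
have [k kE] := In_tnth rin.
by exists alpha'; split; [|rewrite rng|exists k; rewrite kE].
Qed.
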